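(* For every Borel set $X\subseteq {}^*\mathbb N$ there is a Borel cut $U\subseteq{}^*\mathbb N$ with $X\sim_{\mathrm B} U$; in fact there is a $\subseteq$-minimal Borel cut $U$ satisfying $X\sim_{\mathrm B}U$.
   Context: Work in a fixed countably saturated nonstandard universe; ${}^*\mathbb N$ is the set of hyperintegers, $\mathbb N\subseteq{}^*\mathbb N$ the standard ones. Internal sets are the elements of the internal universe. The Borel subsets of an internal set form the smallest $\sigma$-algebra containing all its internal subsets. A map is Borel if its graph is Borel. For sets $X,Y$: $X\le_{\mathrm B}Y$ means there is a Borel injection $X\to Y$; $X\sim_{\mathrm B}Y$ means $X\le_{\mathrm B}Y$ and $Y\le_{\mathrm B}X$. A cut is an initial segment of ${}^*\mathbb N$ (including $\emptyset$, $\mathbb N$, ${}^*\mathbb N$). *)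

(* Defs.v *)
From mathcomp Require Import all_boot.
From mathcomp Require Import boolp classical_sets functions.
From mathcomp Require Import measurable_structure.

Set Implicit Arguments.
Unset Strict Implicit.
Unset Printing Implicit Defensive.

Local Open Scope classical_set_scope.

Definition elts T (mem : T -> T -> Prop) (a : T) : set T := [set x | mem x a].

(* The finite levels of a superstructure: V_0 is the set of atoms and
   V_(n+1) is the union of V_n and its power set. *)
Fixpoint level B T (mem : T -> T -> Prop) (atom : B -> T) (n : nat) : set T :=
  if n is m.+1 then
    level mem atom m `|` [set a | elts mem a `<=` level mem atom m]
  else range atom.

(* The superstructure over a set of atoms containing a copy of the natural
   numbers. The axioms determine it up to isomorphism from [sbase] (the set of
   atoms) and [snum] (the natural numbers among the atoms). *)
Record superstructure := Superstructure {
  sbase : Type;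
  snum : nat -> sbase;
  sterm :> Type;
  smem : sterm -> sterm -> Prop;
  satom : sbase -> sterm;
  snum_inj : injective snum;
  satom_inj : injective satom;
  satom_no_elts : forall b, elts smem (satom b) = set0;
  sset_ext : forall a b, ~ range satom a -> ~ range satom b ->
    elts smem a = elts smem b -> a = b;
  sfinite_rank : forall a, exists n, level smem satom n a;
  spowerset : forall n (A : set sterm), A `<=` level smem satom n ->
    exists a, ~ range satom a /\ elts smem a = A
}.

(* Bounded formulas of the language {\in, =}, with de Bruijn variables:
   [BAll i f] is "for all x in v_i, f", where x is variable 0 of [f] and the
   other variables are shifted by one. *)
Inductive bformula : Type :=
  | BMem of nat & nat
  | BEq of nat & nat
  | BNot of bformula
  | BAnd of bformula & bformula
  | BAll of nat & bformula.

Definition scons T (x : T) (e : nat -> T) (i : nat) : T :=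
  if i is j.+1 then e j else x.

Fixpoint sat T (mem : T -> T -> Prop) (e : nat -> T) (f : bformula) : Prop :=
  match f with
  | BMem i j => mem (e i) (e j)
  | BEq i j => e i = e j
  | BNot g => ~ sat mem e g
  | BAnd g h => sat mem e g /\ sat mem e h
  | BAll i g => forall x, mem x (e i) -> sat mem (scons x e) g
  end.

(* A countably saturated nonstandard universe over [V]. The type [internal]
   consists of the elements of the sets [star a], a in V. [imem] need not be
   literal membership: by transfer and [internal_star], it is extensional
   away from the elements of the star of the set of atoms, and of finite rank
   over them, so that an internal object [a] can be identified with its
   external extension [elts imem a]. *)
Record nonstandard_universe (V : superstructure) := NonstandardUniverse {
  internal :> Type;
  imem : internal -> internal -> Prop;
  star : V -> internal;
  transfer : forall (f : bformula) (e : nat -> V),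
    sat (@smem V) e f <-> sat imem (star \o e) f;
  internal_star : forall x, exists a : V, imem x (star a);
  countably_saturated : forall A : nat -> internal,
    (forall n, exists x, forall k, (k <= n)%N -> imem x (A k)) ->
    exists x, forall k, imem x (A k)
}.

(* Unordered pairs and Kuratowski ordered pairs, for standard and internal
   membership alike. *)
Definition is_upair T (mem : T -> T -> Prop) (p x y : T) : Prop :=
  elts mem p = [set x; y].

Definition is_pair T (mem : T -> T -> Prop) (p x y : T) : Prop :=
  exists a b, [/\ is_upair mem a x x, is_upair mem b x y & is_upair mem p a b].

Section Standard.
Variable V : superstructure.

Definition num (n : nat) : V := satom (snum V n).

(* The element of V with extension [A]; a junk value when [A] is not contained
   in a level of V. *)
Definition setof (A : set V) : V :=
  if pselect (exists a, ~ range (@satom V) a /\ elts (@smem V) a = A)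
    is left ex then sval (cid ex) else num 0.

Definition naturals : V := setof (range num).

Definition nat_lt : V :=
  setof [set p | exists m n, (m < n)%N /\ is_pair (@smem V) p (num m) (num n)].

Lemma elts_setof n (A : set V) :
  A `<=` level (@smem V) (@satom V) n -> elts (@smem V) (setof A) = A.
Proof.
move=> /spowerset ex; rewrite /setof; case: pselect => [{}ex|//].
by case: (svalP (cid ex)).
Qed.

Lemma elts_naturals : elts (@smem V) naturals = range num.
Proof. by apply: (@elts_setof 0) => _ [n _ <-]; exists (snum V n). Qed.

Lemma elts_nat_lt : elts (@smem V) nat_lt =
  [set p | exists m n, (m < n)%N /\ is_pair (@smem V) p (num m) (num n)].
Proof.
have atomE n : level (@smem V) (@satom V) 0 (num n) by exists (snum V n).
apply: (@elts_setof 2) => p [m [n [_ [a [b [amm bmn pab]]]]]]; right.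
by rewrite /= pab => _ [->|->]; right; rewrite /= ?amm ?bmn => _ [->|->].
Qed.

End Standard.

Section Internal.
Variables (V : superstructure) (W : nonstandard_universe V).

Definition iset (a : W) : set W := elts (@imem V W) a.

Definition hypernat : W := star W (naturals V).

Definition hlt (x y : W) : Prop :=
  exists p, is_pair (@imem V W) p x y /\ imem p (star W (nat_lt V)).

Definition internal_subset (Z : W) : set (set W) :=
  [set A | A `<=` iset Z /\ range iset A].

Definition borel_in (Z : W) : set (set W) := <<s iset Z, internal_subset Z>>.

Definition borel (A : set W) : Prop := exists Z, borel_in Z A.

Definition graph (X : set W) (f : W -> W) : set W :=
  [set p | exists x, X x /\ is_pair (@imem V W) p x (f x)].

(* Only the restriction of [f] to [X] matters. *)
Definition borel_le (X Y : set W) : Prop :=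
  exists f : W -> W, [/\ set_fun X Y f, set_inj X f & borel (graph X f)].

Definition borel_equiv (X Y : set W) : Prop := borel_le X Y /\ borel_le Y X.

Definition cut (U : set W) : Prop :=
  U `<=` iset hypernat /\
  forall x y, iset hypernat x -> U y -> hlt x y -> U x.

Definition borel_cut (U : set W) : Prop := cut U /\ borel_in hypernat U.

End Internal.

Arguments hypernat {V} W.

(* Main.v *)
(* The minimal cut U consists of all x such that (n + 1) x < n |A| for some
   standard n and some hyperfinite internal A contained in X.

   If the cut of all sizes |A| is closed under doubling, it equals U and has
   countable cofinality or coinitiality.  In the first case a perfect-set type
   dichotomy for Souslin sets covers X by countably many internal sets of size in
   U; in the second it gives a decreasing sequence of internal sets inside X with
   sizes coinitial above U, while Loeb measurability gives one around X.
   Otherwise the sizes are bounded by a multiple of one of them, c, and X is an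
   increasing union of internal sets plus a set that is Loeb null at scale c,
   which Hilbert's hotel absorbs.

   For minimality, a Borel injection is covered by countably many internal ones,
   hence it preserves Loeb measure, and a set of size |A| does not inject into
   [0, x) when (n + 1) x < n |A|. *)
Require Import Defs.
From mathcomp Require Import all_boot.
From mathcomp Require Import boolp classical_sets functions.
From mathcomp Require Import measurable_structure zify.

Set Implicit Arguments.
Unset Strict Implicit.
Unset Printing Implicit Defensive.

Local Open Scope classical_set_scope.

(** * Transfer of bounded formulas *)

(** Exact sizes are not invariant under Borel equivalence: a remainder that is null relative to |A|
    can be absorbed, so |A| counts only up to an infinitesimal relative error. Hence the factors n
    and n + 1 in the cut: they leave a gap of noninfinitesimal relative width, which is what an
    argument by measure can detect. When the sizes are closed under doubling, the gap costs nothing.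

    Transfer applies to bounded formulas only, and internal membership need not be literal. The work
    is therefore done in second-order arithmetic: variables range over hyperintegers and over
    internal sets of hyperintegers, every standard function and relation has a symbol, and pairs are
    replaced by numerical codes, so that graphs are again sets of hyperintegers. Borel subsets of
    [W] and Kuratowski pairs return only in the final translation.

    Composing arbitrary Borel injections involves projections. The equivalence of X with its cut is
    therefore built from piecewise internal injections, which compose well; general Borel injections
    occur only in the minimality argument. *)

Definition mix T (e c : nat -> T) (i : nat) : T :=
  if odd i then c i./2 else e i./2.

Lemma mix_even T (e c : nat -> T) i : mix e c i.*2 = e i.
Proof. by rewrite /mix odd_double doubleK. Qed.

Lemma mix_odd T (e c : nat -> T) i : mix e c i.*2.+1 = c i.
Proof. by rewrite /mix /= odd_double uphalf_double. Qed.

Lemma nat_parity i : i = i./2.*2 \/ i = i./2.*2.+1.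
Proof. by rewrite -{1 3}(odd_double_half i); case: odd; [right | left]. Qed.

Lemma comp_mix T S (h : T -> S) e c : h \o mix e c = mix (h \o e) (h \o c).
Proof. by apply: funext => i; rewrite /mix /=; case: odd. Qed.

Lemma comp_scons T S (h : T -> S) x e : h \o scons x e = scons (h x) (h \o e).
Proof. by apply: funext => -[]. Qed.

Definition lift_var (r : nat -> nat) (i : nat) : nat :=
  if i is j.+1 then (r j).+1 else 0.

Fixpoint bren (r : nat -> nat) (f : bformula) : bformula :=
  match f with
  | BMem i j => BMem (r i) (r j)
  | BEq i j => BEq (r i) (r j)
  | BNot g => BNot (bren r g)
  | BAnd g h => BAnd (bren r g) (bren r h)
  | BAll i g => BAll (r i) (bren (lift_var r) g)
  end.

Lemma sat_bren T (mem : T -> T -> Prop) f r e :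
  sat mem e (bren r f) <-> sat mem (e \o r) f.
Proof.
elim: f r e => //= [f IH|f IHf g IHg|i f IH] r e.
- by rewrite IH.
- by rewrite IHf IHg.
- have E x : scons x e \o lift_var r = scons x (e \o r).
    by apply: funext => -[].
  by split=> H x xe; have := H x xe; rewrite IH E.
Qed.

(** A formula sees finitely many variables, so [def_valid] can bind all of them by finitely many
    quantifiers. *)
Lemma sat_support (f : bformula) : exists K, forall T (mem : T -> T -> Prop) e e',
  (forall i, (i < K)%N -> e i = e' i) -> sat mem e f <-> sat mem e' f.
Proof.
elim: f => [i j|i j|f [K IH]|f [K IHf] g [L IHg]|i f [K IH]].
- by exists (i + j).+1 => T mem e e' E /=; rewrite !E //; lia.
- by exists (i + j).+1 => T mem e e' E /=; rewrite !E //; lia.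
- by exists K => T mem e e' E /=; rewrite (IH _ mem e e').
- exists (K + L) => T mem e e' E /=.
  rewrite (IHf _ mem e e') ?(IHg _ mem e e') // => j jK; apply: E; lia.
- exists (K + i).+1 => T mem e e' E /=; rewrite (E i); last lia.
  have F x : sat mem (scons x e) f <-> sat mem (scons x e') f.
    by apply: IH => -[|j] //= jK; apply: E; lia.
  by split=> H x xe; apply/F/H.
Qed.

Section Transfer.
Variables (V : superstructure) (W : nonstandard_universe V).
Local Notation smem := (@smem V).
Local Notation imem := (@imem V W).
Local Notation star := (@star V W).

(* [P] and [Q] are the standard and the internal meaning of one bounded
   formula, whose constants sit at the odd indices of [mix]. *)
Definition def (P : (nat -> V) -> Prop) (Q : (nat -> W) -> Prop) :=
  exists f c, (forall e, P e <-> sat smem (mix e c) f) /\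
              (forall e, Q e <-> sat imem (mix e (star \o c)) f).

Lemma def_iff P' Q' P Q : def P' Q' -> (forall e, P e <-> P' e) ->
  (forall e, Q e <-> Q' e) -> def P Q.
Proof.
move=> [f [c [HP HQ]]] PP QQ; exists f, c.
by split=> e; [rewrite PP HP | rewrite QQ HQ].
Qed.

Lemma def_transfer P Q : def P Q -> forall e, P e <-> Q (star \o e).
Proof.
by move=> [f [c [HP HQ]]] e; rewrite HP HQ -comp_mix; exact: transfer.
Qed.

Lemma def_ren r P Q : def P Q ->
  def (fun e => P (e \o r)) (fun e => Q (e \o r)).
Proof.
move=> [f [c [HP HQ]]].
pose r' := mix (fun i => (r i).*2) (fun i => i.*2.+1).
have E T (e c' : nat -> T) : mix e c' \o r' = mix (e \o r) c'.
  apply: funext => i /=; rewrite /r'.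
  by case: (nat_parity i) => ->; rewrite ?(mix_even, mix_odd).
by exists (bren r' f), c; split=> e; rewrite sat_bren E.
Qed.

Lemma def_mem i j : def (fun e => smem (e i) (e j)) (fun e => imem (e i) (e j)).
Proof.
have [a _] : exists a : V, True by exists (num V 0).
by exists (BMem i.*2 j.*2), (fun=> a); split=> e /=; rewrite !mix_even.
Qed.

Lemma def_eq i j : def (fun e => e i = e j) (fun e => e i = e j).
Proof.
by exists (BEq i.*2 j.*2), (fun=> num V 0); split=> e /=; rewrite !mix_even.
Qed.

Lemma def_memc i a : def (fun e => smem (e i) a) (fun e => imem (e i) (star a)).
Proof.
by exists (BMem i.*2 1), (fun=> a); split=> e /=; rewrite !mix_even.
Qed.

Lemma def_eqc i a : def (fun e => e i = a) (fun e => e i = star a).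
Proof.
by exists (BEq i.*2 1), (fun=> a); split=> e /=; rewrite !mix_even.
Qed.

Lemma def_not P Q : def P Q -> def (fun e => ~ P e) (fun e => ~ Q e).
Proof.
move=> [f [c [HP HQ]]]; exists (BNot f), c.
by split=> e /=; [rewrite HP|rewrite HQ].
Qed.

Lemma def_and P Q P' Q' : def P Q -> def P' Q' ->
  def (fun e => P e /\ P' e) (fun e => Q e /\ Q' e).
Proof.
move=> [f [c [HP HQ]]] [f' [c' [HP' HQ']]].
(* The two formulas come with separate constants; [mix c c'] interleaves them, and [r k] redirects
   constant i to constant 2i + k. *)
pose r k := mix (fun i => i.*2) (fun i => (i.*2 + k).*2.+1).
have E0 T (e d d' : nat -> T) : mix e (mix d d') \o r 0 = mix e d.
  apply: funext => i /=; rewrite /r.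
  by case: (nat_parity i) => ->; rewrite ?(mix_even, mix_odd, addn0).
have E1 T (e d d' : nat -> T) : mix e (mix d d') \o r 1 = mix e d'.
  apply: funext => i /=; rewrite /r.
  by case: (nat_parity i) => ->; rewrite ?(mix_even, mix_odd, addn1).
exists (BAnd (bren (r 0) f) (bren (r 1) f')), (mix c c').
split=> e /=; rewrite ?comp_mix !sat_bren !(E0, E1); first by rewrite HP HP'.
by rewrite HQ HQ'.
Qed.

Lemma def_all a P Q : def P Q ->
  def (fun e => forall v, smem v a -> P (scons v e))
      (fun e => forall v, imem v (star a) -> Q (scons v e)).
Proof.
move=> [f [c [HP HQ]]].
(* The bound [a] is stored as constant 0, at index 1, and pushes the other constants up by one;
   under the binder every index shifts once more. *)
pose r := mix (fun i => if i is j.+1 then j.*2.+1 else 0)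
              (fun i => i.+1.*2.+2).
have E T (e d : nat -> T) v b :
    scons v (mix e (scons b d)) \o r = mix (scons v e) d.
  apply: funext => i /=; rewrite /r.
  case: (nat_parity i) => ->; rewrite ?(mix_even, mix_odd).
    by case: i./2 => //= j; rewrite mix_even.
  by rewrite [LHS]/= (mix_odd _ _ _.+1).
exists (BAll 1 (bren r f)), (scons a c).
split=> e /=; rewrite ?comp_scons.
  by split=> H v vA; have := H v vA; rewrite sat_bren E HP.
by split=> H v vA; have := H v vA; rewrite sat_bren E HQ.
Qed.

Lemma def_allv j P Q : def P Q ->
  def (fun e => forall v, smem v (e j) -> P (scons v e))
      (fun e => forall v, imem v (e j) -> Q (scons v e)).
Proof.
move=> [f [c [HP HQ]]].
pose r := mix (fun i => if i is j.+1 then j.*2.+1 else 0)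
              (fun i => i.*2.+2).
have E T (e d : nat -> T) v :
    scons v (mix e d) \o r = mix (scons v e) d.
  apply: funext => i /=; rewrite /r.
  case: (nat_parity i) => ->; rewrite ?(mix_even, mix_odd).
    by case: i./2 => //= k; rewrite mix_even.
  by rewrite [LHS]/= mix_odd.
exists (BAll j.*2 (bren r f)), c.
split=> e /=; rewrite mix_even.
  by split=> H v vA; have := H v vA; rewrite sat_bren E HP.
by split=> H v vA; have := H v vA; rewrite sat_bren E HQ.
Qed.

Lemma def_or P Q P' Q' : def P Q -> def P' Q' ->
  def (fun e => P e \/ P' e) (fun e => Q e \/ Q' e).
Proof.
move=> /def_not d /def_not d'; apply: (def_iff (def_not (def_and d d'))) => e;
  by rewrite not_andE !not_notE.
Qed.

Lemma def_imp P Q P' Q' : def P Q -> def P' Q' ->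
  def (fun e => P e -> P' e) (fun e => Q e -> Q' e).
Proof.
move=> /def_not d d'; apply: (def_iff (def_or d d')) => e; by rewrite implyE.
Qed.

Lemma def_bi P Q P' Q' : def P Q -> def P' Q' ->
  def (fun e => P e <-> P' e) (fun e => Q e <-> Q' e).
Proof. by move=> d d'; exact: (def_and (def_imp d d') (def_imp d' d)). Qed.

Lemma not_all_not T (A B : T -> Prop) :
  (exists2 v, A v & B v) <-> ~ (forall v, A v -> ~ B v).
Proof.
split=> [[v a b] /(_ v a)|H]; first exact.
by apply: contrapT => N; apply: H => v a b; apply: N; exists v.
Qed.

Lemma def_ex a P Q : def P Q ->
  def (fun e => exists2 v, smem v a & P (scons v e))
      (fun e => exists2 v, imem v (star a) & Q (scons v e)).
Proof.
move=> /def_not /(def_all a) /def_not /def_iff; apply=> e; exact: not_all_not.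
Qed.

Lemma def_exv j P Q : def P Q ->
  def (fun e => exists2 v, smem v (e j) & P (scons v e))
      (fun e => exists2 v, imem v (e j) & Q (scons v e)).
Proof.
move=> /def_not /(def_allv j) /def_not /def_iff; apply=> e; exact: not_all_not.
Qed.

(** Validity over all assignments becomes a single transferable statement once the relevant
    variables are quantified one at a time over their domains. Nonemptiness of the domains supplies
    a standard assignment for the base case. *)
Lemma def_valid P Q (D : nat -> V) : def P Q ->
  (forall i, exists x, smem x (D i)) ->
  (forall e, (forall i, smem (e i) (D i)) -> P e) ->
  forall e, (forall i, imem (e i) (star (D i))) -> Q e.
Proof.
move=> PQ; have [K [SP SQ]] : exists K,
    (forall e e', (forall i, (i < K)%N -> e i = e' i) -> P e -> P e') /\
    (forall e e', (forall i, (i < K)%N -> e i = e' i) -> Q e -> Q e').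
  have [f [c [HP HQ]]] := PQ.
  have [K HK] := sat_support f; exists K.
  have M T (e e' d : nat -> T) : (forall i, (i < K)%N -> e i = e' i) ->
      forall i, (i < K)%N -> mix e d i = mix e' d i.
    by move=> E i iK; rewrite /mix; case: odd => //; apply: E; lia.
  by split=> e e' E; rewrite ?HP ?HQ (HK _ _ _ _ (M _ _ _ _ E)).
elim: K D P Q PQ SP SQ => [|K IH] D P Q PQ SP SQ D0 HP e eD.
  have /choice [e0 e0D] := D0.
  by apply: (SQ (star \o e0)) => //; rewrite -(def_transfer PQ); apply: HP.
have E T (h : nat -> T) : scons (h 0) (fun i => h i.+1) = h.
  by apply: funext => -[].
rewrite -(E _ e).
apply: (IH (fun i => D i.+1) _ _ (def_all (D 0) PQ)) => //.
- move=> e1 e2 E12 H v vD; apply: (SP (scons v e1)); last exact: H.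
  by case=> //= i iK; apply: E12.
- move=> e1 e2 E12 H v vD; apply: (SQ (scons v e1)); last exact: H.
  by case=> //= i iK; apply: E12.
- by move=> e1 e1D v vD; apply: HP => -[|i] //=.
Qed.

Lemma def_pair i j k : def (fun e => is_pair smem (e i) (e j) (e k))
                           (fun e => is_pair imem (e i) (e j) (e k)).
Proof.
have up T (mem : T -> T -> Prop) p x y : is_upair mem p x y <->
    (mem x p /\ mem y p) /\ forall z, mem z p -> z = x \/ z = y.
  rewrite /is_upair; split=> [H|[[xp yp] H]].
    have E z : mem z p <-> z = x \/ z = y by rewrite -[mem z p]/(elts mem p z) H.
    by split=> [|z /E //]; split; apply/E; [left | right].
  by apply/seteqP; split=> z /=; [move/H | case=> ->].
have dup a b c : def (fun e => is_upair smem (e a) (e b) (e c))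
                     (fun e => is_upair imem (e a) (e b) (e c)).
  apply: (def_iff (def_and (def_and (def_mem b a) (def_mem c a))
     (def_allv a (def_or (def_eq 0 b.+1) (def_eq 0 c.+1))))) => e; exact: up.
(* The two auxiliary sets are elements of p, which bounds the quantifiers over them. *)
have pr T (mem : T -> T -> Prop) p x y : is_pair mem p x y <->
    exists2 a, mem a p & exists2 b, mem b p &
    (is_upair mem a x x /\ is_upair mem b x y) /\ is_upair mem p a b.
  split=> [[a [b [H1 H2 H3]]]|[a _ [b _ [[H1 H2] H3]]]]; last by exists a, b.
  have /up[[ap bp] _] := H3.
  by exists a => //; exists b.
by apply: (def_iff (def_exv i (def_exv i.+1 (def_and
  (def_and (dup 1 j.+2 j.+2) (dup 0 j.+2 k.+2)) (dup i.+2 1 0))))) => e; exact: pr.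
Qed.

End Transfer.

Lemma pair_inj T (mem : T -> T -> Prop) p x y x' y' :
  is_pair mem p x y -> is_pair mem p x' y' -> x = x' /\ y = y'.
Proof.
move=> [a [b [Ha Hb Hp]]] [a' [b' [Ha' Hb' Hp']]].
have S (u z w : T) : [set u; u] = [set z; w] -> u = z /\ u = w.
  move=> E; have : [set u; u] z by rewrite E; left.
  have : [set u; u] w by rewrite E; right.
  by move=> [->|->] [->|->].
have I (c d u v u' v' : T) : is_upair mem c u v -> is_upair mem d u' v' -> c = d ->
  [set u; v] = [set u'; v'] by move=> <- <- ->.
have L (u v v' : T) : [set u; v] = [set u; v'] -> v = v'.
  move=> E; have : [set u; v'] v by rewrite -E; right.
  have : [set u; v] v' by rewrite E; right.
  by move=> [->|->] // [->|->].
have E : [set a; b] = [set a'; b'] by rewrite -Hp -Hp'.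
have : [set a'; b'] a by rewrite -E; left.
case=> [aa|ab].
  have [xx _] := S _ _ _ (I _ _ _ _ _ _ Ha Ha' aa); split=> //.
  move: E Ha' Hb'; rewrite -aa -xx => /L bb _ Hb'.
  exact: (L _ _ _ (I _ _ _ _ _ _ Hb Hb' bb)).
have [xx xy] := S _ _ _ (I _ _ _ _ _ _ Ha Hb' ab); split=> //.
have : [set a; b] a' by rewrite E; left.
case=> [aa|ba].
  have /esym/S [_ abE] : [set a; b] = [set a; a] by rewrite E -ab aa.
  have /S [_ <-] := I _ _ _ _ _ _ Ha Hb abE.
  by rewrite -xy.
have /S [_ <-] := I _ _ _ _ _ _ Ha' Hb ba.
by rewrite -xx.
Qed.
Arguments def {V} W P Q.

(** * Second-order arithmetic *)

(* A bijection: each z + 1 is 2 ^ i * (2 n + 1) for exactly one pair (i, n). *)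
Definition cpair (i n : nat) : nat := (2 ^ i * n.*2.+1).-1.
Definition cfst (z : nat) : nat := logn 2 z.+1.
Definition csnd (z : nat) : nat := (z.+1 %/ 2 ^ logn 2 z.+1)./2.

Lemma cpairK z : cpair (cfst z) (csnd z) = z.
Proof.
rewrite /cpair /cfst /csnd; set l := logn 2 z.+1.
have [m m2 E] := pfactor_coprime (isT : prime 2) (ltn0Sn z).
rewrite -/l in E; rewrite E mulnK ?expn_gt0 //.
move: m2; rewrite coprime2n => mo.
have := odd_double_half m; rewrite mo add1n => ->.
by rewrite mulnC -E.
Qed.

Lemma cpair_logn i n : logn 2 (cpair i n).+1 = i.
Proof.
rewrite /cpair prednK ?muln_gt0 ?expn_gt0 // lognM ?expn_gt0 //.
rewrite pfactorK // [logn 2 _.+1](_ : _ = 0) ?addn0 //.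
by apply: logn_coprime; rewrite coprime2n /= odd_double.
Qed.

Lemma cfstE i n : cfst (cpair i n) = i.
Proof. exact: cpair_logn. Qed.

Lemma csndE i n : csnd (cpair i n) = n.
Proof.
rewrite /csnd cpair_logn /cpair prednK ?muln_gt0 ?expn_gt0 //.
by rewrite mulKn ?expn_gt0 // -[_.*2.+1]/(true + n.*2) half_bit_double.
Qed.

Lemma cpair_ltr i m n : (m < n)%N -> (cpair i m < cpair i n)%N.
Proof.
move=> mn; rewrite /cpair.
have : (2 ^ i * m.*2.+1 < 2 ^ i * n.*2.+1)%N.
  by rewrite ltn_pmul2l ?expn_gt0 //; lia.
have : (0 < 2 ^ i * m.*2.+1)%N by rewrite muln_gt0 expn_gt0.
lia.
Qed.

(** Every standard binary function has its own symbol; unary functions are applied to the same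
    argument twice. *)
Inductive tm := TV of nat | TC of nat | TF of (nat -> nat -> nat) & tm & tm.

(** [FC r i t] relates a set variable to a number. It is used with [scard], whose transfer is the
    internal cardinality. *)
Inductive fm :=
  | FEq of tm & tm
  | FR of (nat -> nat -> Prop) & tm & tm
  | FM of tm & nat
  | FC of (set nat -> nat -> Prop) & nat & tm
  | FNot of fm
  | FAnd of fm & fm
  | FOr of fm & fm
  | FImp of fm & fm
  | FAllN of nat & fm
  | FExN of nat & fm
  | FAllS of nat & fm
  | FExS of nat & fm.

Notation tfst t := (TF (fun u _ => cfst u) t t).
Notation tsnd t := (TF (fun u _ => csnd u) t t).
Notation FMpair i j k := (FM (TF cpair (TV i) (TV j)) k).
Notation Fsub i j := (FAllN 9 (FImp (FM (TV 9) i) (FM (TV 9) j))).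

(** Binders of [fm] name their variable and overwrite its value, unlike the de Bruijn binders of
    [bformula]; [bindv] translates between the two. *)
Definition upd T (e : nat -> T) x v i : T := if i == x then v else e i.

Section Semantics.
Variables (N S : Type) (cst : nat -> N) (fn : (nat -> nat -> nat) -> N -> N -> N).
Variables (rl : (nat -> nat -> Prop) -> N -> N -> Prop) (mm : N -> S -> Prop).
Variable cd : (set nat -> nat -> Prop) -> S -> N -> Prop.

Fixpoint tmval (en : nat -> N) (t : tm) : N :=
  match t with
  | TV i => en i
  | TC k => cst k
  | TF g t u => fn g (tmval en t) (tmval en u)
  end.

Fixpoint fsat (en : nat -> N) (es : nat -> S) (f : fm) : Prop :=
  match f with
  | FEq t u => tmval en t = tmval en u
  | FR r t u => rl r (tmval en t) (tmval en u)
  | FM t i => mm (tmval en t) (es i)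
  | FC r i t => cd r (es i) (tmval en t)
  | FNot g => ~ fsat en es g
  | FAnd g h => fsat en es g /\ fsat en es h
  | FOr g h => fsat en es g \/ fsat en es h
  | FImp g h => fsat en es g -> fsat en es h
  | FAllN x g => forall v, fsat (upd en x v) es g
  | FExN x g => exists v, fsat (upd en x v) es g
  | FAllS x g => forall v, fsat en (upd es x v) g
  | FExS x g => exists v, fsat en (upd es x v) g
  end.
End Semantics.

Definition sfsat := fsat id (fun g => g) (fun r => r) (fun x A => A x)
                         (fun r (A : set nat) => r A).

(** * Numbers, sets of numbers and relations as elements of the superstructure *)

Section Coding.
Variable V : superstructure.
Local Notation smem := (@smem V).
Local Notation lev := (level smem (@satom V)).

Definition cset (A : set nat) : V := setof (num V @` A).
Definition powN : V := setof (range cset).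
Definition cfam (F : set (set nat)) : V := setof (cset @` F).
Definition powpowN : V := setof (range cfam).
Definition crel T (c : T -> V) (r : T -> nat -> Prop) : V :=
  setof [set p | exists x n, r x n /\ is_pair smem p (c x) (num V n)].

Lemma numI : injective (num V).
Proof. by move=> m n /satom_inj /snum_inj. Qed.

Lemma num_lev n : lev 0 (num V n). Proof. by exists (snum V n). Qed.

Lemma elts_cset A : elts smem (cset A) = num V @` A.
Proof. by apply: (@elts_setof _ 0) => _ [n _ <-]; exact: num_lev. Qed.

Lemma cset_lev A : lev 1 (cset A).
Proof. by right; rewrite /= elts_cset => _ [n _ <-]; exact: num_lev. Qed.

Lemma smem_cset n A : smem (num V n) (cset A) <-> A n.
Proof.
rewrite -[smem _ _]/(elts smem (cset A) (num V n)) elts_cset.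
by split=> [[m Am /numI <-//]|An]; exists n.
Qed.

Lemma csetI : injective cset.
Proof. by move=> A B E; apply/predeqP => n; rewrite -!smem_cset E. Qed.

Lemma elts_powN : elts smem powN = range cset.
Proof. by apply: (@elts_setof _ 1) => _ [A _ <-]; exact: cset_lev. Qed.

Lemma elts_cfam F : elts smem (cfam F) = cset @` F.
Proof. by apply: (@elts_setof _ 1) => _ [A _ <-]; exact: cset_lev. Qed.

Lemma elts_powpowN : elts smem powpowN = range cfam.
Proof.
apply: (@elts_setof _ 2) => _ [F _ <-]; right.
by rewrite /= elts_cfam => _ [A _ <-]; exact: cset_lev.
Qed.

Lemma smem_cfam A F : smem (cset A) (cfam F) <-> F A.
Proof.
rewrite -[smem _ _]/(elts smem (cfam F) (cset A)) elts_cfam.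
by split=> [[B FB /csetI <-//]|FA]; exists A.
Qed.

Lemma naturalsP v : smem v (naturals V) <-> exists n, v = num V n.
Proof.
rewrite -[smem _ _]/(elts smem (naturals V) v) elts_naturals.
by split=> [[n _ <-]|[n ->]]; exists n.
Qed.

Lemma powNP v : smem v powN <-> exists A, v = cset A.
Proof.
rewrite -[smem _ _]/(elts smem powN v) elts_powN.
by split=> [[n _ <-]|[n ->]]; exists n.
Qed.

Lemma powpowNP v : smem v powpowN <-> exists A, v = cfam A.
Proof.
rewrite -[smem _ _]/(elts smem powpowN v) elts_powpowN.
by split=> [[n _ <-]|[n ->]]; exists n.
Qed.

Lemma pair_ex x y : lev 1 x -> lev 1 y -> exists p, is_pair smem p x y.
Proof.
move=> x1 y1.
have [a [_ Ha]] : exists a, ~ range (@satom V) a /\ elts smem a = [set x; x].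
  by apply: (@spowerset V 1) => _ [->|->].
have [b [_ Hb]] : exists a, ~ range (@satom V) a /\ elts smem a = [set x; y].
  by apply: (@spowerset V 1) => _ [->|->].
have [p [_ Hp]] : exists p, ~ range (@satom V) p /\ elts smem p = [set a; b].
  apply: (@spowerset V 2) => _ [->|->]; right; rewrite /= ?Ha ?Hb.
    by move=> _ [->|->].
  by move=> _ [->|->].
by exists p, a, b.
Qed.

Lemma upair_uniq p q x y : is_upair smem p x y -> is_upair smem q x y -> p = q.
Proof.
move=> Hp Hq.
have na r : is_upair smem r x y -> ~ range (@satom V) r.
  move=> Hr [b _ br]; have : elts smem r x by rewrite Hr; left.
  by rewrite -br satom_no_elts.
by apply: sset_ext; [exact: na | exact: na | rewrite Hp Hq].
Qed.

Lemma pair_uniq p q x y : is_pair smem p x y -> is_pair smem q x y -> p = q.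
Proof.
move=> [a [b [Ha Hb Hp]]] [a' [b' [Ha' Hb' Hq]]].
rewrite -(upair_uniq Ha Ha') -(upair_uniq Hb Hb') in Hq.
exact: upair_uniq Hp Hq.
Qed.

Section Rel.
Variables (T : Type) (c : T -> V).
Hypothesis cI : injective c.
Hypothesis c1 : forall x, lev 1 (c x).

Lemma crel_lev3 r :
  [set p | exists x n, r x n /\ is_pair smem p (c x) (num V n)] `<=` lev 3.
Proof.
move=> p [x [n [_ [a [b [axx bxn pab]]]]]]; right.
have n1 : lev 1 (num V n) by left; exact: num_lev.
by rewrite /= pab => _ [->|->]; right; rewrite /= ?axx ?bxn => _ [->|->];
  [exact: c1 | exact: c1 | exact: c1 | exact: n1].
Qed.

Lemma elts_crel r : elts smem (crel c r) =
  [set p | exists x n, r x n /\ is_pair smem p (c x) (num V n)].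
Proof. exact: elts_setof (@crel_lev3 r). Qed.

Lemma crelP r x n : (exists2 p, smem p (crel c r) &
  is_pair smem p (c x) (num V n)) <-> r x n.
Proof.
split=> [[p]|rxn].
  rewrite -[smem _ _]/(elts smem (crel c r) p) elts_crel => -[x' [n' [rxn' Hp]]].
  by move=> /(pair_inj Hp) [/cI <- /numI <-].
have [p Hp] := @pair_ex (c x) (num V n) (c1 x) (or_introl (num_lev n)).
exists p => //; rewrite -[smem _ _]/(elts smem (crel c r) p) elts_crel.
by exists x, n.
Qed.
End Rel.

Definition nrelP := crelP numI (fun n => or_introl (num_lev n)).
Definition srelP := crelP csetI cset_lev.
End Coding.

(** * Hyperintegers and internal sets *)

Lemma sval_inj T (P : T -> Prop) (x y : {z | P z}) : sval x = sval y -> x = y.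
Proof. by case: x y => x px [y py] /= E; exact: eq_exist. Qed.

Lemma upd_mix_even T (a b : nat -> T) x v :
  upd (mix a b) x.*2 v = mix (upd a x v) b.
Proof.
apply: funext => i; rewrite /upd.
case: (nat_parity i) => ->; rewrite ?(mix_even, mix_odd).
  by rewrite -!muln2 eqn_pmul2r.
by case: eqP => //; lia.
Qed.

Lemma upd_mix_odd T (a b : nat -> T) x v :
  upd (mix a b) x.*2.+1 v = mix a (upd b x v).
Proof.
apply: funext => i; rewrite /upd.
case: (nat_parity i) => ->; rewrite ?(mix_even, mix_odd).
  by case: eqP => //; lia.
by rewrite eqSS -!muln2 eqn_pmul2r.
Qed.

Lemma comp_upd T S (h : T -> S) (e : nat -> T) x v :
  h \o upd e x v = upd (h \o e) x (h v).
Proof. by apply: funext => i; rewrite /upd /=; case: eqP. Qed.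

Section Hyper.
Variables (V : superstructure) (W : nonstandard_universe V).
Local Notation smem := (@smem V).
Local Notation imem := (@imem V W).
Local Notation star := (@star V W).
Local Notation naturals := (naturals V).
Local Notation powN := (powN V).

Definition hnat := {x : W | imem x (hypernat W)}.
Definition iint := {a : W | imem a (star powN)}.
Definition to_hnat x (xN : imem x (hypernat W)) : hnat :=
  exist (fun x => imem x (hypernat W)) x xN.
Definition to_iint a (aP : imem a (star powN)) : iint :=
  exist (fun a => imem a (star powN)) a aP.

Definition ihas (c : V) (x y : W) :=
  exists2 p, imem p (star c) & is_pair imem p x y.
Definition shas (c x y : V) := exists2 p, smem p c & is_pair smem p x y.

Definition hrel (r : nat -> nat -> Prop) (x y : hnat) :=
  ihas (crel (num V) r) (sval x) (sval y).
Definition hcard_rel (r : set nat -> nat -> Prop) (a : iint) (x : hnat) :=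
  ihas (crel (@cset V) r) (sval a) (sval x).
Definition hmem (x : hnat) (a : iint) := imem (sval x) (sval a).

Lemma def_has i j c : def W (fun e => shas c (e i) (e j))
                            (fun e => ihas c (e i) (e j)).
Proof. exact: (def_ex c (def_pair W 0 i.+1 j.+1)). Qed.

Lemma star_mem x a : smem x a -> imem (star x) (star a).
Proof.
by move=> xa; have := def_transfer (def_memc W 0 a) (fun=> x); move=> [+ _]; apply.
Qed.

Lemma hcst_subproof n : imem (star (num V n)) (hypernat W).
Proof. by apply/star_mem/naturalsP; exists n. Qed.
Definition hcst n : hnat := to_hnat (hcst_subproof n).

(** The ternary graph of g is split into three binary relations through a code z of the two
    arguments, so that sets of pairs suffice as constants. *)
Lemma hgr_def g : def W
  (fun e => exists2 z, smem z naturals &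
     (shas (crel (num V) (fun z x => cfst z = x)) z (e 0) /\
      shas (crel (num V) (fun z x => csnd z = x)) z (e 1)) /\
      shas (crel (num V) (fun z w => g (cfst z) (csnd z) = w)) z (e 2))
  (fun e => exists2 z, imem z (hypernat W) &
     (ihas (crel (num V) (fun z x => cfst z = x)) z (e 0) /\
      ihas (crel (num V) (fun z x => csnd z = x)) z (e 1)) /\
      ihas (crel (num V) (fun z w => g (cfst z) (csnd z) = w)) z (e 2)).
Proof.
exact: (def_ex naturals (def_and (def_and (def_has 0 1 _) (def_has 0 2 _))
   (def_has 0 3 _))).
Qed.

Definition hgr g (x y w : hnat) := exists z : hnat,
  (hrel (fun z x => cfst z = x) z x /\ hrel (fun z x => csnd z = x) z y) /\
  hrel (fun z w => g (cfst z) (csnd z) = w) z w.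

Lemma sgrE g m n (v : V) : (exists2 z, smem z naturals &
     (shas (crel (num V) (fun z x => cfst z = x)) z (num V m) /\
      shas (crel (num V) (fun z x => csnd z = x)) z (num V n)) /\
      shas (crel (num V) (fun z w => g (cfst z) (csnd z) = w)) z v) <->
  v = num V (g m n).
Proof.
split=> [[_ /naturalsP[z ->]] [[/nrelP <- /nrelP <-]]|->].
  move=> [p pr pz]; move: pr.
  rewrite -[smem _ _]/(elts smem (crel _ _) p) elts_crel; last first.
    by move=> n'; left; exact: num_lev.
  by move=> [z' [w [<- /(pair_inj pz) [/numI-> ->]]]].
exists (num V (cpair m n)); first by apply/naturalsP; exists (cpair m n).
by split; [split|]; apply/nrelP; rewrite ?cfstE ?csndE.
Qed.

Lemma nat_inh : exists x, smem x naturals.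
Proof. by exists (num V 0); apply/naturalsP; exists 0. Qed.

Lemma powN_inh : exists x, smem x powN.
Proof. by exists (cset V set0); apply/powNP; exists set0. Qed.

Lemma hgr_ex g x y : exists w, hgr g x y w.
Proof.
have := @def_valid _ _ _ _ (fun=> naturals)
  (def_ex naturals (def_ren (fun i => if i is 2 then 0 else i.+1) (hgr_def g)))
  (fun=> nat_inh).
move=> /(_ _ (fun i => sval (if i is 0 then x else y))) [|i|w wN [z zN H]].
- move=> e eN; have /naturalsP[m E0] := eN 0; have /naturalsP[n E1] := eN 1.
  exists (num V (g m n)); first by apply/naturalsP; exists (g m n).
  by rewrite /= E0 E1; apply/sgrE.
- by case: i => [|i]; [case: x | case: y].
by exists (to_hnat wN), (to_hnat zN).
Qed.

Lemma hgr_uniq g x y w w' : hgr g x y w -> hgr g x y w' -> w = w'.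
Proof.
move=> [z H] [z' H']; apply: sval_inj.
have d := def_imp (hgr_def g) (def_imp
  (def_ren (fun i => if i is 2 then 3 else i) (hgr_def g))
  (def_eq W 2 3)).
have := @def_valid _ _ _ _ (fun=> naturals) d (fun=> nat_inh).
move=> /(_ _ (fun i => sval (nth w' [:: x; y; w] i))); apply.
- move=> e eN; have /naturalsP[m E0] := eN 0; have /naturalsP[n E1] := eN 1.
  by rewrite /= E0 E1 !sgrE => -> ->.
- by move=> i; case: (nth _ _ _).
- by exists (sval z) => //; case: (z).
- by exists (sval z') => //; case: (z').
Qed.

Definition hfun g x y : hnat := sval (cid (hgr_ex g x y)).

Lemma hfunP g x y w : hgr g x y w <-> w = hfun g x y.
Proof.
rewrite /hfun; case: cid => v /= Hv; split=> [/(hgr_uniq Hv) //|->//].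
Qed.

Definition htval := tmval hcst hfun.
Definition hsat := fsat hcst hfun hrel hmem hcard_rel.

Local Notation senv en es := (mix (num V \o en) (@cset V \o es)).
Definition henv (hn : nat -> hnat) (hs : nat -> iint) : nat -> W :=
  mix (fun i => sval (hn i)) (fun i => sval (hs i)).

(** Bounded formulas have no function symbols, so a term is described by the graph of its value,
    with the candidate value in variable 0. *)
Lemma tm_def t : exists P Q, [/\ def W P Q,
  forall n en es, P (scons (num V n) (senv en es)) <-> n = tmval id (fun g => g) en t &
  forall h hn hs, Q (scons (sval h) (henv hn hs)) <-> h = htval hn t].
Proof.
elim: t => [i|k|g t [P [Q [PQ HP HQ]]] u [P' [Q' [PQ' HP' HQ']]]].
- exists (fun e => e 0 = e i.*2.+1), (fun e => e 0 = e i.*2.+1); split.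
  + exact: def_eq.
  + by move=> n en es /=; rewrite mix_even; split=> [/numI|->].
  + by move=> h hn hs /=; rewrite /henv mix_even; split=> [/sval_inj|->].
- exists (fun e => e 0 = num V k), (fun e => e 0 = star (num V k)); split.
  + exact: def_eqc.
  + by move=> n en es /=; split=> [/numI|->].
  + by move=> h hn hs /=; split=> [E|->//]; exact: sval_inj.
have d := def_ex naturals (def_ex naturals (def_and
  (def_and (def_ren (fun i => if i is j.+1 then j.+3 else 1) PQ)
           (def_ren (fun i => if i is j.+1 then j.+3 else 0) PQ'))
  (def_ren (fun i => if i is 0 then 1 else if i is 1 then 0 else 2) (hgr_def g)))).
eexists; eexists; split; first exact: d.
  have E T (e : nat -> T) x y z : (scons x (scons y (scons z e))) \o
      (fun i => if i is j.+1 then j.+3 else 1) = scons y e.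
    by apply: funext => -[].
  have E' T (e : nat -> T) x y z : (scons x (scons y (scons z e))) \o
      (fun i => if i is j.+1 then j.+3 else 0) = scons x e.
    by apply: funext => -[].
  move=> n en es /=; split.
    move=> [_ /naturalsP[a ->]] [_ /naturalsP[b ->]] [].
    by rewrite E E' HP HP' => -[-> ->] /sgrE /numI.
  move=> ->; set a := tmval _ _ en t; set b := tmval _ _ en u.
  exists (num V a); first by apply/naturalsP; exists a.
  exists (num V b); first by apply/naturalsP; exists b.
  by rewrite E E' HP HP'; split=> //; apply/sgrE.
have E T (e : nat -> T) x y z : (scons x (scons y (scons z e))) \o
    (fun i => if i is j.+1 then j.+3 else 1) = scons y e.
  by apply: funext => -[].
have E' T (e : nat -> T) x y z : (scons x (scons y (scons z e))) \o
    (fun i => if i is j.+1 then j.+3 else 0) = scons x e.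
  by apply: funext => -[].
move=> h hn hs /=; rewrite -/htval; split.
  move=> [a aN [b bN]]; rewrite E E'.
  rewrite -[a]/(sval (to_hnat aN)) -[b]/(sval (to_hnat bN)) HQ HQ'.
  move=> [[-> ->] [z zN H]]; apply/hfunP.
  by exists (to_hnat zN).
move=> ->; set a := htval hn t; set b := htval hn u.
exists (sval a); first by case: (a).
exists (sval b); first by case: (b).
rewrite E E' HQ HQ'; split=> //.
have [z H] : hgr g a b (hfun g a b) by apply/hfunP.
by exists (sval z) => //; case: (z).
Qed.

Definition bindv x i := if i == x then 0 else i.+1.

Lemma scons_bindv T (e : nat -> T) x v : scons v e \o bindv x = upd e x v.
Proof. by apply: funext => i; rewrite /bindv /upd /=; case: eqP. Qed.

Lemma hupdE hn x (h : hnat) :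
  upd (fun i => sval (hn i)) x (sval h) = (fun i => sval (upd hn x h i)).
Proof. by apply: funext => i; rewrite /upd; case: eqP. Qed.

Lemma supdE hs x (a : iint) :
  upd (fun i => sval (hs i)) x (sval a) = (fun i => sval (upd hs x a i)).
Proof. by apply: funext => i; rewrite /upd; case: eqP. Qed.

(** Number and set quantifiers become quantifiers bounded by [naturals] and [powN], which brings
    second-order arithmetic within reach of bounded transfer. *)
Lemma fm_def f : exists P Q, [/\ def W P Q,
  forall en es, P (senv en es) <-> sfsat en es f &
  forall hn hs, Q (henv hn hs) <-> hsat hn hs f].
Proof.
have numN n : smem (num V n) naturals by apply/naturalsP; exists n.
have E1 T (e : nat -> T) x y : scons y (scons x e) \o
    (fun i => if i is j.+1 then j.+2 else 1) = scons x e.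
  by apply: funext => -[].
have E2 T (e : nat -> T) x y : scons y (scons x e) \o
    (fun i => if i is j.+1 then j.+2 else 0) = scons y e.
  by apply: funext => -[].
elim: f => [t u|r t u|t i|r i t|f [P [Q [PQ HP HQ]]]
  |f [P [Q [PQ HP HQ]]] g [P' [Q' [PQ' HP' HQ']]]
  |f [P [Q [PQ HP HQ]]] g [P' [Q' [PQ' HP' HQ']]]
  |f [P [Q [PQ HP HQ]]] g [P' [Q' [PQ' HP' HQ']]]
  |x f [P [Q [PQ HP HQ]]]|x f [P [Q [PQ HP HQ]]]
  |x f [P [Q [PQ HP HQ]]]|x f [P [Q [PQ HP HQ]]]].
- have [P [Q [PQ HP HQ]]] := tm_def t; have [P' [Q' [PQ' HP' HQ']]] := tm_def u.
  eexists; eexists; split; first exact: (def_ex naturals (def_and PQ PQ')).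
    move=> en es; rewrite /sfsat /=; split=> [[_ /naturalsP[a ->]]|E].
      by rewrite HP HP' => -[<- <-].
    exists (num V (tmval id (fun g => g) en t)); first exact: numN.
    by rewrite HP HP'.
  move=> hn hs; rewrite /hsat /= -/htval; split=> [[a aN]|E].
    by rewrite -[a]/(sval (to_hnat aN)) HQ HQ' => -[<- <-].
  exists (sval (htval hn t)); first by case: (htval hn t).
  by rewrite HQ HQ'.
- have [P [Q [PQ HP HQ]]] := tm_def t; have [P' [Q' [PQ' HP' HQ']]] := tm_def u.
  eexists; eexists; split; first exact: (def_ex naturals (def_ex naturals (def_and
   (def_and (def_ren (fun i => if i is j.+1 then j.+2 else 1) PQ)
            (def_ren (fun i => if i is j.+1 then j.+2 else 0) PQ'))
   (def_has 1 0 (crel (num V) r))))).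
    move=> en es; rewrite /sfsat /=;
      split=> [[_ /naturalsP[a ->] [_ /naturalsP[b ->]]]|E].
      by rewrite E1 E2 HP HP' => -[[<- <-]] /nrelP.
    exists (num V (tmval id (fun g => g) en t)); first exact: numN.
    exists (num V (tmval id (fun g => g) en u)); first exact: numN.
    by rewrite E1 E2 HP HP'; split=> //; apply/nrelP.
  move=> hn hs; rewrite /hsat /= -/htval; split=> [[a aN [b bN]]|E].
    rewrite E1 E2 -[a]/(sval (to_hnat aN)) -[b]/(sval (to_hnat bN)) HQ HQ'.
    by move=> [[-> ->]].
  exists (sval (htval hn t)); first by case: (htval hn t).
  exists (sval (htval hn u)); first by case: (htval hn u).
  by rewrite E1 E2 HQ HQ'.
- have [P [Q [PQ HP HQ]]] := tm_def t.
  eexists; eexists; split; first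
    exact: (def_ex naturals (def_and PQ (def_mem W 0 i.*2.+2))).
    move=> en es; rewrite /sfsat /= mix_odd; split=> [[_ /naturalsP[a ->]]|E].
      by rewrite HP => -[<-] /smem_cset.
    exists (num V (tmval id (fun g => g) en t)); first exact: numN.
    by rewrite HP; split=> //; apply/smem_cset.
  move=> hn hs; rewrite /hsat /= -/htval /henv mix_odd; split=> [[a aN]|E].
    by rewrite -[a]/(sval (to_hnat aN)) HQ => -[<-].
  exists (sval (htval hn t)); first by case: (htval hn t).
  by rewrite HQ.
- have [P [Q [PQ HP HQ]]] := tm_def t.
  eexists; eexists; split; first exact: (def_ex naturals (def_and PQ
    (def_has i.*2.+2 0 (crel (@cset V) r)))).
    move=> en es; rewrite /sfsat /= mix_odd; split=> [[_ /naturalsP[a ->]]|E].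
      by rewrite HP => -[<-] /srelP.
    exists (num V (tmval id (fun g => g) en t)); first exact: numN.
    by rewrite HP; split=> //; apply/srelP.
  move=> hn hs; rewrite /hsat /= -/htval /henv mix_odd; split=> [[a aN]|E].
    by rewrite -[a]/(sval (to_hnat aN)) HQ => -[<-].
  exists (sval (htval hn t)); first by case: (htval hn t).
  by rewrite HQ.
- eexists; eexists; split; first exact: (def_not PQ).
    by move=> en es; have := HP en es; rewrite /sfsat /=; tauto.
  by move=> hn hs; have := HQ hn hs; rewrite /hsat /=; tauto.
- eexists; eexists; split; first exact: (def_and PQ PQ').
    by move=> en es; have := HP en es; have := HP' en es; rewrite /sfsat /=; tauto.
  by move=> hn hs; have := HQ hn hs; have := HQ' hn hs; rewrite /hsat /=; tauto.
- eexists; eexists; split; first exact: (def_or PQ PQ').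
    by move=> en es; have := HP en es; have := HP' en es; rewrite /sfsat /=; tauto.
  by move=> hn hs; have := HQ hn hs; have := HQ' hn hs; rewrite /hsat /=; tauto.
- eexists; eexists; split; first exact: (def_imp PQ PQ').
    by move=> en es; have := HP en es; have := HP' en es; rewrite /sfsat /=; tauto.
  by move=> hn hs; have := HQ hn hs; have := HQ' hn hs; rewrite /hsat /=; tauto.
- eexists; eexists; split; first exact: (def_all naturals (def_ren (bindv x.*2) PQ)).
    move=> en es /=; split=> H.
      move=> n; have := H _ (numN n).
      by rewrite scons_bindv upd_mix_even -comp_upd HP.
    by move=> _ /naturalsP[n ->]; rewrite scons_bindv upd_mix_even -comp_upd HP; apply: H.
  move=> hn hs /=; split=> H.
    move=> h; have := H (sval h); rewrite scons_bindv upd_mix_even hupdE HQ.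
    by apply; case: (h).
  move=> a aN; rewrite -[a]/(sval (to_hnat aN)) scons_bindv upd_mix_even hupdE HQ.
  exact: H.
- eexists; eexists; split; first exact: (def_ex naturals (def_ren (bindv x.*2) PQ)).
    move=> en es /=; split=> [[_ /naturalsP[n ->]]|[n H]].
      by rewrite scons_bindv upd_mix_even -comp_upd HP => H; exists n.
    exists (num V n) => //.
    by rewrite scons_bindv upd_mix_even -comp_upd HP.
  move=> hn hs /=; split=> [[a aN]|[h H]].
    rewrite -[a]/(sval (to_hnat aN)) scons_bindv upd_mix_even hupdE HQ.
    by move=> H; exists (to_hnat aN).
  exists (sval h); first by case: (h).
  by rewrite scons_bindv upd_mix_even hupdE HQ.
- eexists; eexists; split; first exact: (def_all powN (def_ren (bindv x.*2.+1) PQ)).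
    move=> en es /=; split=> H.
      move=> A; have := H (cset V A); rewrite scons_bindv upd_mix_odd -comp_upd HP.
      by apply; apply/powNP; exists A.
    by move=> _ /powNP[A ->]; rewrite scons_bindv upd_mix_odd -comp_upd HP; apply: H.
  move=> hn hs /=; split=> H.
    move=> h; have := H (sval h); rewrite scons_bindv upd_mix_odd supdE HQ.
    by apply; case: (h).
  move=> a aN; rewrite -[a]/(sval (to_iint aN)) scons_bindv upd_mix_odd supdE HQ.
  exact: H.
- eexists; eexists; split; first exact: (def_ex powN (def_ren (bindv x.*2.+1) PQ)).
    move=> en es /=; split=> [[_ /powNP[n ->]]|[n H]].
      by rewrite scons_bindv upd_mix_odd -comp_upd HP => H; exists n.
    exists (cset V n); first by apply/powNP; exists n.
    by rewrite scons_bindv upd_mix_odd -comp_upd HP.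
  move=> hn hs /=; split=> [[a aN]|[h H]].
    rewrite -[a]/(sval (to_iint aN)) scons_bindv upd_mix_odd supdE HQ.
    by move=> H; exists (to_iint aN).
  exists (sval h); first by case: (h).
  by rewrite scons_bindv upd_mix_odd supdE HQ.
Qed.

Lemma senv_valid P Q : def W P Q -> (forall en es, P (senv en es)) ->
  forall hn hs, Q (henv hn hs).
Proof.
move=> d H hn hs.
apply: (def_valid d (D := mix (fun=> naturals) (fun=> powN))).
- move=> i; rewrite /mix; case: odd; [exact: powN_inh | exact: nat_inh].
- move=> e eD.
  have /choice [en enE] : forall i, exists n, e i.*2 = num V n.
    by move=> i; apply/naturalsP; have := eD i.*2; rewrite mix_even.
  have /choice [es esE] : forall i, exists A, e i.*2.+1 = cset V A.
    by move=> i; apply/powNP; have := eD i.*2.+1; rewrite mix_odd.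
  rewrite (_ : e = senv en es) //; apply: funext => i.
  by case: (nat_parity i) => ->; rewrite ?(mix_even, mix_odd).
- move=> i; rewrite /henv; case: (nat_parity i) => ->; rewrite ?(mix_even, mix_odd).
    by case: (hn _).
  by case: (hs _).
Qed.

Lemma fm_valid f : (forall en es, sfsat en es f) -> forall hn hs, hsat hn hs f.
Proof.
have [P [Q [PQ HP HQ]]] := fm_def f => H hn hs.
by rewrite -HQ; apply: (senv_valid PQ) => en es; rewrite HP.
Qed.

Definition bindv2 x i := if i == x then 0 else i.+2.

Lemma scons_bindv2 T (e : nat -> T) x v w :
  scons v (scons w e) \o bindv2 x = upd e x v.
Proof. by apply: funext => i; rewrite /bindv2 /upd /=; case: eqP. Qed.

(** The internal definition principle: standard comprehension is a bounded statement over [powN],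
    hence transfers. *)
Lemma comprehension f hn hs :
  exists a : iint, forall x, hmem x a <-> hsat (upd hn 0 x) hs f.
Proof.
have [P [Q [PQ HP HQ]]] := fm_def f.
have := senv_valid (def_ex powN (def_all naturals
  (def_bi (def_mem W 0 1) (def_ren (bindv2 0) PQ)))) _ hn hs.
case=> [en es|a aP H].
  exists (cset V [set n | sfsat (upd en 0 n) es f]).
    by apply/powNP; eexists.
  move=> _ /naturalsP[n ->] /=; rewrite smem_cset scons_bindv2.
  by rewrite (upd_mix_even _ _ 0) -comp_upd HP.
exists (to_iint aP) => x.
have /= := H (sval x); rewrite scons_bindv2 (upd_mix_even _ _ 0).
by rewrite hupdE HQ; apply; case: (x).
Qed.

Lemma set_comprehension f hn hs : exists F : W,
  (forall v, imem v F -> imem v (star powN)) /\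
  forall a, imem (sval a) F <-> hsat hn (upd hs 0 a) f.
Proof.
have [P [Q [PQ HP HQ]]] := fm_def f.
have := senv_valid (def_ex (powpowN V) (def_and (def_allv 0 (def_memc W 0 powN))
   (def_all powN (def_bi (def_mem W 0 1) (def_ren (bindv2 1) PQ))))) _ hn hs.
case=> [en es|F FP [FS H]].
  exists (cfam V [set A | sfsat en (upd es 0 A) f]).
    by apply/powpowNP; eexists.
  split=> [v|].
    rewrite -[smem v _]/(elts smem (cfam V _) v) elts_cfam => -[A _ <-].
    by apply/powNP; exists A.
  move=> _ /powNP[A ->] /=; rewrite smem_cfam scons_bindv2.
  by rewrite (upd_mix_odd _ _ 0) -comp_upd HP.
exists F; split=> // a.
have /= := H (sval a); rewrite scons_bindv2 (upd_mix_odd _ _ 0).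
by rewrite supdE HQ; apply; case: (a).
Qed.

Lemma iint_sub (A : iint) v : imem v (sval A) -> imem v (hypernat W).
Proof.
have := @def_valid _ _ _ _ (fun=> powN)
  (def_allv 0 (def_memc W 0 naturals)) (fun=> powN_inh).
move=> /(_ _ (fun=> sval A)) H0; apply: H0 => [e eD u|_]; last exact: (svalP A).
have /powNP[B ->] := eD 0.
rewrite -[smem _ _]/(elts smem (cset V _) u) elts_cset => -[n _ <-].
by apply/naturalsP; exists n.
Qed.

Lemma saturation (a : nat -> iint) :
  (forall n, exists x, forall k, (k <= n)%N -> hmem x (a k)) ->
  exists x, forall k, hmem x (a k).
Proof.
move=> H.
have [n|x xa] := @countably_saturated V W (fun k => sval (a k)).
  by have [x Hx] := H n; exists (sval x).
by exists (to_hnat (iint_sub (xa 0))) => k; exact: xa.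
Qed.

Lemma set_saturation (f : nat -> fm) hn hs :
  (forall n, exists a, forall k, (k <= n)%N -> hsat (hn k) (upd (hs k) 0 a) (f k)) ->
  exists a, forall k, hsat (hn k) (upd (hs k) 0 a) (f k).
Proof.
move=> H.
have /choice [F HF] := fun k => set_comprehension (f k) (hn k) (hs k).
have [n|x xF] := @countably_saturated V W F.
  by have [a Ha] := H n; exists (sval a) => k kn; apply/(HF k).2/Ha.
exists (to_iint ((HF 0).1 _ (xF 0))) => k.
by apply/(HF k).2; exact: xF.
Qed.

Local Notation "x .1h" := (hfun (fun a _ => cfst a) x x) (at level 2, format "x .1h").
Local Notation "x .2h" := (hfun (fun a _ => csnd a) x x) (at level 2, format "x .2h").
Local Notation hpair := (hfun cpair).

(** A dummy value for set variables that a formula does not mention. *)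
Definition iint0 : iint := to_iint (star_mem ((powNP _).2 (ex_intro _ set0 erefl))).

Lemma hpairK z : hpair z.1h z.2h = z.
Proof.
apply: (@fm_valid (FEq (TF cpair (tfst (TV 0))
    (tsnd (TV 0))) (TV 0)) _ (fun=> z)
  (fun=> iint0)) => en es.
by rewrite /sfsat /= cpairK.
Qed.

Lemma hfstE x y : (hpair x y).1h = x.
Proof.
apply: (@fm_valid (FEq (TF (fun a _ => cfst a) (TF cpair (TV 0) (TV 1))
  (TF cpair (TV 0) (TV 1))) (TV 0)) _ (nth x [:: x; y]) (fun=> iint0)) => en es.
by rewrite /sfsat /= cfstE.
Qed.

Lemma hsndE x y : (hpair x y).2h = y.
Proof.
apply: (@fm_valid (FEq (TF (fun a _ => csnd a) (TF cpair (TV 0) (TV 1))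
  (TF cpair (TV 0) (TV 1))) (TV 1)) _ (nth x [:: x; y]) (fun=> iint0)) => en es.
by rewrite /sfsat /= csndE.
Qed.

Lemma hfst_rel z x : hrel (fun z x => cfst z = x) z x <-> z.1h = x.
Proof.
pose F := FR (fun z x => cfst z = x) (TV 0) (TV 1).
pose G := FEq (tfst (TV 0)) (TV 1).
apply: (@fm_valid (FAnd (FImp F G) (FImp G F)) _ (nth x [:: z; x]) (fun=> iint0)).
by move=> en es; split.
Qed.

Lemma hsnd_rel z x : hrel (fun z x => csnd z = x) z x <-> z.2h = x.
Proof.
pose F := FR (fun z x => csnd z = x) (TV 0) (TV 1).
pose G := FEq (tsnd (TV 0)) (TV 1).
apply: (@fm_valid (FAnd (FImp F G) (FImp G F)) _ (nth x [:: z; x]) (fun=> iint0)).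
by move=> en es; split.
Qed.

(** * Kuratowski pairs of hyperintegers and their numerical codes *)

Definition npairs : V := crel (num V) (fun _ _ => True).

Lemma npairsP p : smem p npairs <-> exists m n, is_pair smem p (num V m) (num V n).
Proof.
rewrite -[smem _ _]/(elts smem npairs p) elts_crel; last first.
  by move=> n; left; exact: num_lev.
by split=> [[m [n [_ H]]]|[m [n H]]]; exists m, n.
Qed.

Lemma npairs_ex m n : exists2 p, smem p npairs & is_pair smem p (num V m) (num V n).
Proof. exact/nrelP. Qed.

Lemma npairs_inh : exists p, smem p npairs.
Proof. by have [p ? _] := npairs_ex 0 0; exists p. Qed.

Lemma star_inh x a : imem x (star a) -> exists y, smem y a.
Proof.
move=> xa; have := def_transfer (def_ex a (def_eq W 0 0)) (fun=> a).
by move=> [_ /= H]; have [|y ya _] := H; [exists x | exists y].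
Qed.

Lemma hpairs_ex (x y : hnat) :
  exists2 p, imem p (star npairs) & is_pair imem p (sval x) (sval y).
Proof.
have := @def_valid _ _ _ _ (fun=> naturals) (def_has 0 1 npairs) (fun=> nat_inh).
move=> /(_ _ (fun i => sval (nth x [:: x; y] i))); apply.
- move=> e eN; have /naturalsP[m ->] := eN 0; have /naturalsP[n ->] := eN 1.
  exact/nrelP.
- by move=> i; case: (nth _ _ _).
Qed.

Lemma hpairs_mem p (x y : hnat) :
  is_pair imem p (sval x) (sval y) -> imem p (star npairs).
Proof.
(* A standard set [a] with p in its star gives the domain over which p is quantified. *)
have [a pa] := internal_star p.
have := @def_valid _ _ _ _ (nth naturals [:: a])
  (def_imp (def_pair W 0 1 2) (def_memc W 0 npairs)).
move=> /(_ _ _ (nth (sval y) [:: p; sval x])); apply.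
- by case=> [|[|i]]; [exact: star_inh pa | exact: nat_inh..].
- move=> e eD; have /naturalsP[m ->] := eD 1; have /naturalsP[n ->] := eD 2.
  by move=> H; apply/npairsP; exists m, n.
- by case=> [|[|[|i]]] //=; [case: (x) | case: (y)..].
Qed.

(** Extensionality is not an axiom of internal membership, so uniqueness is transferred from the
    superstructure. *)
Lemma hpairs_uniq p q (x y : hnat) : is_pair imem p (sval x) (sval y) ->
  is_pair imem q (sval x) (sval y) -> p = q.
Proof.
move=> Hp Hq; have pN := hpairs_mem Hp; have qN := hpairs_mem Hq.
have := @def_valid _ _ _ _ (nth naturals [:: npairs; npairs])
  (def_imp (def_pair W 0 2 3) (def_imp (def_pair W 1 2 3) (def_eq W 0 1))).
move=> /(_ _ _ (nth (sval y) [:: p; q; sval x])); apply=> //.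
- by case=> [|[|[|i]]]; [exact: npairs_inh | exact: npairs_inh | exact: nat_inh..].
- move=> e eD; exact: pair_uniq.
- by case=> [|[|[|[|i]]]] //=; [case: (x) | case: (y)..].
Qed.

Lemma hpairs_split p : imem p (star npairs) ->
  exists x y : hnat, is_pair imem p (sval x) (sval y).
Proof.
move=> pN; have := @def_valid _ _ _ _ (fun=> npairs)
  (def_ex naturals (def_ex naturals (def_pair W 2 1 0))) (fun=> npairs_inh).
move=> /(_ _ (fun=> p)) [|//|x xN [y yN H]].
  move=> e eD; have /npairsP[m [n H]] := eD 0.
  exists (num V m); first by apply/naturalsP; exists m.
  by exists (num V n) => //; apply/naturalsP; exists n.
by exists (to_hnat xN), (to_hnat yN).
Qed.

Definition decode (z : hnat) : W := s2val (cid2 (hpairs_ex z.1h z.2h)).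

Lemma decodeP z : is_pair imem (decode z) (sval z.1h) (sval z.2h).
Proof. by rewrite /decode; case: cid2. Qed.

Lemma decode_mem z : imem (decode z) (star npairs).
Proof. exact: hpairs_mem (decodeP z). Qed.

Lemma decode_pair p x y : is_pair imem p (sval x) (sval y) -> p = decode (hpair x y).
Proof.
by move=> Hp; apply: (hpairs_uniq Hp); have := decodeP (hpair x y); rewrite hfstE hsndE.
Qed.

Lemma decode_onto p : imem p (star npairs) -> exists z, p = decode z.
Proof. by move=> /hpairs_split[x [y /decode_pair ->]]; eexists. Qed.

Lemma decode_inj : injective decode.
Proof.
move=> z w E; have := decodeP z; rewrite E => H.
have [E1 E2] := pair_inj H (decodeP w).
by rewrite -(hpairK z) -(hpairK w) (sval_inj E1) (sval_inj E2).
Qed.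

Lemma code_def i j : def W
  (fun e => exists2 x, smem x naturals & exists2 y, smem y naturals &
    is_pair smem (e i) x y /\ (shas (crel (num V) (fun z x => cfst z = x)) (e j) x /\
     shas (crel (num V) (fun z x => csnd z = x)) (e j) y))
  (fun e => exists2 x, imem x (hypernat W) & exists2 y, imem y (hypernat W) &
    is_pair imem (e i) x y /\ (ihas (crel (num V) (fun z x => cfst z = x)) (e j) x /\
     ihas (crel (num V) (fun z x => csnd z = x)) (e j) y)).
Proof.
exact: (def_ex naturals (def_ex naturals (def_and (def_pair W i.+2 1 0)
  (def_and (def_has j.+2 1 _) (def_has j.+2 0 _))))).
Qed.

Lemma icodeE p z : (exists2 x, imem x (hypernat W) & exists2 y, imem y (hypernat W) &
    is_pair imem p x y /\ (ihas (crel (num V) (fun z x => cfst z = x)) (sval z) x /\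
     ihas (crel (num V) (fun z x => csnd z = x)) (sval z) y)) <-> p = decode z.
Proof.
split=> [[x xN [y yN []]]|->].
  rewrite -[x]/(sval (to_hnat xN)) -[y]/(sval (to_hnat yN)) => /decode_pair -> [].
  by rewrite -!/(hrel _ _ _) => /hfst_rel <- /hsnd_rel <-; rewrite hpairK.
exists (sval z.1h); first by case: (z.1h).
exists (sval z.2h); first by case: (z.2h).
split; first exact: decodeP.
by split; [apply/hfst_rel | apply/hsnd_rel].
Qed.

Lemma scodeE p n : (exists2 x, smem x naturals & exists2 y, smem y naturals &
    is_pair smem p x y /\ (shas (crel (num V) (fun z x => cfst z = x)) (num V n) x /\
     shas (crel (num V) (fun z x => csnd z = x)) (num V n) y)) <->
  is_pair smem p (num V (cfst n)) (num V (csnd n)).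
Proof.
split=> [[_ /naturalsP[x ->] [_ /naturalsP[y ->]]]|H].
  by move=> [? [/nrelP -> /nrelP ->]].
exists (num V (cfst n)); first by apply/naturalsP; eexists.
exists (num V (csnd n)); first by apply/naturalsP; eexists.
by split=> //; split; apply/nrelP.
Qed.

(** With [decode_image], this makes [decode] carry internal sets in both directions, and hence Borel
    sets. *)
Lemma decode_preimage (a : W) : exists A : iint, forall z, hmem z A <-> imem (decode z) a.
Proof.
have [b ab] := internal_star a.
have := @def_valid _ _ _ _ (fun=> b)
  (def_ex powN (def_all naturals (def_bi (def_mem W 0 1)
   (def_ex npairs (def_and (def_mem W 0 3) (code_def 0 1)))))) (fun=> star_inh ab).
move=> /(_ _ (fun=> a)) [|//|A AP H].
  move=> e _.
  exists (cset V [set n | exists2 p, smem p (e 0) &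
      is_pair smem p (num V (cfst n)) (num V (csnd n))]).
    by apply/powNP; eexists.
  move=> _ /naturalsP[n ->] /=; rewrite smem_cset.
  split=> [[p pe Hp]|[p pN [pe /scodeE Hp]]].
    exists p; last by split=> //; apply/scodeE.
    by apply/npairsP; exists (cfst n), (csnd n).
  by exists p.
exists (to_iint AP) => z; have /= Hz := H (sval z) (svalP z).
split=> [/Hz[p _ [pa /icodeE <- //]]|za]; apply/Hz.
exists (decode z); first exact: decode_mem.
by split=> //; apply/icodeE.
Qed.

Lemma decode_image (A : iint) : exists a : W, forall p,
  imem p a <-> exists2 z, hmem z A & p = decode z.
Proof.
pose rA (B : set nat) := crel (num V) (fun m n => B (cpair m n)).
(* The standard family of all binary relations on the naturals; its star bounds the quantifier over
   the image. *)
pose PN : V := setof (range rA).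
have n1 n : level smem (@satom V) 1 (num V n) by left; exact: num_lev.
have PNP v : smem v PN <-> exists B, v = rA B.
  rewrite -[smem v _]/(elts smem PN v) (@elts_setof _ 4).
    by split=> [[n _ <-]|[n ->]]; exists n.
  by move=> _ [B _ <-]; right; rewrite /= elts_crel //; exact: crel_lev3.
have := @def_valid _ _ _ _ (fun=> powN)
  (def_ex PN (def_and (def_allv 0 (def_memc W 0 npairs))
   (def_all npairs (def_bi (def_mem W 0 1)
     (def_exv 2 (code_def 1 0)))))) (fun=> powN_inh).
move=> /(_ _ (fun=> sval A)) [|i|a _ [aN H]]; last first.
- exists a => p; split=> [pa|[z zA pz]].
    have /= [+ _] := H p (aN _ pa).
    move=> /(_ pa) [z zA].
    rewrite -[z]/(sval (to_hnat (iint_sub zA))) => /icodeE ->.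
    by exists (to_hnat (iint_sub zA)).
  have pN : imem p (star npairs) by rewrite pz; exact: decode_mem.
  have /= [_] := H p pN.
  by apply; exists (sval z) => //; apply/icodeE.
- exact: (svalP A).
move=> e eD; have /powNP[B EB] := eD 0; exists (rA B); first by apply/PNP; exists B.
have rB p : smem p (rA B) <->
    exists m n, B (cpair m n) /\ is_pair smem p (num V m) (num V n).
  by rewrite -[smem p _]/(elts smem (rA B) p) elts_crel.
split=> [p /rB[m [n [_ Hp]]]|p pN].
  by apply/npairsP; exists m, n.
rewrite /= rB EB; split=> [[m [n [Bmn Hp]]]|[v]].
  exists (num V (cpair m n)); first exact/smem_cset.
  by apply/scodeE; rewrite cfstE csndE.
rewrite -[smem v _]/(elts smem (cset V _) v) elts_cset => -[n Bn <-] /scodeE Hp.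
by exists (cfst n), (csnd n); rewrite cpairK.
Qed.
End Hyper.

Notation hpair := (hfun cpair).
Notation "x .1h" := (hfun (fun u _ => cfst u) x x) (at level 2, format "x .1h").
Notation "x .2h" := (hfun (fun u _ => csnd u) x x) (at level 2, format "x .2h").

(** * Hyperfinite cardinalities *)

Definition nle (a b : nat) : Prop := (a <= b)%N.
Definition nlt (a b : nat) : Prop := (a < b)%N.
(** The standard factor k is part of the function symbol, not a term. *)
Definition nmul (k a _ : nat) : nat := k * a.

Declare Scope hyper_scope.
Delimit Scope hyper_scope with H.
Notation "x <= y" := (hrel nle x y) : hyper_scope.
Notation "x < y" := (hrel nlt x y) : hyper_scope.
Notation "x + y" := (hfun addn x y) : hyper_scope.
Notation "x - y" := (hfun subn x y) : hyper_scope.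
Notation "k *: x" := (hfun (nmul k) x x) (at level 40) : hyper_scope.

Ltac list_add l x :=
  let rec go m := lazymatch m with
    | nil => constr:(cons x l)
    | cons x _ => l
    | cons _ ?m' => go m' end in go l.

Ltac list_index l x :=
  lazymatch l with
  | cons x _ => constr:(0)
  | cons _ ?l' => let i := list_index l' x in constr:(S i)
  end.

Ltac tm_atoms l t :=
  lazymatch t with
  | hfun _ ?a ?b => let l1 := tm_atoms l a in tm_atoms l1 b
  | hcst _ _ => l
  | _ => list_add l t
  end.

Ltac fm_atoms l p :=
  lazymatch p with
  | ?a -> False => fm_atoms l a
  | ?a -> ?b => let l1 := fm_atoms l a in fm_atoms l1 b
  | ~ ?a => fm_atoms l a
  | ?a /\ ?b => let l1 := fm_atoms l a in fm_atoms l1 b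
  | ?a \/ ?b => let l1 := fm_atoms l a in fm_atoms l1 b
  | hrel _ ?a ?b => let l1 := tm_atoms l a in tm_atoms l1 b
  | ?a = ?b => let l1 := tm_atoms l a in tm_atoms l1 b
  end.

Ltac tm_reify l t :=
  lazymatch t with
  | hfun ?g ?a ?b =>
      let ra := tm_reify l a in let rb := tm_reify l b in constr:(TF g ra rb)
  | hcst _ ?k => constr:(TC k)
  | _ => let i := list_index l t in constr:(TV i)
  end.

Ltac fm_reify l p :=
  lazymatch p with
  | ?a -> False => let r := fm_reify l a in constr:(FNot r)
  | ?a -> ?b =>
      let ra := fm_reify l a in let rb := fm_reify l b in constr:(FImp ra rb)
  | ~ ?a => let r := fm_reify l a in constr:(FNot r)
  | ?a /\ ?b =>
      let ra := fm_reify l a in let rb := fm_reify l b in constr:(FAnd ra rb)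
  | ?a \/ ?b =>
      let ra := fm_reify l a in let rb := fm_reify l b in constr:(FOr ra rb)
  | hrel ?r ?a ?b =>
      let ra := tm_reify l a in let rb := tm_reify l b in constr:(FR r ra rb)
  | ?a = ?b =>
      let ra := tm_reify l a in let rb := tm_reify l b in constr:(FEq ra rb)
  end.

Ltac hrevert :=
  repeat match goal with
  | H : hrel _ _ _ |- _ => revert H
  | H : ~ (hrel _ _ _) |- _ => revert H
  | H : @eq (hnat _) _ _ |- _ => revert H
  end.

(* Transfers a quantifier-free goal about hyperintegers to the natural numbers. *)
Ltac htransfer :=
  hrevert; cbv beta;
  lazymatch goal with
  | |- ?p =>
      let l := fm_atoms open_constr:(@nil (hnat _)) p in
      lazymatch l with
      | cons ?d _ =>
          let f := fm_reify l p in
          refine (@fm_valid _ _ f _ (nth d l) (fun=> iint0 _));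
          let en := fresh "en" in let es := fresh "es" in
          intros en es; unfold sfsat, nle, nlt, nmul; simpl
      end
  end.
Ltac hlia := first [htransfer; lia | exfalso; htransfer; lia].
Ltac hnia := first [htransfer; nia | exfalso; htransfer; nia].

(** * Finite cardinality of sets of naturals *)

Definition scard (A : set nat) n :=
  exists2 s, uniq s /\ size s = n & forall x, A x <-> x \in s.

Lemma scardU A B a b : scard A a -> scard B b -> (forall x, A x -> ~ B x) ->
  scard (A `|` B) (a + b).
Proof.
move=> [s [us <-] sA] [t [ut <-] tB] D; exists (s ++ t); last first.
  move=> x; rewrite mem_cat; split=> [[/sA->//|/tB->]|/orP[/sA|/tB]].
  - by rewrite orbT.
  - by left.
  - by right.
rewrite cat_uniq us ut size_cat andbT; split=> //.
by apply/hasPn => x /tB Bx; apply/negP => /sA /D.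
Qed.

(** After transfer this compares any internal set with a given size, whether or not the set is
    hyperfinite. *)
Lemma scard_total A n :
  (exists2 B, B `<=` A & scard B n) \/ exists2 m, (m < n)%N & scard A m.
Proof.
elim: n => [|n [[B BA [s [us sn] sB]]|[m mn mA]]].
- by left; exists set0 => //; exists [::] => //= x; split.
- have [[x Ax xs]|H] := EM (exists2 x, A x & x \notin s).
    left; exists [set y | y \in x :: s]; last first.
      by exists (x :: s) => //=; rewrite xs us sn.
    by move=> y; rewrite /= inE => /orP[/eqP->//|/sB /BA].
  right; exists n => //; exists s => // x; split=> [Ax|/sB/BA //].
  by apply: contrapT => /negP xs; apply: H; exists x.
- by right; exists m => //; lia.
Qed.

Lemma scard_inj (g : nat -> nat) A B b : scard B b ->
  (forall x y, A x -> A y -> g x = g y -> x = y) -> (forall x, A x -> B (g x)) ->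
  exists2 a, (a <= b)%N & scard A a.
Proof.
move=> [t [ut <-] tB] gI gAB.
have [[C CA [s [us sn] sC]]|[m mn mA]] := scard_total A (size t).+1; last by exists m.
have : (size (map g s) <= size t)%N.
  apply: uniq_leq_size.
    by rewrite map_inj_in_uniq // => x y /sC/CA Ax /sC/CA Ay; apply: gI.
  by move=> _ /mapP[x /sC/CA Ax ->]; apply/tB/gAB.
by rewrite size_map sn ltnn.
Qed.

Lemma scard_surj (g : nat -> nat) A B b : scard B b ->
  (forall x, A x -> exists2 y, B y & g y = x) ->
  exists2 a, (a <= b)%N & scard A a.
Proof.
move=> [t [ut <-] tB] gS.
have [[C CA [s [us sn] sC]]|[m mn mA]] := scard_total A (size t).+1; last by exists m.
have : (size s <= size (map g t))%N.
  apply: uniq_leq_size => // x /sC/CA/gS[y By <-]; apply: map_f; exact/tB.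
by rewrite size_map sn ltnn.
Qed.

Lemma scard_uniq A a b : scard A a -> scard A b -> a = b.
Proof.
move=> cA cA'; apply/eqP; rewrite eqn_leq.
have E c c' : scard A c -> scard A c' -> (c <= c')%N.
  move=> [s [us <-] sA] [t [ut <-] tA].
  by apply: uniq_leq_size => // x /sA /tA.
by rewrite !E.
Qed.

Lemma scard_seg n : scard [set x | (x < n)%N] n.
Proof.
exists (iota 0 n); first by rewrite iota_uniq size_iota.
by move=> x; rewrite mem_iota.
Qed.

Lemma scard_bij A B n : scard A n -> scard B n ->
  exists F : set nat, (forall x, A x -> exists y, B y /\ F (cpair x y)) /\
    (forall x y y', A x -> F (cpair x y) -> F (cpair x y') -> y = y') /\
    (forall x x' y, A x -> A x' -> F (cpair x y) -> F (cpair x' y) -> x = x') /\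
    (forall y, B y -> exists x, A x /\ F (cpair x y)).
Proof.
move=> [s [us sn] sA] [t [ut tn] tB].
exists [set z | exists2 i, (i < n)%N & cfst z = nth 0 s i /\ csnd z = nth 0 t i].
split=> [x /sA xs|]; last split; last split.
- have i : (index x s < n)%N by rewrite -sn index_mem.
  exists (nth 0 t (index x s)); split; first by apply/tB/mem_nth; rewrite tn.
  by exists (index x s); rewrite //= cfstE csndE nth_index.
- move=> x y y' Ax [i il]; rewrite cfstE csndE => -[-> ->] [j jl].
  rewrite cfstE csndE => -[/eqP + ->].
  by rewrite nth_uniq ?sn // => /eqP ->.
- move=> x x' y Ax Ax' [i il]; rewrite cfstE csndE => -[-> ->] [j jl].
  rewrite cfstE csndE => -[-> /eqP].
  by rewrite nth_uniq ?tn // => /eqP ->.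
- move=> y /tB yt; have i : (index y t < n)%N by rewrite -tn index_mem.
  exists (nth 0 s (index y t)); split; first by apply/sA/mem_nth; rewrite sn.
  by exists (index y t); rewrite //= cfstE csndE nth_index.
Qed.

Lemma sinfinite_inj A : (forall n, exists B, B `<=` A /\ scard B n) ->
  exists F : set nat, (forall x, exists y, A y /\ F (cpair x y)) /\
    (forall x y y', F (cpair x y) -> F (cpair x y') -> y = y') /\
    (forall x x' y, F (cpair x y) -> F (cpair x' y) -> x = x').
Proof.
move=> H; have /choice [nxt Hn] : forall n, exists y, A y /\ (n <= y)%N.
  move=> n; have [B [BA cB]] := H n.+1.
  have [//|N] := EM (exists y, A y /\ (n <= y)%N).
  have [|m] := @scard_inj id B _ _ (scard_seg n) (fun x y _ _ => id).
    by move=> x /BA Ax; rewrite /= ltnNge; apply/negP => nx; apply: N; exists x.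
  by move=> mn /(scard_uniq cB) E; lia.
pose e n := iter n (fun y => nxt y.+1) (nxt 0).
have eA n : A (e n) by rewrite /e; case: n => [|n]; apply: (Hn _).1.
have eS n : (e n < e n.+1)%N by exact: (Hn _).2.
have em m n : (m < n)%N -> (e m < e n)%N.
  elim: n => // n IH; rewrite ltnS leq_eqVlt => /orP[/eqP-> //|/IH h].
  exact: ltn_trans h (eS n).
exists [set z | csnd z = e (cfst z)]; split=> [x|]; last split.
- by exists (e x); rewrite /= cfstE csndE.
- by move=> x y y'; rewrite /= !cfstE !csndE => -> ->.
- move=> x x' y; rewrite /= !cfstE !csndE => ->.
  by have [/em|/em|//] := ltngtP x x'; lia.
Qed.

(** This expresses [hbij F A B], with set variables 0, 1, 2 for F, A, B. *)
Definition fbij : fm :=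
  FAnd (FAllN 1 (FImp (FM (TV 1) 1) (FExN 2 (FAnd (FM (TV 2) 2) (FMpair 1 2 0)))))
 (FAnd (FAllN 1 (FAllN 2 (FAllN 3 (FImp (FM (TV 1) 1) (FImp (FMpair 1 2 0)
          (FImp (FMpair 1 3 0) (FEq (TV 2) (TV 3))))))))
 (FAnd (FAllN 1 (FAllN 2 (FAllN 3 (FImp (FM (TV 1) 1) (FImp (FM (TV 2) 1)
          (FImp (FMpair 1 3 0) (FImp (FMpair 2 3 0) (FEq (TV 1) (TV 2)))))))))
       (FAllN 1 (FImp (FM (TV 1) 2) (FExN 2 (FAnd (FM (TV 2) 1) (FMpair 2 1 0))))))).

(** * Internal sets of hyperintegers and their sizes *)

Section Card.
Variables (V : superstructure) (W : nonstandard_universe V).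
Local Notation H := (hnat W).
Local Notation IS := (iint W).
Local Open Scope hyper_scope.

Definition ext (a : IS) : set H := [set x | hmem x a].
Definition intl (A : set H) := exists a, ext a = A.
Definition hcard (A : set H) n := exists2 a, ext a = A & hcard_rel scard a n.

Lemma hcard_intl A n : hcard A n -> intl A. Proof. by move=> [a]; exists a. Qed.

Lemma intl_fm f (hn : nat -> H) (hs : nat -> IS) :
  intl [set x | hsat (upd hn 0 x) hs f].
Proof.
have [a Ha] := comprehension f hn hs.
by exists a; apply/predeqP => x; exact: Ha.
Qed.

Lemma intlU A B : intl A -> intl B -> intl (A `|` B).
Proof.
move=> [a <-] [b <-].
exact: (intl_fm (FOr (FM (TV 0) 0) (FM (TV 0) 1)) (fun=> hcst W 0)
  (nth a [:: a; b])).
Qed.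

Lemma intlI A B : intl A -> intl B -> intl (A `&` B).
Proof.
move=> [a <-] [b <-].
exact: (intl_fm (FAnd (FM (TV 0) 0) (FM (TV 0) 1)) (fun=> hcst W 0)
  (nth a [:: a; b])).
Qed.

Lemma intlD A B : intl A -> intl B -> intl (A `\` B).
Proof.
move=> [a <-] [b <-].
exact: (intl_fm (FAnd (FM (TV 0) 0) (FNot (FM (TV 0) 1))) (fun=> hcst W 0)
  (nth a [:: a; b])).
Qed.

Lemma intlT : intl setT.
Proof.
have [a Ha] := comprehension (FEq (TV 0) (TV 0)) (fun=> hcst W 0) (fun=> iint0 W).
by exists a; apply/predeqP => x; split=> // _; apply/Ha.
Qed.

Lemma intl0 : intl set0.
Proof. by rewrite -(setDv setT); exact: intlD intlT intlT. Qed.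

Lemma intl_seg r n : intl [set x : H | hrel r x n].
Proof. exact: (intl_fm (FR r (TV 0) (TV 1)) (fun=> n) (fun=> iint0 W)). Qed.

Lemma hcard_rel_ext (a b : IS) n : ext a = ext b ->
  hcard_rel scard a n -> hcard_rel scard b n.
Proof.
move=> E; have := @fm_valid _ W (FImp (FAnd (Fsub 0 1) (Fsub 1 0))
  (FImp (FC scard 0 (TV 0)) (FC scard 1 (TV 0))))
  _ (fun=> n) (nth a [:: a; b]).
apply=> [en es /= [S1 S2]|].
  suff -> : es 0 = es 1 by [].
  by apply/predeqP => x; split; [exact: S1 | exact: S2].
by split=> x; rewrite /= -[hmem x a]/(ext a x) -[hmem x b]/(ext b x) E.
Qed.

Lemma hcardE A a n : ext a = A -> hcard A n <-> hcard_rel scard a n.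
Proof.
by move=> E; split=> [[b Eb]|c]; [apply: hcard_rel_ext; rewrite E | exists a].
Qed.

Lemma hcardU A B a b : hcard A a -> hcard B b -> (forall x, A x -> ~ B x) ->
  hcard (A `|` B) (a + b).
Proof.
move=> cA cB D; have [c Ec] := intlU (hcard_intl cA) (hcard_intl cB).
case: cA cB Ec D => a' <- ca [b' <- cb] Ec D; rewrite (hcardE _ Ec).
have := @fm_valid _ W (FImp (FC scard 0 (TV 0)) (FImp (FC scard 1 (TV 1))
  (FImp (FAllN 9 (FImp (FM (TV 9) 0) (FNot (FM (TV 9) 1))))
  (FImp (FAllN 9 (FAnd (FImp (FM (TV 9) 2) (FOr (FM (TV 9) 0) (FM (TV 9) 1)))
      (FImp (FOr (FM (TV 9) 0) (FM (TV 9) 1)) (FM (TV 9) 2))))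
   (FC scard 2 (TF addn (TV 0) (TV 1))))))) _ (nth a [:: a; b]) (nth a' [:: a'; b'; c]).
apply=> //.
  move=> en es /= c0 c1 D' E; rewrite (_ : es 2 = es 0 `|` es 1).
    exact: scardU.
  by apply/predeqP => x; have [] := E x.
by move=> x; have /predeqP/(_ x) := Ec; rewrite /= => -[].
Qed.

Lemma hcard_uniq A a b : hcard A a -> hcard A b -> a = b.
Proof.
move=> [c E ca]; rewrite (hcardE _ E) => cb.
apply: (@fm_valid _ W (FImp (FC scard 0 (TV 0))
  (FImp (FC scard 0 (TV 1)) (FEq (TV 0) (TV 1))))
  _ (nth a [:: a; b]) (fun=> c)) => // en es; exact: scard_uniq.
Qed.

Lemma hcard_total A n : intl A ->
  (exists2 B, B `<=` A & hcard B n) \/ exists2 m, m < n & hcard A m.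
Proof.
move=> [a <-].
have := @fm_valid _ W (FOr (FExS 1 (FAnd (Fsub 1 0) (FC scard 1 (TV 0))))
  (FExN 1 (FAnd (FR nlt (TV 1) (TV 0)) (FC scard 0 (TV 1))))) _ (fun=> n) (fun=> a).
case=> [en es /=|[b [ba cb]]|[m [mn cm]]].
- have [[B BA cB]|[m mn cA]] := scard_total (es 0) (en 0).
    by left; exists B.
  by right; exists m.
- by left; exists (ext b) => //; exists b.
- by right; exists m => //; exists a.
Qed.

(** It is applied to the identity and to the projections of codes, so it is enough to let g be a
    standard function. *)
Lemma hcard_inj g A B b : hcard B b -> intl A ->
  (forall x y, A x -> A y -> hfun g x x = hfun g y y -> x = y) ->
  (forall x, A x -> B (hfun g x x)) ->
  exists2 a, a <= b & hcard A a.
Proof.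
move=> [b' <- cb] [a' <-] gI gAB.
have := @fm_valid _ W (FImp (FC scard 1 (TV 0)) (FImp
   (FAllN 1 (FAllN 2 (FImp (FM (TV 1) 0) (FImp (FM (TV 2) 0)
    (FImp (FEq (TF g (TV 1) (TV 1)) (TF g (TV 2) (TV 2))) (FEq (TV 1) (TV 2)))))))
   (FImp (FAllN 1 (FImp (FM (TV 1) 0) (FM (TF g (TV 1) (TV 1)) 1)))
   (FExN 1 (FAnd (FR nle (TV 1) (TV 0)) (FC scard 0 (TV 1))))))) _ (fun=> b)
   (nth a' [:: a'; b']).
case=> [en es /= cB gI' gAB'||||a [ab ca]] //.
  have [a ab ca] := @scard_inj (fun x => g x x) (es 0) (es 1) _ cB gI' gAB'.
  by exists a.
by exists a => //; exists a'.
Qed.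

Lemma hcard_surj g A B b : hcard B b -> intl A ->
  (forall x, A x -> exists2 y, B y & hfun g y y = x) ->
  exists2 a, a <= b & hcard A a.
Proof.
move=> [b' <- cb] [a' <-] gS.
have := @fm_valid _ W (FImp (FC scard 1 (TV 0)) (FImp
   (FAllN 1 (FImp (FM (TV 1) 0) (FExN 2 (FAnd (FM (TV 2) 1)
     (FEq (TF g (TV 2) (TV 2)) (TV 1))))))
   (FExN 1 (FAnd (FR nle (TV 1) (TV 0)) (FC scard 0 (TV 1)))))) _ (fun=> b)
   (nth a' [:: a'; b']).
case=> [en es /= cB gS'|//|x /gS[y]|a [ab ca]].
- have [x /gS'[y [? ?]]|a ab ca] := @scard_surj (fun x => g x x) (es 0) _ _ cB.
    by exists y.
  by exists a.
- by exists y.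
- by exists a => //; exists a'.
Qed.

Lemma hcard_sub A B b : hcard B b -> intl A -> A `<=` B ->
  exists2 a, a <= b & hcard A a.
Proof.
move=> cB iA AB.
have E (x : H) : hfun (fun a _ => a) x x = x.
  by htransfer.
apply: (@hcard_inj (fun a _ => a) _ _ _ cB iA) => [x y _ _|x Ax]; rewrite !E //.
exact: AB.
Qed.

Lemma hcard_seg n : hcard [set x : H | x < n] n.
Proof.
have [a Ea] := intl_seg nlt n; exists a => //.
apply: (@fm_valid _ W (FImp (FAllN 1 (FAnd (FImp (FM (TV 1) 0) (FR nlt (TV 1) (TV 0)))
  (FImp (FR nlt (TV 1) (TV 0)) (FM (TV 1) 0)))) (FC scard 0 (TV 0)))
  _ (fun=> n) (fun=> a)).
  move=> en es /= E; rewrite (_ : es 0 = [set x | (x < en 0)%N]).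
    exact: scard_seg.
  by apply/predeqP => x; have [] := E x.
by move=> x; have /predeqP/(_ x) := Ea; rewrite /= => -[].
Qed.

(** The conditions concern inputs in A only. F may contain further pairs, so that one F can serve a
    whole chain of sets at once. *)
Definition hbij (F A B : set H) :=
  (forall x, A x -> exists y, B y /\ F (hpair x y)) /\
  (forall x y y', A x -> F (hpair x y) -> F (hpair x y') -> y = y') /\
  (forall x x' y, A x -> A x' -> F (hpair x y) -> F (hpair x' y) -> x = x') /\
  (forall y, B y -> exists x, A x /\ F (hpair x y)).

Lemma hcard_bij A B n : hcard A n -> hcard B n -> exists2 F, intl F & hbij F A B.
Proof.
move=> [a <- ca] [b <- cb].
have := @fm_valid _ W (FImp (FC scard 1 (TV 0))
  (FImp (FC scard 2 (TV 0)) (FExS 0 fbij))) _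
  (fun=> n) (nth a [:: a; a; b]).
case=> [en es /=|||F HF] //; first exact: scard_bij.
by exists (ext F); [exists F | exact: HF].
Qed.

Lemma hinfinite_inj A : intl A -> (forall n, exists2 B, B `<=` A & hcard B n) ->
  exists F, intl F /\ (forall x, exists y, A y /\ F (hpair x y)) /\
    (forall x y y', F (hpair x y) -> F (hpair x y') -> y = y') /\
    (forall x x' y, F (hpair x y) -> F (hpair x' y) -> x = x').
Proof.
move=> [a <-] Ha.
have := @fm_valid _ W (FImp (FAllN 0 (FExS 1 (FAnd (Fsub 1 0) (FC scard 1 (TV 0)))))
  (FExS 1 (FAnd (FAllN 1 (FExN 2 (FAnd (FM (TV 2) 0) (FMpair 1 2 1))))
  (FAnd (FAllN 1 (FAllN 2 (FAllN 3 (FImp (FMpair 1 2 1)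
           (FImp (FMpair 1 3 1) (FEq (TV 2) (TV 3)))))))
   (FAllN 1 (FAllN 2 (FAllN 3 (FImp (FMpair 1 3 1)
           (FImp (FMpair 2 3 1) (FEq (TV 1) (TV 2))))))))))) _
  (fun=> hcst W 0) (fun=> a).
case=> [en es /=|n|F HF]; first exact: sinfinite_inj.
  by have [B BA [b Eb cb]] := Ha n; exists b; split=> // x;
    rewrite -[hmem _ _]/(ext b x) Eb; apply: BA.
by exists (ext F); split; first by exists F.
Qed.
End Card.

Definition finU T (A : nat -> set T) n : set T :=
  [set x | exists2 k, (k < n)%N & A k x].

Lemma finUS T (A : nat -> set T) n : finU A n.+1 = finU A n `|` A n.
Proof.
apply/predeqP => x; split=> [[k]|[[k kn Ak]|An]].
- by rewrite ltnS leq_eqVlt => /orP[/eqP->|kn Ak]; [right | left; exists k].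
- by exists k => //; lia.
- by exists n.
Qed.

Lemma finU0 T (A : nat -> set T) : finU A 0 = set0.
Proof. by apply/predeqP => x; split=> [[]|]. Qed.

Lemma finU_le T (A : nat -> set T) m n : (m <= n)%N -> finU A m `<=` finU A n.
Proof. by move=> mn x [k km Ak]; exists k => //; exact: leq_trans mn. Qed.

(** * Souslin schemes and their branches *)

Definition sus T (A : seq nat -> set T) : set T :=
  [set x | exists f : nat -> nat, forall n, A (mkseq f n) x].

(** The part of the Souslin set that is carried by the branches through s. *)
Definition susp T (A : seq nat -> set T) s : set T :=
  [set x | exists2 f : nat -> nat, mkseq f (size s) = s &
           forall n, A (mkseq f n) x].

Lemma susp_sub T (A : seq nat -> set T) s : susp A s `<=` A s.
Proof. by move=> x [f fs /(_ (size s))]; rewrite fs. Qed.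

Lemma susp_rcons T (A : seq nat -> set T) s :
  susp A s `<=` \bigcup_i susp A (rcons s i).
Proof.
move=> x [f fs Af]; exists (f (size s)) => //.
by exists f => //; rewrite size_rcons mkseqS fs.
Qed.

Lemma path_build (P : seq nat -> Prop) : P [::] ->
  (forall s, P s -> exists i, P (rcons s i)) ->
  exists f : nat -> nat, forall n, P (mkseq f n).
Proof.
move=> P0 PS.
have /choice [h Hh] : forall s, exists i, P s -> P (rcons s i).
  by move=> s; have [/PS[i Pi]|nP] := EM (P s); [exists i | exists 0].
pose g n := iter n (fun s => rcons s (h s)) [::].
have E n : mkseq (fun k => h (g k)) n = g n.
  by elim: n => // n IH; rewrite mkseqS IH.
by exists (fun k => h (g k)) => n; rewrite E; elim: n => //= n /Hh.
Qed.

(** The induction step of [negl_finU], with p = 2^m and denominators cleared: from N s <= (1 - 1/p)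
    c, a new piece of size at most c / (2pN) leads to the bound (1 - 1/(2p)) c. *)
Lemma geom_step p N c s e d : (p * N * s + c <= p * c -> 2 * p * N * e <= c ->
  d <= s + e -> 2 * p * N * d + c <= 2 * p * c)%N.
Proof.
move=> hs he hd.
have : (2 * p * N * d <= 2 * p * N * (s + e))%N by apply: leq_mul.
by rewrite mulnDr -!mulnA in hs he *; lia.
Qed.

(** * Countable saturation and negligible internal sets *)

Section Borel.
Variables (V : superstructure) (W : nonstandard_universe V).
Local Notation H := (hnat W).
Local Open Scope hyper_scope.

Implicit Types (A B C D E X Y : set H) (a b c d e x y : H).

Lemma intl_finU (A : nat -> set H) n : (forall i, intl (A i)) -> intl (finU A n).
Proof.
move=> iA; elim: n => [|n IH]; first by rewrite finU0; exact: intl0.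
by rewrite finUS; exact: intlU.
Qed.

Lemma intl_finI (A : nat -> set H) n : (forall i, intl (A i)) ->
  intl [set x | forall k, (k < n)%N -> A k x].
Proof.
move=> iA; elim: n => [|n IH].
  rewrite (_ : [set x | _] = setT); first exact: intlT.
  by apply/predeqP => x; split.
rewrite (_ : [set x | _] = [set x | forall k, (k < n)%N -> A k x] `&` A n).
  exact: intlI.
apply/predeqP => x; split=> [h|[h An] k]; first by split=> [k kn|]; apply: h; lia.
by rewrite ltnS leq_eqVlt => /orP[/eqP->|/h].
Qed.

Lemma sat_sets (A : nat -> set H) : (forall i, intl (A i)) ->
  (forall n, exists x, forall k, (k <= n)%N -> A k x) -> exists x, forall k, A k x.
Proof.
move=> /choice [a Ea] h; have [n|x Hx] := @saturation _ W a.
  by have [x Hx] := h n; exists x => k /Hx; rewrite -Ea.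
by exists x => k; rewrite -Ea; exact: Hx.
Qed.

Lemma sat_cover (A : set H) (B : nat -> set H) : intl A -> (forall i, intl (B i)) ->
  A `<=` \bigcup_i B i -> exists n, A `<=` finU B n.
Proof.
move=> iA iB AB; apply: contrapT => N.
have [||x Hx] := @sat_sets (fun i => A `\` B i).
- by move=> i; exact: intlD.
- move=> n; apply: contrapT => N'; apply: N; exists n.+1 => x Ax.
  apply: contrapT => Nx; apply: N'; exists x => k kn; split=> // Bk.
  by apply: Nx; exists k.
- have [Ax _] := Hx 0; have [i _ Bi] := AB x Ax.
  by have [] := Hx i.
Qed.

(** [negl 1 c A] merely bounds the size of A by c; holding for all standard n, [negl n c A] says
    that A is Loeb null at scale c. *)
Definition negl n (c : H) (A : set H) := exists2 e, hcard A e & n *: e <= c.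
Definition ge (A : set H) (x : H) := exists2 B, B `<=` A & hcard B x.

Lemma negl_intl n c A : negl n c A -> intl A.
Proof. by move=> [e /hcard_intl]. Qed.

Lemma negl_sub n c A B : negl n c B -> intl A -> A `<=` B -> negl n c A.
Proof.
move=> [b cB nb] iA AB; have [a ab cA] := hcard_sub cB iA AB.
by exists a => //; hnia.
Qed.

Lemma hcardUle A B a b : hcard A a -> hcard B b ->
  exists2 c, c <= a + b & hcard (A `|` B) c.
Proof.
move=> cA cB; have [||b' bb cB'] := @hcard_sub _ _ (B `\` A) _ _ cB.
- exact: intlD (hcard_intl cB) (hcard_intl cA).
- by move=> x [].
exists (a + b'); first by hlia.
rewrite (_ : A `|` B = A `|` (B `\` A)); first by apply: hcardU => // x Ax [].
apply/predeqP => x; split=> [[|Bx]|[|[]]]; [by left | | by left | by right].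
by have [Ax|nAx] := EM (A x); [left | right].
Qed.

Lemma hcardD A B a b : hcard A a -> hcard B b -> A `<=` B -> hcard (B `\` A) (b - a).
Proof.
move=> cA cB AB; have [||e _ ce] := @hcard_sub _ _ (B `\` A) _ _ cB.
- exact: intlD (hcard_intl cB) (hcard_intl cA).
- by move=> x [].
have := hcardU cA ce (fun x Ax h => h.2 Ax).
rewrite setDUK // => /(hcard_uniq cB) E.
by rewrite (_ : b - a = e) //; hlia.
Qed.

Lemma hcard0 : hcard (set0 : set H) (hcst W 0).
Proof.
have [e ee c0] := hcard_sub (hcard_seg (hcst W 0)) (intl0 W) (@sub0set _ _).
by rewrite (_ : hcst W 0 = e) //; hlia.
Qed.

Lemma negl_of_notge A x : intl A -> ~ ge A x -> negl 1 x A.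
Proof.
move=> iA N; have [[B BA cB]|[m mx cA]] := hcard_total x iA.
  by case: N; exists B.
by exists m => //; hlia.
Qed.

(** The weights 2^-(i+1) sum to less than 1, so the bound is uniform in m; through [sat_negl] it
    then passes to infinitely many pieces. *)
Lemma negl_finU N c (E : nat -> set H) m :
  (forall i, (i < m)%N -> negl (2 ^ i.+1 * N) c (E i)) -> negl N c (finU E m).
Proof.
move=> HE; suff [e ce Ne] : exists2 e, hcard (finU E m) e &
    (2 ^ m * N) *: e + c <= 2 ^ m *: c.
  exists e => //; htransfer.
  have : (0 < 2 ^ m)%N by rewrite expn_gt0.
  move: (2 ^ m) (en 0) (en 1) => p x y p0; rewrite -mulnA => h.
  by rewrite -(leq_pmul2l p0); lia.
elim: m HE => [|m IH] HE.
  exists (hcst W 0); last by hlia.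
  by rewrite finU0; exact: hcard0.
have [|e ce Ne] := IH; first by move=> i im; apply: HE; lia.
have [e' ce' Ne'] := HE m (ltnSn m).
have [d de cd] := hcardUle ce ce'.
rewrite finUS; exists d => //; move: Ne Ne' de; htransfer.
by rewrite !expnS => *; apply: geom_step; eassumption.
Qed.
End Borel.

(** * Borel sets *)

Section BorelTheory.
Variables (V : superstructure) (W : nonstandard_universe V).
Local Notation H := (hnat W).
Local Open Scope hyper_scope.
Implicit Types (A B C D E X Y : set H) (a b c d e x y : H).

Definition Bor : set (set H) := <<s setT, @intl V W>>.

Lemma Bor_intl A : intl A -> Bor A.
Proof. exact: sub_sigma_algebra. Qed.

Lemma Bor_setC A : Bor A -> Bor (~` A).
Proof. by rewrite -setTD; exact: sigma_algebraCD. Qed.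

Lemma Bor_bigcup (A : nat -> set H) : (forall i, Bor (A i)) -> Bor (\bigcup_i A i).
Proof. exact: sigma_algebra_bigcup. Qed.

Lemma Bor_bigcap (A : nat -> set H) : (forall i, Bor (A i)) -> Bor (\bigcap_i A i).
Proof.
move=> BA; rewrite -(setCK (\bigcap_i _)) setC_bigcap; apply: Bor_setC.
by apply: Bor_bigcup => i; exact: Bor_setC.
Qed.

Lemma Bor_setU A B : Bor A -> Bor B -> Bor (A `|` B).
Proof.
move=> BA BB; rewrite -bigcup2E; apply: Bor_bigcup => -[|[|i]] //=.
exact: Bor_intl (intl0 W).
Qed.

Lemma Bor_setI A B : Bor A -> Bor B -> Bor (A `&` B).
Proof.
move=> BA BB; rewrite -(setCK (A `&` B)) setCI; apply: Bor_setC.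
by apply: Bor_setU; exact: Bor_setC.
Qed.

Lemma Bor_setD A B : Bor A -> Bor B -> Bor (A `\` B).
Proof. by move=> BA BB; rewrite setDE; apply: Bor_setI => //; exact: Bor_setC. Qed.

Lemma Bor_ind (P : set H -> Prop) : (forall A, intl A -> P A) ->
  (forall A, P A -> P (~` A)) ->
  (forall A : nat -> set H, (forall i, P (A i)) -> P (\bigcup_i A i)) ->
  forall A, Bor A -> P A.
Proof.
move=> Pi PC PU; apply: smallest_sub => //; split=> //.
  by apply: Pi; exact: intl0.
by move=> A PA; rewrite setTD; exact: PC.
Qed.

Definition souslin X := exists2 A : seq nat -> set H, forall s, intl (A s) & X = sus A.

Lemma souslin_intl A : intl A -> souslin A.
Proof.
move=> iA; exists (fun=> A) => //; apply/predeqP => x.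
by split=> [Ax|[f /(_ 0)]//]; exists (fun=> 0).
Qed.

Lemma souslin_bigcup (X : nat -> set H) : (forall i, souslin (X i)) ->
  souslin (\bigcup_i X i).
Proof.
move=> sX; have /choice [A HA] : forall i, exists A : seq nat -> set H,
    (forall s, intl (A s)) /\ X i = sus A.
  by move=> i; have [A ? ?] := sX i; exists A.
(* The first entry of a branch selects the set, and the empty node imposes nothing. *)
exists (fun s => if s is i :: t then A i t else setT).
  by case=> [|i t]; [exact: intlT | exact: (HA i).1].
have E (f : nat -> nat) n : mkseq f n.+1 = f 0 :: mkseq (fun k => f k.+1) n.
  by rewrite /mkseq /= -[1]/(1 + 0)%N iotaDl -map_comp.
apply/predeqP => x; split=> [[i _]|[f Hf]].
  rewrite (HA i).2 => -[f Hf]; exists (fun n => if n is k.+1 then f k else i).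
  by case=> [|n] //; rewrite E.
exists (f 0) => //; rewrite (HA (f 0)).2; exists (fun k => f k.+1) => n.
rewrite -[A (f 0) _]/(if f 0 :: mkseq (fun k => f k.+1) n is i :: t
  then A i t else setT) -E.
exact: (Hf n.+1).
Qed.

(* The branch [f] codes the branches [f (cpair i _)]; since [cpair] is
   increasing in its second argument, the length-n initial segment of the i-th
   one is determined by the first [cpair i n] values of [f]. *)
Lemma souslin_bigcap (X : nat -> set H) : (forall i, souslin (X i)) ->
  souslin (\bigcap_i X i).
Proof.
move=> sX; have /choice [A HA] : forall i, exists A : seq nat -> set H,
    (forall s, intl (A s)) /\ X i = sus A.
  by move=> i; have [A ? ?] := sX i; exists A.
pose A' s := let i := cfst (size s) in
  A i (mkseq (fun m => nth 0 s (cpair i m)) (csnd (size s))).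
have E f i n : A' (mkseq f (cpair i n)) = A i (mkseq (fun m => f (cpair i m)) n).
  rewrite /A' size_mkseq cfstE csndE; congr A.
  apply/eq_in_map => m; rewrite mem_iota add0n => /andP[_ mn].
  by rewrite nth_mkseq //; exact: cpair_ltr.
exists A'; first by move=> s; exact: (HA _).1.
apply/predeqP => x; split=> [Hx|[f Hf] i _].
  have /choice [g Hg] : forall i, exists f : nat -> nat, forall n, A i (mkseq f n) x.
    by move=> i; have := Hx i I; rewrite (HA i).2.
  exists (fun z => g (cfst z) (csnd z)) => n.
  rewrite -(cpairK n) E (_ : mkseq _ _ = mkseq (g (cfst n)) (csnd n)) //.
  by apply: eq_mkseq => m; rewrite cfstE csndE.
rewrite (HA i).2; exists (fun m => f (cpair i m)) => n.
by have := Hf (cpair i n); rewrite E.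
Qed.

(** The Souslin operation gives no closure under complements, so X and its complement are carried
    through the induction together. *)
Lemma Bor_souslin X : Bor X -> souslin X.
Proof.
move=> BX; suff [] : souslin X /\ souslin (~` X) by [].
move: X BX; apply: Bor_ind => [A iA|A [sA sC]|A sA].
- split; apply: souslin_intl => //; rewrite -setTD; exact: intlD (intlT W) iA.
- by rewrite setCK.
- split; first by apply: souslin_bigcup => i; exact: (sA i).1.
  by rewrite setC_bigcup; apply: souslin_bigcap => i; exact: (sA i).2.
Qed.

(** Each node is intersected with its predecessors, a finite and therefore internal intersection. *)
Lemma souslin_mono X : souslin X -> exists A : seq nat -> set H,
  [/\ forall s, intl (A s), forall s i, A (rcons s i) `<=` A s & X = sus A].
Proof.
move=> [A iA ->].
exists (fun s => [set x | forall k, (k < (size s).+1)%N -> A (take k s) x]); split.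
- by move=> s; apply: (@intl_finI _ _ (fun k => A (take k s))).
- move=> s i x h k ks; have := h k; rewrite size_rcons -cats1 takel_cat //.
  by apply; lia.
- apply/predeqP => x; split=> -[f Hf]; exists f => n.
    move=> k; rewrite size_mkseq ltnS => kn.
    by rewrite /mkseq -map_take take_iota (minn_idPl kn); exact: Hf.
  by have := Hf n n; rewrite size_mkseq take_oversize ?size_mkseq //; apply.
Qed.

Lemma cofinal_max (c : nat -> H) n : (forall k, exists k', c k < c k') ->
  exists k', forall k, (k <= n)%N -> c k < c k'.
Proof.
move=> cS; elim: n => [|n [k' Hk']].
  by have [k' Hk'] := cS 0; exists k' => k; rewrite leqn0 => /eqP->.
have [k1 H1] := cS n.+1; have [k2 H2] := cS k'.
have [l|l] : c k1 <= c k2 \/ c k2 <= c k1 by hlia.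
- exists k2 => k; rewrite leq_eqVlt => /orP[/eqP->|/Hk' h]; hlia.
- exists k1 => k; rewrite leq_eqVlt => /orP[/eqP->|/Hk' h]; hlia.
Qed.

Lemma decr_le (A : nat -> set H) : (forall n, A n.+1 `<=` A n) ->
  forall m n, (m <= n)%N -> A n `<=` A m.
Proof.
move=> dA m n; elim: n => [|n IH]; first by rewrite leqn0 => /eqP->.
by rewrite leq_eqVlt => /orP[/eqP->//|/IH h] x /dA /h.
Qed.

(** An overspill argument: finitely many of the conditions on x are met by a single [c k']. *)
Lemma sat_ge_bound (A : nat -> set H) (c : nat -> H) : (forall n, intl (A n)) ->
  (forall n k, ge (A n) (c k)) -> (forall k, exists k', c k < c k') ->
  exists2 x, forall k, c k < x & forall n, ge (A n) x.
Proof.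
move=> /choice [a Ea] gA cS.
pose f := FAnd (FR nlt (TV 1) (TV 0))
   (FExS 1 (FAnd (Fsub 1 0) (FC scard 1 (TV 0)))).
have [||x Hx] := @sat_sets _ _ (fun n =>
  [set x | hsat (upd (fun=> c n) 0 x) (fun=> a n) f]).
- by move=> i; exact: intl_fm.
- move=> n; have [k' Hk'] := cofinal_max n cS; exists (c k') => k kn.
  split; first exact: Hk'.
  have [B BA [b Eb cb]] := gA k k'; exists b; split=> // y.
  by rewrite -Ea -Eb in BA; exact: BA.
- exists x => n; have [cx [b [ba cb]]] := Hx n; first exact: cx.
  by exists (ext b); [rewrite -Ea; exact: ba | exists b].
Qed.

(** As the sets decrease, a subset of [A n] of size x meets all requirements up to n, and saturation
    applies. *)
Lemma sat_ge (A : nat -> set H) x : (forall n, intl (A n)) ->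
  (forall n, A n.+1 `<=` A n) -> (forall n, ge (A n) x) ->
  exists2 B, hcard B x & forall n, B `<=` A n.
Proof.
move=> iA dA gA; have /choice [a Ea] := iA.
pose f := FAnd (Fsub 0 1) (FC scard 0 (TV 0)).
have [|b Hb] := @set_saturation _ W (fun=> f) (fun _ _ => x) (fun n _ => a n).
- move=> n; have [B BA [b Eb cb]] := gA n; exists b => k kn; split=> // y.
  rewrite -[hmem _ _]/(ext b y) Eb => /BA /(decr_le dA kn).
  by rewrite -Ea.
- exists (ext b); first by exists b => //; exact: (Hb 0).2.
  by move=> n y; rewrite -Ea; exact: (Hb n).1.
Qed.

Lemma sat_negl n c (B : nat -> set H) : (forall m, negl n c (finU B m)) ->
  (forall i, intl (B i)) -> exists2 C, negl n c C & forall i, B i `<=` C.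
Proof.
move=> nB /choice [b Eb].
pose f := FAnd (Fsub 1 0)
  (FExN 1 (FAnd (FC scard 0 (TV 1)) (FR nle (TF (nmul n) (TV 1) (TV 1)) (TV 0)))).
have [|a Ha] := @set_saturation _ W (fun=> f) (fun _ _ => c) (fun n _ => b n).
- move=> m; have [e [a Ea ca] ne] := nB m.+1; exists a => k km; split; last by exists e.
  by move=> y yb; rewrite -[hmem _ _]/(ext a y) Ea; exists k => //; rewrite -Eb.
- exists (ext a); last by move=> i y; rewrite -Eb; exact: (Ha i).1.
  by have [_ [e [ce ne]]] := Ha 0; exists e => //; exists a.
Qed.

(** * A dichotomy for Souslin sets *)

Definition covered (c : nat -> H) Y :=
  exists2 B : nat -> set H, forall i, exists n, negl 1 (c n) (B i) & Y `<=` \bigcup_i B i.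

Lemma covered_bigcup (c : nat -> H) (Y : nat -> set H) : (forall i, covered c (Y i)) ->
  covered c (\bigcup_i Y i).
Proof.
move=> cY; have /choice [B HB] : forall i, exists B : nat -> set H,
    (forall i, exists n, negl 1 (c n) (B i)) /\ Y i `<=` \bigcup_i B i.
  by move=> i; have [B ? ?] := cY i; exists B.
exists (fun k => B (cfst k) (csnd k)); first by move=> k; exact: (HB _).1.
move=> x [i _ /(HB i).2 [j _ Bx]]; exists (cpair i j) => //.
by rewrite cfstE csndE.
Qed.

(* Otherwise one descends along uncovered nodes of the scheme. *)
Lemma souslin_dichotomy (A : seq nat -> set H) (c : nat -> H) : (forall s, intl (A s)) ->
  covered c (sus A) \/ exists f : nat -> nat, forall n k, ge (A (mkseq f n)) (c k).
Proof.
move=> iA; have [?|N] := EM (covered c (sus A)); [by left | right].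
have [||f Hf] := @path_build (fun s => ~ covered c (susp A s)).
- move=> [B cB sB]; apply: N; exists B => // x [f Hf]; apply: sB.
  by exists f.
- move=> s Ns; apply: contrapT => N'; apply: Ns.
  have [B cB sB] : covered c (\bigcup_i susp A (rcons s i)).
    apply: covered_bigcup => i; apply: contrapT => Ni; apply: N'.
    by exists i.
  by exists B => // x sx; apply: sB; exact: susp_rcons.
- exists f => n k; apply: contrapT => ng; apply: (Hf n).
  exists (fun=> A (mkseq f n)); first by move=> _; exists k; exact: negl_of_notge.
  by move=> x sx; exists 0 => //; exact: (susp_sub sx).
Qed.

(** Along the branch given by the dichotomy, saturation is used twice: for a common size x above all
    [c k], then for one internal set of size x inside every node, hence inside X. *)
Lemma covered_or_ge X (c : nat -> H) : Bor X -> (forall k, exists k', c k < c k') ->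
  covered c X \/ exists2 x, forall k, c k < x & ge X x.
Proof.
move=> /Bor_souslin/souslin_mono[A [iA dA ->]] cS.
have [?|[f Hf]] := souslin_dichotomy c iA; [by left | right].
have [x cx gx] := sat_ge_bound (fun n => iA (mkseq f n)) Hf cS.
have [n|B cB BA] := sat_ge (fun n => iA (mkseq f n)) _ gx.
  by rewrite mkseqS; exact: dA.
exists x => //; exists B => // y By; exists f => n; exact: BA.
Qed.

(** * Loeb measurability of Borel sets *)

Lemma near_sup (S : H -> Prop) k c N : (exists a, S a) ->
  (forall a, S a -> a <= k *: c) ->
  exists2 a, S a & forall a', S a' -> N *: a' <= N *: a + c.
Proof.
move=> [a0 S0] bS; apply: contrapT => none.
have step a : S a -> exists2 a', S a' & N *: a + c < N *: a'.
  move=> Sa; apply: contrapT => no; apply: none; exists a => // a' Sa'.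
  apply: contrapT => nle; apply: no; exists a' => //; hlia.
(* Each step raises a by more than c / N, so N k + 1 steps would pass the bound k c. The extra
   summand counts the strict inequalities and settles the case c = 0. *)
have [a Sa ha] : exists2 a, S a & (N * k).+1 *: c + hcst W (N * k).+1 <= N *: a.
  elim: (N * k).+1 => [|j [a Sa ha]]; first by exists a0 => //; hlia.
  have [a' Sa' ha'] := step a Sa; exists a' => //.
  by hnia.
by have := bS a Sa; hnia.
Qed.

(** Loeb measurability at every scale c, restricted to internal sets D of finite measure at that
    scale. *)
Definition approx X := forall D c k, negl 1 (k *: c) D -> forall n,
  exists A B, [/\ intl A, intl B, A `<=` X `&` D, X `&` D `<=` B &
                  B `<=` D /\ negl n c (B `\` A)].

Lemma negl0 n c : negl n c (set0 : set H).
Proof. by exists (hcst W 0); [exact: hcard0 | hlia]. Qed.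

Lemma neglU2 n c A B : negl n.*2 c A -> negl n.*2 c B -> negl n c (A `|` B).
Proof.
move=> [a cA na] [b cB nb]; have [d dab cd] := hcardUle cA cB.
by exists d => //; move: na nb dab; rewrite -muln2; hnia.
Qed.

(** In the union step the inner set is a finite union of almost maximal size. What the outer pieces
    add to it stays small in every finite union, so saturation collects it in one small internal
    set. *)
Lemma Bor_approx X : Bor X -> approx X.
Proof.
move: X; apply: Bor_ind => [A iA|X aX|X aX] D c k leD n.
- have iD := negl_intl leD; exists (A `&` D), (A `&` D); split=> //; try exact: intlI.
  by split; [move=> x [] | rewrite setDv; exact: negl0].
- have iD := negl_intl leD; have [A [B [iA iB AX XB [BD nAB]]]] := aX D c k leD n.
  exists (D `\` B), (D `\` A); split; try exact: intlD.
  + by move=> x [Dx nBx]; split=> // Xx; apply: nBx; apply: XB.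
  + by move=> x [nXx Dx]; split=> // /AX[].
  + split; first by move=> x [].
    apply: (negl_sub nAB); first by apply: intlD; exact: intlD.
    move=> x [[Dx nAx] nDB]; split=> //; apply: contrapT => nBx.
    exact: nDB.
have iD := negl_intl leD.
(* The factor 2^(i+1) sums the errors geometrically; 2n leaves room for the second error, from the
   choice of m. *)
have /choice [AB HAB] : forall i, exists AB : set H * set H,
    [/\ intl AB.1, intl AB.2, AB.1 `<=` X i `&` D, X i `&` D `<=` AB.2 &
      AB.2 `<=` D /\ negl (2 ^ i.+1 * n.*2) c (AB.2 `\` AB.1)].
  by move=> i; have [A [B ?]] := aX i D c k leD (2 ^ i.+1 * n.*2); exists (A, B).
pose A i := (AB i).1; pose B i := (AB i).2.
have iA i : intl (A i) by case: (HAB i).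
have iB i : intl (B i) by case: (HAB i).
have AD m : finU A m `<=` D by move=> x [i _]; have [_ _ AX _ _] := HAB i; move=> /AX[].
have cA m : exists2 a, a <= k *: c & hcard (finU A m) a.
  have [d cD dk] := leD.
  have [a ad ca] := hcard_sub cD (intl_finU m iA) (AD m); exists a => //; hlia.
(* From m on, no finite union of inner pieces gains more than c / (2n). *)
have [||a [m cm] Hm] := @near_sup (fun a => exists m, hcard (finU A m) a) k c n.*2.
- by have [a _ ca] := cA 0; exists a, 0.
- by move=> a [m cm]; have [a' ak /(hcard_uniq cm) ->] := cA m.
have nm m' : negl n.*2 c (finU A m' `\` finU A m).
  have [a' _ ca'] := cA (maxn m m').
  have ce := hcardD cm ca' (@finU_le _ _ _ _ (leq_maxl m m')).
  have h := Hm _ (ex_intro (fun m => hcard (finU A m) a') _ ca').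
  apply: (@negl_sub _ _ _ _ _ (finU A (maxn m m') `\` finU A m)).
  - by exists (a' - a) => //; hnia.
  - by apply: intlD; exact: intl_finU.
  - by apply: setSD; apply: finU_le; exact: leq_maxr.
have nE m' : negl n c (finU (fun i => B i `\` finU A m) m').
  have nBA : negl n.*2 c (finU (fun i => B i `\` A i) m').
    by apply: negl_finU => i _; have [_ _ _ _ []] := HAB i.
  apply: negl_sub (neglU2 (nm m') nBA) _ _.
    by apply: intl_finU => i; apply: intlD => //; exact: intl_finU.
  move=> x [i im [Bx nAx]]; have [Ax|nAix] := EM (A i x).
    by left; split=> //; exists i.
  by right; exists i.
have [i|C nC BC] := sat_negl nE; first by apply: intlD => //; exact: intl_finU.
have iC := negl_intl nC.
exists (finU A m), ((C `&` D) `|` finU A m); split.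
- exact: intl_finU.
- by apply: intlU; [exact: intlI | exact: intl_finU].
- move=> x Ax; split; last exact: AD Ax.
  by case: Ax => i _ Aix; exists i => //; have [_ _ /(_ x Aix) []] := HAB i.
- move=> x [[i _ Xx] Dx]; have [Ax|nAx] := EM (finU A m x); first by right.
  left; split=> //; apply: (BC i); split=> //.
  by have [_ _ _ XB _] := HAB i; apply: XB.
- split; first by move=> x [[]|/AD].
  apply: (negl_sub nC).
    by apply: intlD; [apply: intlU; [exact: intlI|]|]; exact: intl_finU.
  by move=> x [[[]|]].
Qed.

(* At scale [c] a Borel set is Loeb null locally, on each [B i]; the covers of
   the pieces are then summed. *)
Lemma null_cover X c : Bor X ->
  (exists2 B : nat -> set H, forall i, exists k, negl 1 (k *: c) (B i) &
                             X `<=` \bigcup_i B i) ->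
  (forall n A, intl A -> A `<=` X -> negl n c A) ->
  forall n, exists2 C, negl n c C & X `<=` C.
Proof.
move=> BX [B fB XB] nX n.
have /choice [C HC] : forall i, exists C, negl (2 ^ i.+1 * n) c C /\ X `&` B i `<=` C.
  move=> i; have [k fBi] := fB i.
  (* The inner set A is small by hypothesis and C \ A by approximation; doubling pays for their
     union. *)
  have [A [C [iA iC AX XC [CB nCA]]]] := Bor_approx BX fBi (2 ^ i.+1 * n).*2.
  exists C; split=> //; apply: negl_sub (neglU2 (nX _ A iA _) nCA) iC _.
    by move=> x /AX[].
  by move=> x Cx; have [Ax|nAx] := EM (A x); [left | right].
have [m|i|D nD CD] := @sat_negl n c C; first by apply: negl_finU => i _; exact: (HC i).1.
  exact: negl_intl (HC i).1.
by exists D => // x Xx; have [i _ Bx] := XB x Xx; apply: (CD i); apply: (HC i).2.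
Qed.

Lemma inj_path (P : nat -> set H) g : (forall n, intl (P n)) ->
  (forall n, P n.+1 `<=` P n) ->
  (forall z z', (forall n, P n z) -> (forall n, P n z') ->
     hfun g z z = hfun g z' z' -> z = z') ->
  exists n, forall z z', P n z -> P n z' -> hfun g z z = hfun g z' z' -> z = z'.
Proof.
move=> iP dP gI; apply: contrapT => N.
have /choice [p Ep] := iP.
pose f := FAnd (FNot (FEq (tfst (TV 0)) (tsnd (TV 0))))
  (FAnd (FEq (TF (fun u _ => g (cfst u) (cfst u)) (TV 0) (TV 0))
             (TF (fun u _ => g (csnd u) (csnd u)) (TV 0) (TV 0)))
  (FAnd (FM (tfst (TV 0)) 0)
        (FM (tsnd (TV 0)) 0))).
have gE w : hfun (fun u _ => g (cfst u) (cfst u)) w w = hfun g w.1h w.1h by htransfer.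
have gE' w : hfun (fun u _ => g (csnd u) (csnd u)) w w = hfun g w.2h w.2h by htransfer.
have [n|n|w Hw] := @sat_sets _ _ (fun n =>
  [set x | hsat (upd (fun=> x) 0 x) (fun=> p n) f]).
- have [a Ha] := comprehension f (fun=> hcst W 0) (fun=> p n).
  by exists a; apply/predeqP => x; exact: Ha.
- apply: contrapT => N'; apply: N; exists n => z z' Pz Pz' E; apply: contrapT => zz'.
  apply: N'; exists (hpair z z') => k kn.
  rewrite /hsat /f /= /upd /= gE gE' !hfstE !hsndE.
  split=> //; split=> //.
  rewrite -[hmem z _]/(ext (p k) z) -[hmem z' _]/(ext (p k) z') Ep.
  by split; apply: (decr_le dP kn).
- have [+ [+ _]] := Hw 0; rewrite /= /upd /= gE gE' => nw E; apply: nw; apply: gI => // n.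
    by have [_ [_ [+ _]]] := Hw n; rewrite /= /upd /= -[hmem _ _]/(ext (p n) _) Ep.
  by have [_ [_ [_ +]]] := Hw n; rewrite /= /upd /= -[hmem _ _]/(ext (p n) _) Ep.
Qed.

Lemma intl_image g A : intl A -> intl [set x | exists2 z, A z & hfun g z z = x].
Proof.
move=> [a <-].
have [b Hb] := comprehension (FExN 1 (FAnd (FM (TV 1) 0)
    (FEq (TF g (TV 1) (TV 1)) (TV 0))))
  (fun=> hcst W 0) (fun=> a).
exists b; apply/predeqP => x; split=> [/Hb [z [? ?]]|[z ? ?]]; first by exists z.
by apply/Hb; exists z.
Qed.

(* The graph is covered by countably many internal injections, and each piece
   is Loeb measurable, so that a Borel injection preserves Loeb measure. *)
Lemma Bor_inj_card A a x n (G : set H) : hcard A a -> Bor G ->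
  (forall z, G z -> A z.1h /\ z.2h < x) ->
  (forall u, A u -> exists2 z, G z & z.1h = u) ->
  (forall z z', G z -> G z' -> z.1h = z'.1h -> z = z') ->
  (forall z z', G z -> G z' -> z.2h = z'.2h -> z = z') ->
  ~ n.+1 *: x < n *: a.
Proof.
move=> cA BG GA AG G1 G2.
have [P [iP dP EG]] := souslin_mono (Bor_souslin BG).
pose good s := (forall z z', P s z -> P s z' -> z.1h = z'.1h -> z = z').
have Ggood z : G z -> exists2 s, good s & P s z.
  rewrite EG => -[f Hf].
  have dPf n' : P (mkseq f n'.+1) `<=` P (mkseq f n') by rewrite mkseqS; exact: dP.
  have [w w' Hw Hw' E|m Hm] :=
    @inj_path (fun n => P (mkseq f n)) (fun u _ => cfst u) (fun n => iP _) dPf.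
    by apply: G1 => //; rewrite EG; exists f.
  by exists (mkseq f m).
(* The countably many nodes are enumerated by [unpickle]. Only those with injective first projection
   are kept; over A they have size at most a. All other indices get the empty set. *)
pose D i : set H := if unpickle i is Some s then
  if `[< good s >] then P s `&` [set z | A z.1h] else set0 else set0.
have iA1 : intl [set z | A z.1h].
  have [a' <-] := hcard_intl cA.
  exact: (intl_fm (FM (tfst (TV 0)) 0) (fun=> hcst W 0) (fun=> a')).
have leD i : negl 1 (1 *: a) (D i).
  rewrite /D; case: unpickle => [s|]; last exact: negl0.
  case: asboolP => [gs|_]; last exact: negl0.
  have [|||e ea ce] := @hcard_inj _ _ (fun u _ => cfst u)
    (P s `&` [set z | A z.1h]) A a cA.
  - exact: intlI.
  - by move=> z z' [Pz _] [Pz' _]; exact: gs.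
  - by move=> z [].
  - by exists e => //; hlia.
have /choice [LM HLM] : forall i, exists LM : set H * set H,
    [/\ intl LM.1, intl LM.2, LM.1 `<=` G `&` D i, G `&` D i `<=` LM.2 &
      LM.2 `<=` D i /\ negl (2 ^ i.+1 * n.+1) a (LM.2 `\` LM.1)].
  move=> i; have [L [M ?]] := Bor_approx BG (leD i) (2 ^ i.+1 * n.+1).
  by exists (L, M).
pose L i := (LM i).1; pose M i := (LM i).2.
have iL i : intl (L i) by case: (HLM i).
have iM i : intl (M i) by case: (HLM i).
have LG m : finU L m `<=` G by move=> z [i _]; have [_ _ LGi _ _] := HLM i; move=> /LGi[].
have [|||m Hm] := @sat_cover _ _ A (fun i => [set x | exists2 z, M i z & z.1h = x]).
- exact: hcard_intl cA.
- by move=> i; exact: intl_image.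
- move=> u /[dup] Au /AG[z Gz zu]; have [s gs Psz] := Ggood z Gz.
  exists (pickle s) => //; exists z => //.
  have [_ _ _ GM _] := HLM (pickle s); apply: GM; split=> //.
  by rewrite /D pickleK asboolT //; split=> //=; rewrite zu.
(* The inner pieces lie in G, so the second projection is injective on their whole union. *)
have [|||l lx cL] := @hcard_inj _ _ (fun u _ => csnd u)
  (finU L m) [set y | y < x] x (hcard_seg x).
- exact: intl_finU.
- by move=> z z' /LG Gz /LG Gz'; exact: G2.
- by move=> z /LG /GA[].
have [e ce ne] : negl n.+1 a (finU (fun i => M i `\` L i) m).
  by apply: negl_finU => i _; have [_ _ _ _ []] := HLM i.
have [d dle cd] := hcardUle cL ce.
(* The inner pieces and the errors together project onto A, whence a <= x + e with (n + 1) e <= a,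
   that is, n a <= (n + 1) x. *)
have [||a' a'd ca'] := @hcard_surj _ _ (fun u _ => cfst u) A _ d cd.
- exact: hcard_intl cA.
- move=> u /Hm[i im [z Mz zu]]; exists z => //.
  by have [Lz|nLz] := EM (L i z); [left | right]; exists i.
by have E := hcard_uniq cA ca'; subst a'; hnia.
Qed.
End BorelTheory.

(** * Piecewise internal injections *)

Section Piecewise.
Variables (V : superstructure) (W : nonstandard_universe V).
Local Notation H := (hnat W).
Local Notation IS := (iint W).
Local Open Scope hyper_scope.
Implicit Types (A B C D E F G X Y Z : set H) (a b c d e x y : H).

(* [F i] is the set of [cpair] codes of the graph of an internal map on [X i]. *)
Definition piecewise (R : H -> H -> Prop) := exists (X F : nat -> set H),
  [/\ forall i, Bor (X i), forall i, intl (F i) &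
      forall x y, R x y <-> exists i, X i x /\ F i (hpair x y)].

(** The countable family of internal pieces is closed under composition ([pinj_trans]), and
    [pinj_graph] still yields a Borel graph. *)
Definition pinj X Y := exists R, [/\ piecewise R,
  forall x, X x -> exists2 y, Y y & R x y,
  forall x y, R x y -> X x,
  forall x y y', R x y -> R x y' -> y = y' &
  forall x x' y, R x y -> R x' y -> x = x'].

Lemma pinj_pieces X Y (Xi Fi Ci : nat -> set H) :
  (forall i, Bor (Xi i)) -> (forall i, intl (Fi i)) ->
  (forall x, X x <-> exists i, Xi i x) ->
  (forall i, Ci i `<=` Y) ->
  (forall i x, Xi i x -> exists2 y, Ci i y & Fi i (hpair x y)) ->
  (forall i x y y', Xi i x -> Fi i (hpair x y) -> Fi i (hpair x y') -> y = y') ->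
  (forall i x x' y, Xi i x -> Xi i x' ->
     Fi i (hpair x y) -> Fi i (hpair x' y) -> x = x') ->
  (forall i j x, Xi i x -> Xi j x -> i = j) ->
  (forall i j y, Ci i y -> Ci j y -> i = j) ->
  pinj X Y.
Proof.
move=> BX iF XE CY tot fct inj dX dC.
have val i x y : Xi i x -> Fi i (hpair x y) -> Ci i y.
  by move=> Xx Fxy; have [y' Cy' /(fct _ _ _ _ Xx Fxy) ->] := tot i x Xx.
exists (fun x y => exists i, Xi i x /\ Fi i (hpair x y)); split.
- by exists Xi, Fi.
- move=> x /XE[i Xx]; have [y Cy Fy] := tot i x Xx.
  by exists y; [exact: CY Cy | exists i].
- by move=> x y [i [Xx _]]; apply/XE; exists i.
- move=> x y y' [i [Xx Fy]] [j [Xx' Fy']].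
  have ij := dX _ _ _ Xx Xx'.
  by move: Fy'; rewrite -ij; exact: fct Fy.
- move=> x x' y [i [Xx Fy]] [j [Xx' Fy']].
  have ij := dC _ _ _ (val _ _ _ Xx Fy) (val _ _ _ Xx' Fy').
  by move: Xx' Fy'; rewrite -ij => ? ?; exact: inj Fy _.
Qed.

Lemma pinj_subr X Y Y' : pinj X Y -> Y `<=` Y' -> pinj X Y'.
Proof.
move=> [R [pR tot dom fct inj]] YY; exists R; split=> // x /tot[y Yy Rxy].
by exists y => //; exact: YY.
Qed.

Lemma pinj_subl X X' Y : Bor X' -> X' `<=` X -> pinj X Y -> pinj X' Y.
Proof.
move=> BX' XX [R [[Xi [Fi [BX iF RE]]] tot dom fct inj]].
exists (fun x y => X' x /\ R x y); split.
- exists (fun i => Xi i `&` X'), Fi; split=> // [i|x y]; first exact: Bor_setI.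
  split=> [[X'x /RE[i [Xx Fx]]]|[i [[Xx X'x] Fx]]]; first by exists i.
  by split=> //; apply/RE; exists i.
- by move=> x X'x; have [y Yy Rxy] := tot x (XX x X'x); exists y.
- by move=> x y [].
- by move=> x y y' [_ +] [_]; exact: fct.
- by move=> x x' y [_ +] [_]; exact: inj.
Qed.

(** Since F is single-valued on X, preimages commute with complements inside the domain of F, which
    is internal. *)
Lemma Bor_preimage X F Y : Bor X -> intl F -> Bor Y ->
  (forall x y y', X x -> F (hpair x y) -> F (hpair x y') -> y = y') ->
  Bor [set x | X x /\ exists2 y, F (hpair x y) & Y y].
Proof.
move=> BX [f <-] BY fct.
have dom (a : IS) : intl [set x | exists2 y, ext f (hpair x y) & ext a y].
  have [b Hb] := comprehension (FExN 1 (FAnd (FMpair 0 1 0) (FM (TV 1) 1)))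
    (fun=> hcst W 0) (nth a [:: f; a]).
  by exists b; apply/predeqP => x; split=> [/Hb[y [? ?]]|[y ? ?]];
      [exists y | apply/Hb; exists y].
pose Q A := [set x | X x /\ exists2 y, ext f (hpair x y) & A y].
suff : Bor (Q Y) by [].
move: Y BY; apply: Bor_ind => [_ [a <-]|A BA|A BA].
- have -> : Q (ext a) = X `&` [set x | exists2 y, ext f (hpair x y) & ext a y].
    by apply/predeqP => x; split=> -[].
  by apply: Bor_setI => //; exact: Bor_intl (dom a).
- have [t Et] := intlT W.
  have -> : Q (~` A) = (X `&` [set x | exists2 y, ext f (hpair x y) & ext t y]) `\`
     Q A.
    apply/predeqP => x; split=> [[Xx [y fy nAy]]|[[Xx [y fy _]] nA]].
      split; first by split=> //; exists y => //; rewrite Et.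
      by move=> [_ [y' fy' Ay']]; apply: nAy; rewrite (fct x y y').
    by split=> //; exists y => // Ay; apply: nA; split=> //; exists y.
  by apply: Bor_setD => //; apply: Bor_setI => //; exact: Bor_intl (dom t).
- have -> : Q (\bigcup_i A i) = \bigcup_i Q (A i); last exact: Bor_bigcup.
  apply/predeqP => x; split=> [[Xx [y fy [i _ Ay]]]|[i _ [Xx [y fy Ay]]]].
    by exists i => //; split=> //; exists y.
  by split=> //; exists y => //; exists i.
Qed.

Lemma pinj_trans X Y Z : pinj X Y -> pinj Y Z -> pinj X Z.
Proof.
move=> [R [[Xi [Fi [BX iF RE]]] tot dom fct inj]].
move=> [S [[Yi [Gi [BY iG SE]]] tot' dom' fct' inj']].
exists (fun x z => exists2 y, R x y & S y z); split.
(* Piece k composes piece [cfst k] of R with piece [csnd k] of S. *)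
- exists (fun k => [set x | Xi (cfst k) x /\
     exists2 y, Fi (cfst k) (hpair x y) & Yi (csnd k) y]),
   (fun k => [set w | exists2 y, Fi (cfst k) (hpair w.1h y) &
       Gi (csnd k) (hpair y w.2h)]).
  split=> [k|k|x z].
  + apply: Bor_preimage => // x y y' Xx Fy Fy'.
    by apply: (fct x); apply/RE; exists (cfst k).
  + have [f <-] := iF (cfst k); have [g <-] := iG (csnd k).
    have [b Hb] := comprehension (FExN 1 (FAnd
        (FM (TF cpair (tfst (TV 0)) (TV 1)) 0)
        (FM (TF cpair (TV 1) (tsnd (TV 0))) 1)))
      (fun=> hcst W 0) (nth g [:: f; g]).
    by exists b; apply/predeqP => x; split=> [/Hb[y [? ?]]|[y ? ?]];
      [exists y | apply/Hb; exists y].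
  + split=> [[y /RE[i [Xx Fxy]] /SE[j [Yy Gyz]]]|[k [[Xx [y Fxy Yy]] [y']]]].
      exists (cpair i j); rewrite cfstE csndE; split; first by split=> //; exists y.
      by exists y; rewrite ?hfstE ?hsndE.
    rewrite hfstE hsndE => Fxy' Gyz.
    have Rxy : R x y by apply/RE; exists (cfst k).
    have Rxy' : R x y' by apply/RE; exists (cfst k).
    exists y => //; apply/SE; exists (csnd k); split=> //.
    by rewrite (fct _ _ _ Rxy Rxy').
- move=> x /tot[y Yy Rxy]; have [z Zz Syz] := tot' y Yy.
  by exists z => //; exists y.
- by move=> x z [y /dom].
- move=> x z z' [y Rxy Syz] [y' Rxy' Sy'z'].
  by move: Sy'z'; rewrite -(fct _ _ _ Rxy Rxy'); exact: fct'.
- move=> x x' z [y Rxy Syz] [y' Rxy' Sy'z].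
  by move: Rxy'; rewrite -(inj' _ _ _ Syz Sy'z); exact: inj.
Qed.

Lemma pinj_sub X Y : Bor X -> X `<=` Y -> pinj X Y.
Proof.
move=> BX XY.
exists (fun x y => X x /\ x = y); split.
- exists (fun=> X), (fun=> [set w | w.1h = w.2h]); split=> // [_|x y].
    by have [b Hb] := comprehension (FEq (tfst (TV 0))
      (tsnd (TV 0))) (fun=> hcst W 0) (fun=> iint0 W);
    exists b; apply/predeqP => x; exact: Hb.
  rewrite /= hfstE hsndE; split=> [h|[_ h]] //; by exists 0.
- by move=> x Xx; exists x => //; exact: XY.
- by move=> x y [].
- by move=> x y y' [_ <-] [_ <-].
- by move=> x x' y [_ ->] [_ ->].
Qed.

Lemma pinj_graph X Y : pinj X Y -> exists G, [/\ Bor G,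
  forall z, G z -> X z.1h /\ Y z.2h,
  forall x, X x -> exists2 z, G z & z.1h = x,
  forall z z', G z -> G z' -> z.1h = z'.1h -> z = z' &
  forall z z', G z -> G z' -> z.2h = z'.2h -> z = z'].
Proof.
move=> [R [[Xi [Fi [BX iF RE]]] tot dom fct inj]].
exists [set z | R z.1h z.2h]; split.
- have -> : [set z | R z.1h z.2h] = \bigcup_i ([set z | Xi i z.1h] `&` Fi i).
    apply/predeqP => z; split=> [/RE[i []]|[i _ [Xz Fz]]].
      by rewrite hpairK; exists i.
    by apply/RE; exists i; rewrite hpairK.
  apply: Bor_bigcup => i; apply: Bor_setI; last exact: Bor_intl.
    (* g is the graph of the first projection, so the cylinder over [Xi i] is a preimage under an
       internal map. *)
    have [g Hg] := comprehension (FEq (TF (fun u _ => cfst (cfst u)) (TV 0) (TV 0))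
      (tsnd (TV 0))) (fun=> hcst W 0) (fun=> iint0 W).
    have gE z x : ext g (hpair z x) <-> x = z.1h.
      rewrite [ext g _]Hg /= /upd /=.
      have -> : hfun (fun u _ => cfst (cfst u)) (hpair z x) (hpair z x) =
          (hpair z x).1h.1h.
        by htransfer.
      by rewrite hfstE hsndE; split.
    have -> : [set z | Xi i z.1h] =
        [set z | setT z /\ exists2 x, ext g (hpair z x) & Xi i x].
      apply/predeqP => z; split=> [Xz|[_ [x /gE -> //]]].
      by split=> //; exists z.1h => //; apply/gE.
    apply: (@Bor_preimage setT) => //; [exact: Bor_intl (intlT W) | by exists g |].
    by move=> x y y' _ /gE -> /gE ->.
- move=> z Rz; split; first exact: dom Rz.
  by have [y Yy /(fct _ _ _ Rz) ->] := tot _ (dom _ _ Rz).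
- move=> x /tot[y _ Rxy]; exists (hpair x y); last by rewrite hfstE.
  by rewrite /= hfstE hsndE.
- move=> z z' Rz Rz' E; rewrite -(hpairK z) -(hpairK z') E; congr hfun.
  by apply: (fct z.1h) => //; rewrite E.
- move=> z z' Rz Rz' E; rewrite -(hpairK z) -(hpairK z') E; congr hfun.
  by apply: (inj _ _ z.2h) => //; rewrite E.
Qed.

Lemma hbij_sub F A B x y : hbij F A B -> A x -> F (hpair x y) -> B y.
Proof.
by move=> [tot [fct _]] Ax Fxy; have [y' [By' /(fct _ _ _ Ax Fxy) ->]] := tot x Ax.
Qed.

Lemma hbij_agree F F' A B : (forall x y, A x -> F (hpair x y) <-> F' (hpair x y)) ->
  hbij F A B -> hbij F' A B.
Proof.
move=> E [tot [fct [inj sur]]]; split; last split; last split.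
- by move=> x Ax; have [y [By /(E _ _ Ax) Fy]] := tot x Ax; exists y.
- by move=> x y y' Ax /(E _ _ Ax) h /(E _ _ Ax) h'; exact: (fct x).
- by move=> x x' y Ax Ax' /(E _ _ Ax) h /(E _ _ Ax') h'; exact: (inj x x' y).
- by move=> y By; have [x [Ax /(E _ _ Ax) Fx]] := sur y By; exists x.
Qed.

Lemma hbij_union F A B A' B' : hbij F A B -> hbij F A' B' ->
  (forall y, B y -> ~ B' y) -> hbij F (A `|` A') (B `|` B').
Proof.
move=> h h' D; have [tot [fct [inj sur]]] := h; have [tot' [fct' [inj' sur']]] := h'.
split; last split; last split.
- move=> x [/tot|/tot'] [y [By Fy]]; exists y; split=> //; by [left | right].
- by move=> x y y' [Ax|Ax]; [exact: fct | exact: fct'].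
- move=> x x' y [Ax|Ax] [Ax'|Ax'] Fx Fx'; [exact: inj Fx Fx' | | | exact: inj' Fx Fx'].
    by case: (D y); [exact: (hbij_sub h Ax Fx) | exact: (hbij_sub h' Ax' Fx')].
  by case: (D y); [exact: (hbij_sub h Ax' Fx') | exact: (hbij_sub h' Ax Fx)].
- move=> y [/sur|/sur'] [x [Ax Fx]]; exists x; split=> //; by [left | right].
Qed.

(** * Matching increasing and decreasing sequences of internal sets *)

Definition dif (B : nat -> set H) n := if n is m.+1 then B n `\` B m else B 0.

Lemma incr_le (B : nat -> set H) : (forall n, B n `<=` B n.+1) ->
  forall m n, (m <= n)%N -> B m `<=` B n.
Proof.
move=> dB m n; elim: n => [|n IH]; first by rewrite leqn0 => /eqP->.
by rewrite leq_eqVlt => /orP[/eqP->//|/IH h] x /h /dB.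
Qed.

Lemma dif_disj (B : nat -> set H) : (forall n, B n `<=` B n.+1) ->
  forall i j x, dif B i x -> dif B j x -> i = j.
Proof.
move=> iB; have L i j x : (i < j)%N -> dif B i x -> ~ dif B j x.
  case: j => // j; rewrite ltnS => ij di [_]; apply; apply: (incr_le iB ij).
  by case: i di {ij} => // i [].
move=> i j x di dj; have [ij|ij|//] := ltngtP i j.
  by case: (L _ _ _ ij di).
by case: (L _ _ _ ij dj).
Qed.

Lemma dif_ex (B : nat -> set H) n x : B n x -> exists2 i, (i <= n)%N & dif B i x.
Proof.
elim: n => [|n IH] Bx; first by exists 0.
have [/IH[i il]|nB] := EM (B n x); first by exists i => //; lia.
by exists n.+1.
Qed.

Lemma dif_sub (B : nat -> set H) n : dif B n `<=` B n.
Proof. by case: n => // n x []. Qed.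

Lemma hcard_dif (B : nat -> set H) (b : nat -> H) n : (forall n, B n `<=` B n.+1) ->
  (forall n, hcard (B n) (b n)) ->
  hcard (dif B n) (if n is m.+1 then b n - b m else b 0).
Proof.
move=> iB cB; case: n => [|n] /=; first exact: cB.
exact: hcardD.
Qed.

(** Corresponding successive differences of B and C have equal sizes, so each difference gets its
    own internal bijection. *)
Lemma pinj_incr (B C : nat -> set H) (b : nat -> H) X : (forall n, B n `<=` B n.+1) ->
  (forall n, C n `<=` C n.+1) -> (forall n, hcard (B n) (b n)) ->
  (forall n, hcard (C n) (b n)) -> Bor X -> X `<=` \bigcup_n B n ->
  pinj X (\bigcup_n C n).
Proof.
move=> iB iC cB cC BX XB.
have /choice [F HF] : forall n, exists F, intl F /\ hbij F (dif B n) (dif C n).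
  move=> n; have [F ? ?] := hcard_bij (hcard_dif n iB cB) (hcard_dif n iC cC).
  by exists F.
have iF n := (HF n).1; have bF n := (HF n).2.
apply: (@pinj_pieces _ _ (fun n => X `&` dif B n) F (dif C)) => //.
- move=> i; apply: Bor_setI => //; apply: Bor_intl.
  exact: hcard_intl (hcard_dif i iB cB).
- move=> x; split=> [Xx|[i []//]]; have [n _ Bx] := XB x Xx.
  by have [i _ dx] := dif_ex Bx; exists i.
- by move=> i y /dif_sub Cy; exists i.
- by move=> i x [_ dx]; have [y [Cy Fy]] := (bF i).1 x dx; exists y.
- by move=> i x y y' [_ dx]; exact: (bF i).2.1.
- by move=> i x x' y [_ dx] [_ dx']; exact: (bF i).2.2.1.
- by move=> i j x [_ dx] [_ dx']; exact: dif_disj dx dx'.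
- exact: dif_disj.
Qed.

(** F is built from the innermost level outwards: a bijection between the differences of two
    consecutive levels extends it by one level and leaves the inner ones unchanged. *)
Lemma hbij_chain (B C : nat -> set H) (b : nat -> H) n : (forall n, B n.+1 `<=` B n) ->
  (forall n, C n.+1 `<=` C n) -> (forall n, hcard (B n) (b n)) ->
  (forall n, hcard (C n) (b n)) ->
  exists2 F, intl F & forall k, (k <= n)%N -> hbij F (B k) (C k).
Proof.
move=> dB dC cB cC.
suff /(_ n (leqnn n)) [F iF HF] : forall j, (j <= n)%N -> exists2 F, intl F &
    forall k, (n - j <= k <= n)%N -> hbij F (B k) (C k).
  by exists F => // k kn; apply: HF; lia.
elim=> [|j IH] jn.
  have [F iF HF] := hcard_bij (cB n) (cC n); exists F => // k.
  by rewrite subn0 -eqn_leq => /eqP <-.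
have [|F iF HF] := IH; first by lia.
set k0 := (n - j.+1)%N.
have [G iG HG] := hcard_bij (hcardD (cB k0.+1) (cB k0) (dB k0))
  (hcardD (cC k0.+1) (cC k0) (dC k0)).
have iB1 := hcard_intl (cB k0.+1).
pose F' := [set w | (B k0.+1 w.1h /\ F w) \/ (~ B k0.+1 w.1h /\ G w)].
have FE x y : B k0.+1 x -> F (hpair x y) <-> F' (hpair x y).
  move=> Bx; rewrite /F' /= hfstE; split=> [|[[]|[]]] //; by left.
exists F'.
  rewrite /F'; have [f <-] := iF; have [g <-] := iG; have [b1 <-] := iB1.
  exact: (intl_fm (FOr (FAnd (FM (tfst (TV 0)) 0) (FM (TV 0) 1))
    (FAnd (FNot (FM (tfst (TV 0)) 0)) (FM (TV 0) 2)))
    (fun=> hcst W 0) (nth g [:: b1; f; g])).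
move=> k /andP[k1 k2]; have [kk|kk] := leqP k0.+1 k.
  apply: (@hbij_agree F); last by apply: HF; lia.
  by move=> x y /(decr_le dB kk); exact: FE.
have -> : k = k0 by lia.
rewrite -(setDUK (@dB k0)) -(setDUK (@dC k0)); apply: hbij_union; last by move=> y ? [].
  apply: (@hbij_agree F); last by apply: HF; lia.
  by move=> x y; exact: FE.
apply: (@hbij_agree G) HG => x y [_ nB].
by rewrite /F' /= hfstE; split=> [|[[]|[]]] //; right.
Qed.

(** Saturation turns the finite chains of [hbij_chain] into one internal F that is a bijection at
    every level, and so maps intersection into intersection. *)
Lemma pinj_decr (B C : nat -> set H) (b : nat -> H) X : (forall n, B n.+1 `<=` B n) ->
  (forall n, C n.+1 `<=` C n) -> (forall n, hcard (B n) (b n)) ->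
  (forall n, hcard (C n) (b n)) -> Bor X -> X `<=` \bigcap_n B n ->
  pinj X (\bigcap_n C n).
Proof.
move=> dB dC cB cC BX XB.
have [F iF HF] : exists2 F, intl F & forall n, hbij F (B n) (C n).
  have /choice [b' Eb] : forall n, exists a : IS, ext a = B n.
    by move=> n; exact: hcard_intl (cB n).
  have /choice [c' Ec] : forall n, exists a : IS, ext a = C n.
    by move=> n; exact: hcard_intl (cC n).
  have [|f Hf] := @set_saturation _ W (fun=> fbij) (fun _ _ => b 0)
    (fun n => nth (b' n) [:: b' n; b' n; c' n]).
    move=> n; have [F [f <-] HF] := hbij_chain n dB dC cB cC; exists f => k kn.
    by have := HF k kn; rewrite -Eb -Ec.
  by exists (ext f); [exists f | move=> n; rewrite -Eb -Ec; exact: (Hf n)].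
have X0 x : X x -> B 0 x by move=> /XB; exact.
exists (fun x y => X x /\ F (hpair x y)); split.
- exists (fun=> X), (fun=> F); split=> // x y; split=> [?|[_ //]].
  by exists 0.
- move=> x Xx; have [y [Cy Fy]] := (HF 0).1 x (X0 x Xx); exists y => //.
  by move=> n _; apply: (hbij_sub (HF n) _ Fy); exact: XB.
- by move=> x y [].
- by move=> x y y' [Xx Fy] [_ Fy']; exact: (HF 0).2.1 (X0 x Xx) Fy Fy'.
- by move=> x x' y [Xx Fy] [Xx' Fy']; exact: (HF 0).2.2.1 (X0 x Xx) (X0 x' Xx') Fy Fy'.
Qed.

(* Hilbert's hotel: [Z] moves into [J 0], and its copy in [J j] into [J j.+1]. *)
Lemma pinj_hotel Y Z (g T J : nat -> set H) : Bor Y -> Bor Z ->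
  (forall x, Y x -> ~ Z x) -> (forall j, intl (g j)) -> (forall j, intl (T j)) ->
  (forall j, hbij (g j) (T j) (J j)) -> (forall j, Z `<=` T j) ->
  (forall j, J j `<=` Y) -> (forall i j y, J i y -> J j y -> i = j) ->
  pinj (Y `|` Z) Y.
Proof.
move=> BY BZ DYZ ig iT gB ZT JY DJ.
pose Zj j := [set y | exists2 z, g j (hpair z y) & Z z].
(* Back along [g j] and forward along [g j.+1]: the shift from one copy of Z to the next. *)
pose h j := [set w | exists z, (T j z /\ T j.+1 z) /\
    (g j (hpair z w.1h) /\ g j.+1 (hpair z w.2h))].
pose rest := Y `\` \bigcup_j Zj j.
have ZJ j : Zj j `<=` J j.
  by move=> y [z gz Zz]; apply: (hbij_sub (gB j) _ gz); exact: ZT.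
have BZj j : Bor (Zj j).
  have [t Et] := iT j; have [g' Eg] := ig j.
  (* [g1] is the inverse of [g j] on [T j]; it presents the image [Zj j] as a preimage. *)
  have [g1 Hg1] := comprehension (FAnd (FM (tsnd (TV 0)) 0)
    (FM (TF cpair (tsnd (TV 0)) (tfst (TV 0))) 1))
    (fun=> hcst W 0) (nth t [:: t; g']).
  have g1E y z : ext g1 (hpair y z) <-> T j z /\ g j (hpair z y).
    by rewrite [ext g1 _]Hg1 /= /upd /= hfstE hsndE -Et -Eg.
  have -> : Zj j = [set y | setT y /\ exists2 z, ext g1 (hpair y z) & Z z].
    apply/predeqP => y; split=> [[z gz Zz]|[_ [z /g1E[Tz gz] Zz]]]; last by exists z.
    by split=> //; exists z => //; apply/g1E; split=> //; exact: ZT.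
  apply: Bor_preimage => //; [exact: Bor_intl (intlT W) | by exists g1 |].
  by move=> y z z' _ /g1E[Tz gz] /g1E[Tz' gz']; exact: (gB j).2.2.1 Tz Tz' gz gz'.
have ih j : intl (h j).
  rewrite /h; have [t <-] := iT j; have [t' <-] := iT j.+1.
  have [u <-] := ig j; have [u' <-] := ig j.+1.
  exact: (intl_fm (FExN 1 (FAnd (FAnd (FM (TV 1) 0) (FM (TV 1) 1))
    (FAnd (FM (TF cpair (TV 1) (tfst (TV 0))) 2)
          (FM (TF cpair (TV 1) (tsnd (TV 0))) 3))))
    (fun=> hcst W 0) (nth u' [:: t; t'; u; u'])).
have hE j x y z : Z z -> g j (hpair z x) -> h j (hpair x y) <-> g j.+1 (hpair z y).
  move=> Zz gz; rewrite /h /= hfstE hsndE; split=> [[z' [[Tz' _] [gz' gy]]]|gy].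
    by rewrite ((gB j).2.2.1 z z' x _ _ gz gz') //; exact: ZT.
  by exists z; split=> //; split; exact: ZT.
have idf : intl [set w : H | w.1h = w.2h].
  have [a Ha] := comprehension (FEq (tfst (TV 0))
      (tsnd (TV 0))) (fun=> hcst W 0) (fun=> iint0 W).
  by exists a; apply/predeqP => x; exact: Ha.
have rJ i x : Zj i x -> rest x -> False by move=> Zx [_]; apply; exists i.
(* Piece 0 brings Z in, piece 1 fixes the points outside all copies, and piece j + 2 shifts copy j
   to copy j + 1. *)
apply: (@pinj_pieces _ _
  (fun i => match i with 0 => Z | 1 => rest | j.+2 => Zj j end)
  (fun i => match i with 0 => g 0 | 1 => [set w | w.1h = w.2h] | j.+2 => h j end)
  (fun i => match i with 0 => Zj 0 | 1 => rest | j.+2 => Zj j.+1 end)).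
- case=> [|[|j]] //; apply: Bor_setD => //; exact: Bor_bigcup.
- by case=> [|[|j]].
- move=> x; split=> [[Yx|Zx]|[[|[|j]]]]; last 1 first.
  + by move=> /ZJ/JY; left.
  + have [[j _ Zx]|nZ] := EM ((\bigcup_j Zj j) x); first by exists j.+2.
    by exists 1.
  + by exists 0.
  + by right.
  + by move=> []; left.
- case=> [|[|j]] y; [by move=> /ZJ/JY | by move=> [] | by move=> /ZJ/JY].
- case=> [|[|j]] x.
  + move=> Zx; have [y [_ gy]] := (gB 0).1 x (ZT 0 x Zx).
    by exists y => //; exists x.
  + by move=> rx; exists x => //; rewrite /= hfstE hsndE.
  + move=> [z gz Zz]; have [y [_ gy]] := (gB j.+1).1 z (ZT j.+1 z Zz).
    by exists y; [exists z | apply/(hE _ _ _ _ Zz gz)].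
- case=> [|[|j]] x y y'.
  + by move=> Zx; exact: (gB 0).2.1 (ZT 0 x Zx).
  + by move=> _; rewrite /= !hfstE !hsndE => <- <-.
  + move=> [z gz Zz] /(hE _ _ _ _ Zz gz) gy /(hE _ _ _ _ Zz gz) gy'.
    exact: (gB j.+1).2.1 (ZT _ z Zz) gy gy'.
- case=> [|[|j]] x x' y.
  + by move=> Zx Zx'; exact: (gB 0).2.2.1 (ZT 0 x Zx) (ZT 0 x' Zx').
  + by move=> _ _; rewrite /= !hfstE !hsndE => -> ->.
  + move=> [z gz Zz] [z' gz' Zz'] /(hE _ _ _ _ Zz gz) gy /(hE _ _ _ _ Zz' gz') gy'.
    have E := (gB j.+1).2.2.1 z z' y (ZT _ z Zz) (ZT _ z' Zz') gy gy'.
    by move: gz'; rewrite -E; exact: (gB j).2.1 (ZT _ z Zz) gz.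
- case=> [|[|i]] [|[|j]] x //.
  + by move=> Zx [/DYZ].
  + by move=> Zx /ZJ/JY/DYZ.
  + by move=> [/DYZ].
  + by move=> rx /rJ/(_ rx).
  + by move=> /ZJ/JY/DYZ.
  + by move=> /rJ h' /h'.
  + by move=> /ZJ Ji /ZJ Jj; rewrite (DJ _ _ _ Ji Jj).
- case=> [|[|i]] [|[|j]] y //.
  + by move=> /rJ h' /h'.
  + by move=> /ZJ Ji /ZJ Jj; have := DJ _ _ _ Ji Jj.
  + by move=> ry /rJ/(_ ry).
  + by move=> ry /rJ/(_ ry).
  + by move=> /ZJ Ji /ZJ Jj; have := DJ _ _ _ Ji Jj.
  + by move=> /rJ h' /h'.
  + by move=> /ZJ Ji /ZJ Jj; have [->] := DJ _ _ _ Ji Jj.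
Qed.
End Piecewise.

(** * The cut of a Borel set *)

Lemma dependent_sequence T (P : nat -> T -> Prop) (Q : nat -> T -> T -> Prop) t0 :
  P 0 t0 -> (forall n t, P n t -> exists2 t', P n.+1 t' & Q n t t') ->
  exists s : nat -> T, forall n, P n (s n) /\ Q n (s n) (s n.+1).
Proof.
move=> P0 step.
have /choice [h Hh] : forall p : nat * T, exists t',
    P p.1 p.2 -> P p.1.+1 t' /\ Q p.1 p.2 t'.
  move=> [n t]; have [/step[t' ? ?]|nP] := EM (P n t); first by exists t'.
  by exists t.
pose fix s n := if n is m.+1 then h (m, s m) else t0.
have Ps n : P n (s n) by elim: n => //= n /(Hh (n, s n)) [].
by exists s => n; split=> //; have [] := Hh (n, s n) (Ps n).
Qed.

(* The least s with n a <= (n + 1) s. *)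
Definition shrink n a (_ : nat) : nat := (n * a + n) %/ n.+1.

Lemma shrinkP n a b x : (x < shrink n a b)%N = (n.+1 * x < n * a)%N.
Proof. by rewrite /shrink leq_divRL // mulSn mulnC; apply/idP/idP; lia. Qed.

(** The deficit c / (4m) of b is at most b / (2m), so x < b (2m + 1) / (2m + 2), and this factor is
    at most 4m / (4m + 1) when m >= 1. *)
Lemma shrink_cofinal m x a b c : (m.+1 * x < m * a -> m * 4 * a <= m * 4 * b + c ->
  c <= 2 * b -> (m * 4).+1 * x < m * 4 * b)%N.
Proof.
move=> h1 h2 h3; rewrite ltnNge; apply/negP => h4.
have m0 : (0 < m)%N by case: m h1 {h2 h4}.
have h5 : (16 * m * (m.+1 * x).+1 <= 16 * m * (m * a))%N by apply: leq_mul.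
have h6 : (4 * m * (m * 4 * a) <= 4 * m * (m * 4 * b + 2 * b))%N.
  by apply: leq_mul => //; lia.
have h7 : ((4 * m + 2) * (m * 4 * b) <= (4 * m + 2) * ((m * 4).+1 * x))%N.
  exact: leq_mul.
nia.
Qed.

Lemma leq_div_pow2 j t s : (t <= s %/ 2 ^ j)%N = (2 ^ j * t <= s)%N.
Proof. by rewrite leq_divRL ?expn_gt0 // mulnC. Qed.

Section Cases.
Variables (V : superstructure) (W : nonstandard_universe V).
Local Notation H := (hnat W).
Local Open Scope hyper_scope.
Implicit Types (A B C D E F G X Y Z : set H) (a b c d e x y z : H).

Lemma hcard_exact A a m : hcard A a -> m <= a -> exists2 B, B `<=` A & hcard B m.
Proof.
move=> cA ma; have [//|[m' mm' cA']] := hcard_total m (hcard_intl cA).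
by have E := hcard_uniq cA cA'; subst m'; exfalso; hlia.
Qed.

Lemma ge_le X x y : ge X x -> y <= x -> ge X y.
Proof.
move=> [B BX cB] yx; have [C CB cC] := hcard_exact cB yx.
by exists C => //; exact: subset_trans CB BX.
Qed.

Lemma hcard_between S A s a m : hcard S s -> hcard A a -> S `<=` A ->
  s <= m -> m <= a -> exists2 B, hcard B m & S `<=` B /\ B `<=` A.
Proof.
move=> cS cA SA sm ma.
have [|D DA cD] := @hcard_exact _ _ (m - s) (hcardD cS cA SA); first by hlia.
exists (S `|` D).
  have -> : m = s + (m - s) by hlia.
  by apply: hcardU => // x Sx /DA[].
by split=> x; [left | case=> [/SA|/DA[]]].
Qed.

Lemma seg_incr (b : nat -> H) : (forall n, b n <= b n.+1) ->
  forall n, [set x | x < b n] `<=` [set x | x < b n.+1].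
Proof. by move=> bb n x /=; have := bb n; hlia. Qed.

Lemma finU_incr (B : nat -> set H) n : finU B n `<=` finU B n.+1.
Proof. exact: finU_le. Qed.

(* The sizes of the hyperfinite internal subsets of [X], up to an
   infinitesimal relative error. *)
Definition core X : set H :=
  [set x | exists n A a, [/\ A `<=` X, hcard A a & n.+1 *: x < n *: a]].

Lemma core_cut X x y : core X y -> x < y -> core X x.
Proof. by move=> [n [A [a [AX cA h]]]] xy; exists n, A, a; split=> //; hnia. Qed.

(** The supremum of the sizes is approached up to c / N for every standard N. The resulting
    increasing internal subsets of X match the segments that exhaust the core; the rest of X is null
    at scale c and is absorbed in one of them. *)
Lemma core_bounded X c : Bor X -> hcst W 1 <= c -> ge X c ->
  (forall A, intl A -> A `<=` X -> negl 1 (2 *: c) A) ->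
  [/\ Bor (core X), pinj X (core X) & pinj (core X) X].
Proof.
move=> BX c1 gc bX.
(* Otherwise some internal subset of X would exceed all multiples of c, against the bound 2c. *)
have sigma : exists2 B : nat -> set H, forall i, exists k, negl 1 (k *: c) (B i) &
                                X `<=` \bigcup_i B i.
  have [k|//|[x cx [B BX' cB]]] := @covered_or_ge _ _ X (fun k => k *: c) BX.
    by exists k.+1; hnia.
  have [e ce he] := bX B (hcard_intl cB) BX'.
  have E := hcard_uniq cB ce; subst e.
  by have h := cx 3; hlia.
pose S a := exists2 A, A `<=` X & hcard A a.
have Sc : S c by [].
have S2 a : S a -> a <= 2 *: c.
  move=> [A AX cA]; have [e ce he] := bX A (hcard_intl cA) AX.
  by rewrite (hcard_uniq cA ce); hlia.
have /choice [A0 HA0] : forall N, exists A, [/\ A `<=` X, intl A & exists2 a, hcard A a &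
    forall a', S a' -> N *: a' <= N *: a + c].
  move=> N; have [|a [A AX cA] Ha] := @near_sup _ _ S 2 c N _ S2; first by exists c.
  by exists A; split=> //; [exact: hcard_intl cA | exists a].
pose A n := finU A0 n.+1.
have AX n : A n `<=` X by move=> x [k _]; have [+ _ _] := HA0 k; apply.
have iA n : intl (A n) by apply: intl_finU => k; case: (HA0 k).
have /choice [a Ha] : forall n, exists a, hcard (A n) a.
  by move=> n; have [e ce _] := bX _ (iA n) (AX n); exists e.
have Aa n : A n `<=` A n.+1 by exact: finU_incr.
have aa n : a n <= a n.+1.
  by have [e ea /(hcard_uniq (Ha n)) ->] := hcard_sub (Ha n.+1) (iA n) (@Aa n).
have Sa n : S (a n) by exists (A n).
have near n a' : S a' -> n *: a' <= n *: a n + c.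
  move=> Sa'; have [_ i0 [a0 c0 /(_ _ Sa') h]] := HA0 n.
  have [|e ea ce] := hcard_sub (Ha n) i0; first by move=> x ?; exists n.
  have E := hcard_uniq c0 ce; subst e; hnia.
(* By [sP], the segment below [s n] is the part of the core witnessed by [A n] with the factor n. *)
pose s n := hfun (shrink n) (a n) (a n).
have sP n x : x < s n <-> n.+1 *: x < n *: a n.
  split; rewrite /s; htransfer; by rewrite shrinkP.
have ss n : s n <= s n.+1.
  suff : ~ s n.+1 < s n by hlia.
  move=> /sP h; have : s n.+1 < s n.+1; last by hlia.
  by apply/sP; have := aa n; hnia.
have sa n : s n <= a n.
  suff : ~ a n < s n by hlia.
  by move=> /sP; hnia.
have s0 : s 0 = hcst W 0.
  suff : ~ hcst W 0 < s 0 by hlia.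
  by move=> /sP; hlia.
have s1 n : n *: a n <= n.+1 *: s n.
  suff : ~ n.+1 *: s n < n *: a n by hlia.
  by move=> /sP; hlia.
(* The sets [A n] may be too large for the core; nested subsets of size exactly [s n] fit it. *)
have [Y HY] : exists Y : nat -> set H, forall n,
    (hcard (Y n) (s n) /\ Y n `<=` A n) /\ Y n `<=` Y n.+1.
  apply: (@dependent_sequence _ (fun n Y => hcard Y (s n) /\ Y `<=` A n)
    (fun _ Y Y' => Y `<=` Y') set0).
    by split; [rewrite s0; exact: hcard0 | exact: sub0set].
  move=> n Yn [cY YA].
  have [|B cB [YB BA]] := hcard_between cY (Ha n.+1) _ (ss n) (sa n.+1).
    exact: subset_trans YA (@Aa n).
  by exists B.
have cY n : hcard (Y n) (s n) by case: (HY n) => [[]].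
have YA n : Y n `<=` A n by case: (HY n) => [[]].
have YY n : Y n `<=` Y n.+1 by case: (HY n).
have coreE : core X = \bigcup_n [set x | x < s n].
  apply/predeqP => x; split=> [[m [A' [a' [A'X cA' h]]]]|[n _ /sP h]]; last first.
    by exists n, (A n), (a n).
  have h2 := near (m * 4) a' (ex_intro2 _ _ A' A'X cA').
  have h3 := near (m * 4) c Sc.
  exists (m * 4) => //; apply/sP.
  have h4 : c <= 2 *: a (m * 4).
    case: m h h2 h3 => [|m]; first by hlia.
    by move=> _ _; hnia.
  by htransfer=> *; apply: shrink_cofinal; eassumption.
have Bcore : Bor (core X).
  by rewrite coreE; apply: Bor_bigcup => n; apply: Bor_intl; exact: intl_seg.
have cseg n : hcard [set x | x < s n] (s n) by exact: hcard_seg.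
have iseg := seg_incr ss.
pose Y' := \bigcup_n Y n.
have BY' : Bor Y' by apply: Bor_bigcup => n; exact: Bor_intl (hcard_intl (cY n)).
have Y'X : Y' `<=` X by move=> x [n _ /YA/AX].
have up : pinj (core X) X.
  apply: pinj_subr Y'X; rewrite coreE.
  by apply: (pinj_incr iseg YY cseg cY) => //; rewrite -coreE.
split=> //.
have down : pinj Y' (core X) by rewrite coreE; exact: (pinj_incr YY iseg cY cseg).
apply: pinj_trans down.
pose Z := X `\` Y'.
have BZ : Bor Z by exact: Bor_setD.
rewrite (_ : X = Y' `|` Z); last by rewrite setDUK.
(* D is disjoint from [Y (n * 3)], so with N = 3n the near maximality of [a N] and N a <= (N + 1) s
   give N e <= s + c <= 3c. *)
have nZ n D : intl D -> D `<=` Z -> negl n c D.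
  move=> iD DZ; have [e ce he] := bX D iD (fun x Dx => (DZ x Dx).1).
  exists e => //.
  have Se : S (s (n * 3) + e).
    exists (Y (n * 3) `|` D).
      by move=> x [/YA/AX//|/DZ[]].
    by apply: hcardU => // x Yx /DZ[_]; apply; exists (n * 3).
  have h := near (n * 3) _ Se; have h1 := s1 (n * 3).
  have h2 := sa (n * 3); have h3 := S2 _ (Sa (n * 3)).
  hnia.
have ZB : exists2 B : nat -> set H, forall i, exists k, negl 1 (k *: c) (B i) &
                                    Z `<=` \bigcup_i B i.
  by have [B fB XB] := sigma; exists B => // x [/XB].
have cover := null_cover BZ ZB nZ.
(* Already [Y 2] has size comparable to c, which leaves room for the hotel. *)
have cs2 : c <= 3 *: s 2.
  by have h := near 2 c Sc; have h1 := s1 2; hlia.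
(* Nested sets [R j] of size s 2 / 2^j are chosen in [Y 2]; their successive differences have at
   least [q j.+1] elements and serve as rooms. *)
pose q j := hfun (fun u _ => u %/ 2 ^ j) (s 2) (s 2).
have qP j t : t <= q j <-> 2 ^ j *: t <= s 2.
  by split; rewrite /q; htransfer; rewrite leq_div_pow2.
have q2 j : 2 *: q j.+1 <= q j.
  apply/qP; have [+ _] := qP j.+1 (q j.+1).
  have -> : 2 ^ j *: (2 *: q j.+1) = 2 ^ j.+1 *: q j.+1.
    by htransfer; rewrite expnS; lia.
  by apply; hlia.
have [R HR] : exists R : nat -> set H, forall n,
    (hcard (R n) (q n) /\ R n `<=` Y 2) /\ R n.+1 `<=` R n.
  apply: (@dependent_sequence _ (fun n R => hcard R (q n) /\ R `<=` Y 2)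
    (fun _ R R' => R' `<=` R) (Y 2)).
    split=> //; rewrite (_ : q 0 = s 2) // /q.
    by htransfer; rewrite expn0 divn1.
  move=> n Rn [cR RY]; have [|B BR cB] := @hcard_exact _ _ (q n.+1) cR.
    by have := q2 n; hlia.
  by exists B => //; split=> //; exact: subset_trans RY.
have cR n : hcard (R n) (q n) by case: (HR n) => [[]].
have RY n : R n `<=` Y 2 by case: (HR n) => [[]].
have RR n : R n.+1 `<=` R n by case: (HR n).
have /choice [gTJ HgTJ] : forall j, exists gTJ : (set H * set H) * set H,
    [/\ intl gTJ.1.1, intl gTJ.1.2, hbij gTJ.1.1 gTJ.1.2 gTJ.2, Z `<=` gTJ.1.2 &
        gTJ.2 `<=` R j `\` R j.+1].
  (* The cover of Z has size at most c / (3 * 2^(j+1)), which is at most s 2 / 2^(j+1) by [cs2], so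
     it fits into room j. *)
  move=> j; have [T [t cT nT] ZT] := cover (3 * 2 ^ j.+1).
  have tq : t <= q j.+1 by apply/qP; hnia.
  have [|J JR cJ] := @hcard_exact _ _ t (hcardD (cR j.+1) (cR j) (RR j)).
    by have := q2 j; hlia.
  have [g ig gB] := hcard_bij cT cJ.
  by exists ((g, T), J); split=> //; exact: hcard_intl cT.
apply: (@pinj_hotel _ _ _ _ (fun j => (gTJ j).1.1)
  (fun j => (gTJ j).1.2) (fun j => (gTJ j).2)) => //.
- by move=> x Yx [_].
- by move=> j; case: (HgTJ j).
- by move=> j; case: (HgTJ j).
- by move=> j; case: (HgTJ j).
- by move=> j; case: (HgTJ j).
- by move=> j y; have [_ _ _ _ JR] := HgTJ j; move=> /JR[/RY ? _]; exists 2.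
- have L i j y : (i < j)%N -> (gTJ i).2 y -> ~ (gTJ j).2 y.
    move=> ij; have [_ _ _ _ Ji] := HgTJ i; have [_ _ _ _ Jj] := HgTJ j.
    move=> /Ji[_ nR] /Jj[Rj _]; apply: nR; exact: (decr_le RR ij).
  move=> i j y Ji Jj; have [ij|ij|//] := ltngtP i j.
    by case: (L _ _ _ ij Ji).
  by case: (L _ _ _ ij Jj).
Qed.

(** With the shift by one, an internal subset of size a contributes exactly the x < a. *)
Definition sizes X : set H := [set x | ge X (x + hcst W 1)].

Lemma sizes_le X x y : sizes X y -> x <= y -> sizes X x.
Proof. by move=> gX xy; apply: ge_le gX _; hlia. Qed.

(** Doubling gives a witness with n = 1, so the relative error disappears. *)
Lemma sizes_core X : (forall x, sizes X x -> sizes X (2 *: x + hcst W 1)) ->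
  sizes X = core X.
Proof.
move=> dX; apply/predeqP => x; split=> [/dX[A AX cA]|[n [A [a [AX cA h]]]]].
  by exists 1, A, (2 *: x + hcst W 1 + hcst W 1); split=> //; hlia.
have [|B BA cB] := @hcard_exact _ _ (x + hcst W 1) cA; first by hnia.
by exists B => //; exact: subset_trans BA AX.
Qed.

Lemma sizes_mul X x k : (forall x, sizes X x -> sizes X (2 *: x + hcst W 1)) ->
  sizes X x -> sizes X (k *: x).
Proof.
move=> dX Xx; suff h : sizes X (2 ^ k *: x).
  apply: sizes_le h _; htransfer; rewrite leq_mul2r ltnW ?orbT //; exact: ltn_expl.
elim: k => [|k /dX]; first by apply: sizes_le Xx _; hlia.
by move=> /sizes_le; apply; htransfer; rewrite expnS; lia.
Qed.

Lemma sizes_nonempty X x : X x -> sizes X (hcst W 0).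
Proof.
move=> Xx; have i1 : intl [set x].
  exact: (intl_fm (FEq (TV 0) (TV 1)) (fun=> x) (fun=> iint0 W)).
have [[B BX cB]|[m m1 cm]] := hcard_total (hcst W 0 + hcst W 1) i1.
  by exists B => // y /BX ->.
have E : m = hcst W 0 by hlia.
rewrite E in cm; have [F _ [tot _]] := hcard_bij cm (hcard0 W).
by have [y []] := tot x erefl.
Qed.

(** Cofinality excludes a size above every [c n], so [covered_or_ge] covers X by internal sets with
    sizes in the cut. Both injections then come from [pinj_incr]. *)
Lemma sizes_countable X (c : nat -> H) : Bor X ->
  (forall x, sizes X x -> sizes X (2 *: x + hcst W 1)) ->
  (forall n, sizes X (c n)) -> (forall x, sizes X x -> exists n, x <= c n) ->
  [/\ Bor (sizes X), pinj X (sizes X) & pinj (sizes X) X].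
Proof.
move=> BX dX cX cof.
have cS k : exists k', c k < c k'.
  by have [k' h] := cof _ (dX _ (cX k)); exists k'; hlia.
have sE : sizes X = \bigcup_n [set x | x <= c n].
  apply/predeqP => x; split=> [/cof[n xn]|[n _]]; first by exists n.
  exact: sizes_le.
have BS : Bor (sizes X).
  by rewrite sE; apply: Bor_bigcup => n; apply: Bor_intl; exact: intl_seg.
split=> //.
- have [[B fB XB]|[x cx gx]] := covered_or_ge BX cS; last first.
    have [|n h] := cof (x - hcst W 1).
      by apply: ge_le gx _; have := cx 0; hlia.
    by have [k' h'] := cS n; have h1 := cx k'; hlia.
  have iB i : intl (B i) by have [n /negl_intl] := fB i.
  (* Closure under doubling keeps the sizes of finite unions below some [c k]. *)
  have /choice [b Hb] : forall n, exists b, hcard (finU B n) b /\ exists k, b <= c k.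
    elim=> [|n [b [cb [k bk]]]].
      exists (hcst W 0); rewrite finU0; split; first exact: hcard0.
      by exists 0; hlia.
    have [k' [e ce he]] := fB n.
    have [d de cd] := hcardUle cb ce; exists d; rewrite finUS; split=> //.
    have [l|l] : c k <= c k' \/ c k' <= c k by hlia.
      by have [k1 h] := cof _ (dX _ (cX k')); exists k1; hlia.
    by have [k1 h] := cof _ (dX _ (cX k)); exists k1; hlia.
  have bb n : b n <= b n.+1.
    have [e ea /(hcard_uniq (Hb n).1) -> //] :=
      hcard_sub (Hb n.+1).1 (intl_finU n iB) (@finU_incr B n).
  apply: (@pinj_subr _ _ _ (\bigcup_n [set x | x < b n])); last first.
    move=> x [n _ /= xb]; have [k bk] := (Hb n).2.
    by apply: sizes_le (cX k) _; hlia.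
  apply: (pinj_incr (@finU_incr B) (seg_incr bb) (fun n => (Hb n).1)) => //.
    by move=> n; exact: hcard_seg.
  by move=> x /XB[i _ Bx]; exists i.+1 => //; exists i.
- have /choice [A HA] : forall n, exists A, A `<=` X /\ hcard A (c n + hcst W 1).
    by move=> n; have [A ? ?] := cX n; exists A.
  have iA n : intl (A n) by exact: hcard_intl (HA n).2.
  have AX n : finU A n `<=` X by move=> x [k _]; exact: (HA k).1.
  have /choice [a Ha] : forall n, exists a, hcard (finU A n) a.
    elim=> [|n [a ca]]; first by exists (hcst W 0); rewrite finU0; exact: hcard0.
    by have [d _ cd] := hcardUle ca (HA n).2; exists d; rewrite finUS.
  have aa n : a n <= a n.+1.
    have [e ea /(hcard_uniq (Ha n)) -> //] :=
      hcard_sub (Ha n.+1) (intl_finU n iA) (@finU_incr A n).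
  apply: (@pinj_subr _ _ _ (\bigcup_n finU A n)); last by move=> x [n _ /AX].
  apply: (pinj_incr (seg_incr aa) (@finU_incr A) _ Ha) => //.
    by move=> n; exact: hcard_seg.
  move=> x /cof[n xn]; exists n.+1 => //=.
  have [|e ea ce] := hcard_sub (Ha n.+1) (iA n); first by move=> y ?; exists n.
  by have E := hcard_uniq (HA n).2 ce; subst e; hlia.
Qed.
End Cases.

(** * Sizes without a countable cofinal sequence, and the equivalence of X with its core *)

Section Main.
Variables (V : superstructure) (W : nonstandard_universe V).
Local Notation H := (hnat W).
Local Notation IS := (iint W).
Local Open Scope hyper_scope.
Implicit Types (A B C D E F G X Y Z : set H) (a b c d e x y z : H).

(** The scheme has countably many nodes, so those of their sizes that lie in the cut have a common
    bound x in it. A branch whose nodes all have at least k x elements for every k thus avoids all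
    sizes in the cut, while any size common to all its nodes is realized inside X. *)
Lemma sizes_branch X x0 : Bor X ->
  (forall x, sizes X x -> sizes X (2 *: x + hcst W 1)) -> sizes X x0 ->
  (forall c : nat -> H, (forall n, sizes X (c n)) ->
     exists2 x, sizes X x & forall n, c n < x) ->
  exists P : nat -> set H, [/\ forall n, intl (P n), forall n, P n.+1 `<=` P n,
    \bigcap_n P n `<=` X & forall z, sizes X z <-> forall n, ge (P n) (z + hcst W 1)].
Proof.
move=> BX dX X0 unb.
have [A [iA dA EX]] := souslin_mono (Bor_souslin BX).
(* [c i] is the size of node i if that size lies in the cut, and the default [x0] otherwise. *)
have /choice [c Hc] : forall i, exists d, sizes X d /\ forall s e,
    unpickle i = Some s -> hcard (A s) e -> sizes X e -> d = e.
  move=> i; have [[s [e [us ce Xe]]]|N] := EM (exists (s : seq nat) e,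
      [/\ unpickle i = Some s, hcard (A s) e & sizes X e]).
    exists e; split=> // s' e'; rewrite us => -[<-] ce' _.
    exact: hcard_uniq ce ce'.
  by exists x0; split=> // s e us ce Xe; case: N; exists s, e.
have [x Xx cx] := unb c (fun i => (Hc i).1).
have [y Xy xy] := unb (fun k => k *: x) (fun k => sizes_mul k dX Xx).
have [[B fB AB]|[f Hf]] := souslin_dichotomy (fun k => k *: x) iA.
  (* By saturation finitely many of the covering sets would already cover C, whose size y + 1
     exceeds all standard multiples of x. *)
  exfalso; have [C CX cC] := Xy.
  have iB i : intl (B i) by have [n /negl_intl] := fB i.
  have [n Cn] : exists n, C `<=` finU B n.
    by apply: sat_cover (hcard_intl cC) iB _ => z /CX; rewrite EX => /AB.
  have [k [e ce ke]] : exists k, negl 1 (k *: x) (finU B n).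
    elim: (n) => [|m [k [e ce ke]]].
      by exists 0, (hcst W 0); [rewrite finU0; exact: hcard0 | hlia].
    have [k' [e' ce' ke']] := fB m; have [d de cd] := hcardUle ce ce'.
    by exists (k + k')%N, d; [rewrite finUS | hnia].
  have [e' e'e /(hcard_uniq cC) E] := hcard_sub ce (hcard_intl cC) Cn.
  by subst e'; have h := xy k; hlia.
have dP n : A (mkseq f n.+1) `<=` A (mkseq f n) by rewrite mkseqS; exact: dA.
exists (fun n => A (mkseq f n)); split=> //.
  by move=> z Az; rewrite EX; exists f => n; exact: Az.
move=> z; split=> [Xz n|gz].
  have [[C CA cC]|[m mz cm]] := hcard_total (z + hcst W 1) (iA (mkseq f n)).
    by exists C.
  have Xm : sizes X m by apply: sizes_le Xz _; hlia.
  have E := (Hc (pickle (mkseq f n))).2 _ _ (pickleK _) cm Xm.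
  (* The node has at least x elements, whereas x was chosen above its size m. *)
  have [C CA cC] := Hf n 1.
  have [e em /(hcard_uniq cC) E'] := hcard_sub cm (hcard_intl cC) CA.
  by have h := cx (pickle (mkseq f n)); rewrite E in h; exfalso; hlia.
have [C cC CA] := sat_ge (fun n => iA (mkseq f n)) dP gz.
by exists C => // u Cu; rewrite EX; exists f => n; exact: CA.
Qed.

Lemma ge_hcard B d x : hcard B d -> ge B x <-> x <= d.
Proof.
move=> cB; split=> [[C CB cC]|xd]; last exact: hcard_exact cB xd.
by have [e ed /(hcard_uniq cC) ->] := hcard_sub cB (hcard_intl cC) CB.
Qed.

(** Saturation gives one internal set with subsets of every size inside the intersection; its
    enumeration is internal. *)
Lemma infinite_pinj (P : nat -> set H) : (forall n, intl (P n)) ->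
  (forall n, P n.+1 `<=` P n) -> (forall n x, ge (P n) x) ->
  pinj setT (\bigcap_n P n).
Proof.
move=> /[dup] iP /choice [p Ep] dP gP.
pose f := FAnd (Fsub 0 1)
  (FAllN 0 (FExS 1 (FAnd (Fsub 1 0) (FC scard 1 (TV 0))))).
have [|b Hb] := @set_saturation _ W (fun=> f) (fun _ _ => hcst W 0) (fun n _ => p n).
  move=> n; exists (p n) => k kn; split=> [x|x].
    by rewrite -[hmem _ _]/(ext (p n) x) Ep => /(decr_le dP kn); rewrite -Ep.
  have [C CP [c Ec cc]] := gP n x; exists c; split=> // y.
  by rewrite -Ec -Ep in CP; exact: CP.
have [||F [iF [tot [fct inj]]]] := @hinfinite_inj _ W (ext b).
- by exists b.
- move=> n; have [c [cb cc]] := (Hb 0).2 n.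
  by exists (ext c); [exact: cb | exists c].
exists (fun x y => F (hpair x y)); split=> //.
- exists (fun=> setT), (fun=> F); split=> // [_|x y]; first exact: Bor_intl (intlT W).
  by split=> [?|[_ []//]]; exists 0.
- move=> x _; have [y [By Fy]] := tot x; exists y => // n _.
  by rewrite -Ep; exact: (Hb n).1.
Qed.

Lemma sizes_uncountable X x0 : Bor X ->
  (forall x, sizes X x -> sizes X (2 *: x + hcst W 1)) -> sizes X x0 ->
  (forall c : nat -> H, (forall n, sizes X (c n)) ->
     exists2 x, sizes X x & forall n, c n < x) ->
  [/\ Bor (sizes X), pinj X (sizes X) & pinj (sizes X) X].
Proof.
move=> BX dX X0 unb; have [P [iP dP PX PE]] := sizes_branch BX dX X0 unb.
have BS : Bor (sizes X).
  have -> : sizes X = \bigcap_n [set z | ge (P n) (z + hcst W 1)].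
    by apply/predeqP => z; split=> [/PE gz n _|gz]; [|apply/PE => n]; exact: gz.
  apply: Bor_bigcap => n; apply: Bor_intl; have [p Ep] := iP n.
  have [b Hb] := comprehension (FExS 1 (FAnd (Fsub 1 0)
    (FC scard 1 (TF addn (TV 0) (TC 1))))) (fun=> hcst W 0) (fun=> p).
  exists b; apply/predeqP => z; rewrite /= -Ep; split.
    by move=> /Hb[c [cp cc]]; exists (ext c); [exact: cp | exists c].
  move=> [C cp [c Ec cc]]; rewrite -Ec in cp; apply/Hb; exists c.
  by split=> // y; exact: cp.
split=> //.
  have [allS|/existsNP[z0 nz0]] := EM (forall z, sizes X z).
    by apply: pinj_sub.
  have [n0 [d0 cd0]] : exists n d, hcard (P n) d.
    have [N|N] := EM (forall n, ge (P n) (z0 + hcst W 1)); first by case: nz0; apply/PE.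
    move/existsNP: N => [n ng]; exists n.
    have [[C CP cC]|[m _ cm]] := hcard_total (z0 + hcst W 1) (iP n); last by exists m.
    by case: ng; exists C.
  (* Nodes before n0 may have no hyperfinite size, so the sequence starts at n0. *)
  have /choice [d Hd] : forall n, exists d, hcard (P (n0 + n)%N) d.
    move=> n; have [d _ cd] := hcard_sub cd0 (iP _) (decr_le dP (leq_addr n n0)).
    by exists d.
  have SE z : sizes X z <-> forall n, z < d n.
    split=> [/PE gz n|h]; first by have /(ge_hcard _ (Hd n)) := gz (n0 + n)%N; hlia.
    apply/PE => n; have [C CP cC] : ge (P (n0 + n)%N) (z + hcst W 1).
      by apply/(ge_hcard _ (Hd n)); have := h n; hlia.
    by exists C => //; apply: subset_trans CP _; apply: (decr_le dP); exact: leq_addl.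
  have nd n : ~ sizes X (d n) by move=> /SE/(_ n); hlia.
  have d1 n : x0 < d n by move/SE: X0.
  (* [d n] lies outside the cut, which is closed under standard multiples, so every internal subset
     of X is null at scale [d n]. [null_cover] then encloses X in an internal set of size at most
     [d n]. *)
  have /choice [T HT] : forall n, exists T, negl 1 (d n) T /\ X `<=` T.
    move=> n; suff h : forall m, exists2 C, negl m (d n) C & X `<=` C.
      by have [T ? ?] := h 1; exists T.
    apply: null_cover => //.
      have [k|[B fB XB]|[x dx gx]] := @covered_or_ge _ _ X (fun k => k *: d n) BX.
      - by exists k.+1; have h := d1 n; hnia.
      - by exists B.
      - case: (nd n); apply: ge_le gx _; have h := dx 2; have h' := d1 n; hlia.
    move=> m A iA AX; have [[C CA cC]|[e el ce]] := hcard_total (d n + hcst W 1) iA.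
      by case: (nd n); exists C => //; exact: subset_trans CA AX.
    exists e => //.
    have [l|l] : m *: e <= d n \/ d n <= m *: e by hlia.
      by [].
    have [e0|e0] : e = hcst W 0 \/ hcst W 0 < e by hlia.
      by rewrite e0; hnia.
    case: (nd n); apply: sizes_le l; apply: sizes_mul => //.
    apply: (@sizes_le _ _ _ _ (2 *: (e - hcst W 1) + hcst W 1)); last by hlia.
    apply: dX; exists A => //.
    by rewrite (_ : e - hcst W 1 + hcst W 1 = e) //; hlia.
  pose T' n := [set x | forall k, (k < n.+1)%N -> T k x].
  have dT n : T' n.+1 `<=` T' n by move=> x h k kn; apply: h; lia.
  have iT n : intl (T' n) by apply: intl_finI => k; exact: negl_intl (HT k).1.
  have /choice [t Ht] : forall n, exists t, hcard (T' n) t /\ t <= d n.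
    move=> n; have [e ce he] := (HT n).1.
    have [|t te ct] := hcard_sub ce (iT n); first by move=> x; apply.
    by exists t; split=> //; hlia.
  have tt n : t n.+1 <= t n.
    by have [e ea /(hcard_uniq (Ht n.+1).1) ->] := hcard_sub (Ht n).1 (iT n.+1) (@dT n).
  apply: (@pinj_subr _ _ _ (\bigcap_n [set x | x < t n])); last first.
    move=> x h; apply/SE => n; have /= := h n Logic.I; have [_ h2] := Ht n; hlia.
  apply: (pinj_decr dT _ (fun n => (Ht n).1)) => //.
  - by move=> n x /=; have := tt n; hlia.
  - by move=> n; exact: hcard_seg.
  - by move=> x Xx n _ k _; exact: (HT k).2.
apply: (pinj_subr _ PX).
have [allP|/existsNP[n0 /existsNP[z0 nz0]]] := EM (forall n x, ge (P n) x).
  apply: (@pinj_subl _ _ setT) => //; exact: infinite_pinj.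
have [d0 cd0] : exists d, hcard (P n0) d.
  have [[C CP cC]|[m _ cm]] := hcard_total z0 (iP n0); last by exists m.
  by case: nz0; exists C.
have /choice [d Hd] : forall n, exists d, hcard (P (n0 + n)%N) d.
  move=> n; have [d _ cd] := hcard_sub cd0 (iP _) (decr_le dP (leq_addr n n0)).
  by exists d.
apply: (@pinj_subr _ _ _ (\bigcap_n P (n0 + n)%N)); last first.
  by move=> x h n _; apply: (decr_le dP (leq_addl n0 n)); exact: h.
have dd n : d n.+1 <= d n.
  have [|e ea /(hcard_uniq (Hd n.+1)) -> //] := hcard_sub (Hd n) (iP (n0 + n.+1)%N).
  by rewrite addnS; exact: dP.
apply: (pinj_decr (B := fun n => [set x | x < d n]) _ _ _ Hd) => //.
- by move=> n x /=; have := dd n; hlia.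
- by move=> n; rewrite addnS; exact: dP.
- by move=> n; exact: hcard_seg.
- by move=> z /PE gz n _ /=; have /(ge_hcard _ (Hd n)) := gz (n0 + n)%N; hlia.
Qed.

Lemma core_equiv X : Bor X -> [/\ Bor (core X), pinj X (core X) & pinj (core X) X].
Proof.
move=> BX; have [dX|/existsNP[x /not_implyP[Xx nX]]] :=
    EM (forall x, sizes X x -> sizes X (2 *: x + hcst W 1)); last first.
  (* If doubling fails at x, then X has an internal subset of size c = x + 1 but none of size 2c. *)
  apply: (@core_bounded _ _ X (x + hcst W 1)) => //; first by hlia.
  move=> A iA AX; apply: negl_of_notge => // -[B BA cB]; apply: nX.
  exists B; first exact: subset_trans BA AX.
  by rewrite (_ : 2 *: x + hcst W 1 + hcst W 1 = 2 *: (x + hcst W 1)) //; hlia.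
have [[x0 /sizes_nonempty X0]|N] := EM (exists x, X x); last first.
  have E : X = set0 by apply/predeqP => x; split=> // Xx; case: N; exists x.
  have -> : core X = set0.
    apply/predeqP => x; split=> // -[n [A [a [AX cA h]]]].
    rewrite E in AX; have A0 : A = set0 by apply/predeqP => y; split=> // /AX.
    by rewrite A0 in cA; have e := hcard_uniq cA (hcard0 W); exfalso; hnia.
  rewrite E; have B0 : Bor (set0 : set H) by exact: Bor_intl (intl0 W).
  by split=> //; exact: pinj_sub.
rewrite -sizes_core //.
have [[c [cX cof]]|N'] := EM (exists c : nat -> H, (forall n, sizes X (c n)) /\
   forall x, sizes X x -> exists n, x <= c n); first exact: sizes_countable cX cof.
apply: (sizes_uncountable BX dX X0) => c cX; apply: contrapT => N2; apply: N'.
exists c; split=> // x Xx; apply: contrapT => N3; apply: N2; exists x => // n.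
apply: contrapT => N4; apply: N3; exists n; hlia.
Qed.

(** * Passage between subsets of the universe and sets of hyperintegers *)

Lemma trace_internal (a : W) : exists A : IS, forall x, hmem x A <-> imem (sval x) a.
Proof.
have [b ab] := internal_star a.
have := @def_valid _ _ _ _ (fun=> b)
  (def_ex (powN V) (def_all (naturals V) (def_bi (def_mem W 0 1)
   (def_mem W 0 2)))) (fun=> star_inh ab).
move=> /(_ _ (fun=> a)) [|//|A AP h].
  move=> e _; exists (cset V [set n | smem (num V n) (e 0)]).
    by apply/powNP; eexists.
  by move=> _ /naturalsP[n ->] /=; rewrite smem_cset.
by exists (to_iint AP) => x; exact: h (svalP x).
Qed.

Local Notation up X := ((fun x : H => sval x) @` X).
Local Notation down X := ([set x : H | X (sval x)]).

Lemma borel_in_Bor (X : set W) : borel_in (hypernat W) X ->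
  X `<=` iset (hypernat W) /\ Bor (down X).
Proof.
move: X; apply: smallest_sub.
  split=> [|A [AN BA]|A HA].
  - by split=> //; exact: Bor_intl (intl0 W).
  - split; first by move=> x [].
    rewrite (_ : down _ = ~` down A); first exact: Bor_setC.
    by apply/predeqP => x; split=> [[]|nA] //; split=> //; exact: (svalP x).
  - split; first by move=> x [i _ /(HA i).1].
    rewrite (_ : down _ = \bigcup_i down (A i)) //.
    by apply: Bor_bigcup => i; exact: (HA i).2.
move=> A [AN [a _ E]]; split=> //; apply: Bor_intl.
have [b Hb] := trace_internal a; exists b; apply/predeqP => x.
by rewrite /ext /= Hb -E.
Qed.

Lemma Bor_borel_in X : Bor X -> borel_in (hypernat W) (up X).
Proof.
move: X; apply: Bor_ind => [_ [a <-]|A BA|A BA].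
- apply: sub_sigma_algebra; split; first by move=> _ [x _ <-]; exact: (svalP x).
  exists (sval a) => //; apply/predeqP => v; split=> [va|[x xa <-] //].
  by exists (to_hnat (iint_sub va)).
- rewrite (_ : up _ = iset (hypernat W) `\` up A); first exact: sigma_algebraCD.
  apply/predeqP => v; split=> [[x nA <-]|[vN nA]].
    by split; [exact: (svalP x) | move=> [y Ay /sval_inj E]; apply: nA; rewrite -E].
  by exists (to_hnat vN) => // Av; apply: nA; exists (to_hnat vN).
- rewrite image_bigcup; exact: sigma_algebra_bigcup.
Qed.

Lemma Bor_borel_pairs G : Bor G -> borel_in (star W (npairs V)) (@decode V W @` G).
Proof.
move: G; apply: Bor_ind => [_ [a <-]|A BA|A BA].
- have [b Hb] := decode_image a.
  apply: sub_sigma_algebra; split; first by move=> _ [z _ <-]; exact: decode_mem.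
  exists b => //; apply/predeqP => p; rewrite [iset b p]Hb.
  by split=> [[z za ->]|[z za <-]]; exists z.
- rewrite (_ : @decode V W @` _ = iset (star W (npairs V)) `\` (@decode V W @` A)).
    exact: sigma_algebraCD.
  apply/predeqP => p; split=> [[z nA <-]|[/decode_onto[z ->] nA]].
    split; first exact: decode_mem.
    by move=> [y Ay /decode_inj E]; apply: nA; rewrite -E.
  by exists z => // Az; apply: nA; exists z.
- rewrite image_bigcup; exact: sigma_algebra_bigcup.
Qed.

(** The ambient set is arbitrary here; pulling back along [decode] preserves internal sets and
    Boolean operations, so the graph becomes a Borel set of codes. *)
Lemma borel_Bor_pairs (G : set W) : borel G -> Bor [set z | G (decode z)].
Proof.
move=> [Z]; move: G; apply: smallest_sub.
  have iZ (a : W) : intl [set z | iset a (decode z)].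
    by have [b Hb] := decode_preimage a; exists b; apply/predeqP => z; exact: Hb.
  split=> [|A BA|A BA].
  - exact: Bor_intl (intl0 W).
  - by apply: (@Bor_setD _ _ [set z | iset Z (decode z)] _ _ BA); exact: Bor_intl.
  - exact: (@Bor_bigcup _ _ (fun i => [set z | A i (decode z)]) BA).
move=> A [_ [a _ <-]]; apply: Bor_intl.
by have [b Hb] := decode_preimage a; exists b; apply/predeqP => z; exact: Hb.
Qed.

Lemma pinj_borel_le X Y : pinj X Y -> borel_le (up X) (up Y).
Proof.
move=> /pinj_graph[G [BG GXY tot G1 G2]].
have /choice [f Hf] : forall w : W, exists v,
    forall z, G z -> sval z.1h = w -> v = sval z.2h.
  move=> w; have [[z Gz zw]|N] := EM (exists2 z, G z & sval z.1h = w).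
    exists (sval z.2h) => z' Gz' z'w; rewrite (G1 z z') //.
    by apply: sval_inj; rewrite zw.
  (* Outside the domain of G the value is the default w. *)
  by exists w => z Gz zw; case: N; exists z.
have fE z : G z -> f (sval z.1h) = sval z.2h by move=> Gz; exact: (Hf _ z).
exists f; split.
- by move=> _ [x /tot[z Gz <-] <-]; rewrite fE //; exists z.2h => //; exact: (GXY z Gz).2.
- move=> _ _ /set_mem[x /tot[z Gz <-] <-] /set_mem[x' /tot[z' Gz' <-] <-].
  by rewrite !fE // => /sval_inj E; rewrite (G2 z z').
- exists (star W (npairs V)); rewrite (_ : graph _ _ = @decode V W @` G).
    exact: Bor_borel_pairs.
  apply/predeqP => p; split=> [[_ [[x /tot[z Gz <-] <-]]]|[z Gz <-]].
    rewrite fE // => /decode_pair ->; rewrite hpairK; by exists z.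
  exists (sval z.1h); split; first by exists z.1h => //; exact: (GXY z Gz).1.
  by rewrite fE //; exact: decodeP.
Qed.
End Main.

Theorem theorem3p1 (V : superstructure) (W : nonstandard_universe V)
    (X : set W) (X_borel : borel_in (hypernat W) X) :
  exists U : set W,
    [/\ borel_cut U,
        borel_equiv X U &
        forall U' : set W,
          borel_cut U' -> borel_equiv X U' -> U' `<=` U -> U' = U].
Proof.
have [XN BX] := borel_in_Bor X_borel.
set X' := [set x : hnat W | X (sval x)] in BX.
have XE : X = (fun x : hnat W => sval x) @` X'.
  apply/predeqP => w; split=> [Xw|[x Xx <-] //].
  by exists (to_hnat (XN w Xw)).
have [BU XU UX] := core_equiv BX.
exists ((fun x : hnat W => sval x) @` core X'); split.
- split; last exact: Bor_borel_in.
  split; first by move=> _ [x _ <-]; exact: (svalP x).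
  move=> x _ xN [y Uy <-] [p [pxy plt]]; exists (to_hnat xN) => //.
  (* [nat_lt V] unfolds to [crel (num V) nlt], so [hlt] agrees with the order on [hnat]. *)
  by apply: core_cut Uy _; exists p.
- by rewrite XE; split; exact: pinj_borel_le.
move=> U' [[U'N cU'] _] [[f [fXU finj BG]] _] U'U; apply/seteqP; split=> // _ [x Ux <-].
apply: contrapT => nU'.
(* A cut that misses x lies entirely below x. *)
have small (y : hnat W) : U' (sval y) -> hrel nlt y x.
  move=> U'y; apply: contrapT => nyx; apply: nU'.
  have [->//|[p pl pxy]] : x = y \/ hrel nlt x y by hlia.
  by apply: (cU' _ (sval y)) => //; [exact: (svalP x) | exists p].
have [n [A [a [AX cA h]]]] := Ux.
(* The coded graph of f restricted to A: a Borel injection of A into the segment below x, which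
   [Bor_inj_card] excludes. *)
pose G := [set z | graph X f (decode z)] `&`
  [set z | A (hfun (fun u _ => cfst u) z z)].
have GE z : graph X f (decode z) -> X (sval (hfun (fun u _ => cfst u) z z)) /\
    f (sval (hfun (fun u _ => cfst u) z z)) = sval (hfun (fun u _ => csnd u) z z).
  by move=> [w [Xw /(pair_inj (decodeP z)) [-> ->]]].
apply: (@Bor_inj_card _ _ A a x n G cA _ _ _ _ _ h).
- apply: Bor_setI; first exact: borel_Bor_pairs.
  apply: Bor_intl; have [b <-] := hcard_intl cA.
  exact: (intl_fm (FM (tfst (TV 0)) 0)
    (fun=> hcst W 0) (fun=> b)).
- move=> z [/GE[Xz fz] Az]; split=> //; apply: small; rewrite -fz; exact: fXU.
- move=> u Au; have Xu := AX u Au; have fU' := fXU _ Xu.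
  exists (hfun cpair u (to_hnat (U'N _ fU'))); last by rewrite hfstE.
  split; last by rewrite /= hfstE.
  exists (sval u); split=> //.
  by have := decodeP (hfun cpair u (to_hnat (U'N _ fU'))); rewrite hfstE hsndE.
- move=> z z' [/GE[_ fz] _] [/GE[_ fz'] _] E.
  rewrite -(hpairK z) -(hpairK z') E; congr hfun; apply: sval_inj.
  by rewrite -fz -fz' E.
- move=> z z' [/GE[Xz fz] _] [/GE[Xz' fz'] _] E.
  rewrite -(hpairK z) -(hpairK z') E; congr hfun; apply: sval_inj.
  by apply: finj; rewrite ?fz ?fz' ?E //; exact: mem_set.
Qed.
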